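(* Let $r\geq 1$ be an integer and let $(\bm{a},\bm{j})=\big((a_i,j_i)\big)_{i=0}^{r-1}\in\mathcal{P}^r$. Then $\mathcal{A}_r\cdot E(\bm{a},\bm{j})$ is a symmetric $k$-algebra.
   Context: Let $k$ be an algebraically closed field of characteristic $p>0$. The hyperalgebra. Let $X,Y,H$ be the standard basis of $\mathfrak{sl}_2(\mathbb{C})$ ($X$ upper triangular nilpotent, $Y$ lower triangular nilpotent, $H=\mathrm{diag}(1,-1)$). Let $\mathcal{U}_{\mathbb{Z}}$ be the subring of the universal enveloping algebra of $\mathfrak{sl}_2(\mathbb{C})$ generated by $X^{(m)}=X^m/m!$ and $Y^{(m)}=Y^m/m!$ ($m\geq 0$). Put $\binom{H+c}{m}=\frac{(H+c)(H+c-1)\cdots(H+c-m+1)}{m!}$ for $c\in\mathbb{Z}$, $m\geq 0$. The elements $Y^{(m)}\binom{H}{n}X^{(m')}$ ($m,n,m'\geq 0$) form a $\mathbb{Z}$-basis of $\mathcal{U}_{\mathbb{Z}}$. Let $\mathcal{U}=\mathcal{U}_{\mathbb{Z}}\otimes_{\mathbb{Z}}k$ (the hyperalgebra of $\mathrm{SL}_2(k)$); the same notation is used for images in $\mathcal{U}$. For $r\geq 1$, $\mathcal{U}_r$ is the subalgebra of $\mathcal{U}$ generated by $X^{(p^i)},Y^{(p^i)}$ with $0\leq i\leq r-1$. Let $\mathcal{A}$ be the subalgebra of $\mathcal{U}$ generated by all $\binom{H}{p^i}$ and $Y^{(p^i)}X^{(p^i)}$ ($i\geq 0$), and $\mathcal{A}_r=\mathcal{A}\cap\mathcal{U}_r$;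 $\mathcal{A}_r$ is commutative, is generated by $\binom{H}{p^i}$ and $Y^{(p^i)}X^{(p^i)}$ with $0\leq i\leq r-1$, and has the $k$-basis $Y^{(m)}\binom{H}{n}X^{(m)}$, $0\leq m,n\leq p^r-1$. Let $\mathrm{Fr}':\mathcal{U}\to\mathcal{U}$ be the $k$-linear map with $Y^{(m)}\binom{H}{n}X^{(m')}\mapsto Y^{(mp)}\binom{H}{np}X^{(m'p)}$. For $a\in\mathbb{Z}$ put $\mu_a=\binom{H-a-1}{p-1}\in\mathcal{U}$. The elements $B^{(\varepsilon)}(a,j)$, $\varepsilon\in\{0,1\}$. If $p$ is odd: $\mathcal{S}=\{0,1,\dots,(p-1)/2\}$ (also identified with its image in $\mathbb{F}_p$), $\mathcal{P}=\{0,1,\dots,p-1\}\times\mathcal{S}$. In $\mathbb{F}_p[x]$ put $\psi(x)=\prod_{i\in\mathbb{F}_p}(x-i^2)$, $\psi^{(1)}_j(x)=\psi(x)/(x-j^2)$ for $j\in\mathcal{S}$, $\psi^{(0)}_0(x)=\prod_{i\in\mathbb{F}_p^\times}(x-i^2)$, and $\psi^{(0)}_s(x)=2x(x+s^2)\prod_{i\in\mathbb{F}_p^\times\setminus\{s,p-s\}}(x-i^2)$ for $s\in\mathcal{S}\setminus\{0\}$. Set $B^{(\varepsilon)}(a,j)=\psi^{(\varepsilon)}_j\big(\mu_aYX+((a+1)/2)^2\big)\cdot\mu_a$ for $(a,j)\in\mathcal{P}$. If $p=2$: $\mathcal{P}=\{(0,1/2),(1,0),(1,1)\}$ and $B^{(0)}(0,1/2)=\mu_0$,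 $B^{(1)}(0,1/2)=\mu_0YX$, $B^{(0)}(1,0)=B^{(1)}(1,0)=\mu_1YX$, $B^{(0)}(1,1)=B^{(1)}(1,1)=\mu_1YX+\mu_1$. Types. $(a,j)\in\mathcal{P}$ is of type (A) if $a$ is even and $(p-a+1)/2\leq j\leq(p-1)/2$; (B) if $a$ is even and $0\leq j\leq(p-a-1)/2$; (C) if $a$ is odd and $0\leq j\leq(a-1)/2$; (D) if $a$ is odd and $(a+1)/2\leq j\leq(p-1)/2$. For $p=2$ the pairs $(0,1/2),(1,0),(1,1)$ are of type (B), (C), (D) respectively. For types (A) and (C) put $s(a,j)=(p-a+1)/2$ if $p$ is odd and $a$ is even, $s(a,j)=(p-a)/2$ if $p$ and $a$ are odd, and $s(a,j)=1$ if $p=2$. The maps $Z^{(\varepsilon)}$. Each $B^{(\varepsilon)}(a,j)$ can be written uniquely as $\mu_a\sum_{m=0}^{p-1}c^{(\varepsilon)}_mY^mX^m$ with $c^{(\varepsilon)}_m\in\mathbb{F}_p$; for types (A), (C) one has $c_m^{(\varepsilon)}=0$ for $m<s(a,j)$. For $z\in\mathcal{U}$ define $Z^{(\varepsilon)}(z;(a,j))=\mu_a\sum_{m=s(a,j)}^{p-1}c^{(\varepsilon)}_mY^mX^{m-s(a,j)}\,\mathrm{Fr}'(z)\,X^{s(a,j)}$ for types (A), (C), and $Z^{(\varepsilon)}(z;(a,j))=\mathrm{Fr}'(z)B^{(\varepsilon)}(a,j)$ for types (B), (D). The elements $B^{(\bm{\varepsilon})}(\bm{a},\bm{j})$. For $\bm{\varepsilon}=(\varepsilon_0,\dots,\varepsilon_{r-1})\in\{0,1\}^r$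 and $(\bm{a},\bm{j})=\big((a_i,j_i)\big)_{i=0}^{r-1}\in\mathcal{P}^r$ (with $\bm{a}=(a_0,\dots,a_{r-1})$, $\bm{j}=(j_0,\dots,j_{r-1})$), define recursively $B^{(\bm{\varepsilon})}(\bm{a},\bm{j})=B^{(\varepsilon_0)}(a_0,j_0)$ if $r=1$, and $B^{(\bm{\varepsilon})}(\bm{a},\bm{j})=Z^{(\varepsilon_0)}\big(B^{(\varepsilon_1,\dots,\varepsilon_{r-1})}((a_1,\dots,a_{r-1}),(j_1,\dots,j_{r-1}));(a_0,j_0)\big)$ if $r\geq 2$. These lie in $\mathcal{A}_r$. Idempotents. $E(\bm{a},\bm{j})=B^{(0,\dots,0)}(\bm{a},\bm{j})$. The elements $E(\bm{a},\bm{j})$, $(\bm{a},\bm{j})\in\mathcal{P}^r$, are pairwise orthogonal idempotents of $\mathcal{A}_r$ with sum $1$; $\mathcal{A}_r\cdot E(\bm{a},\bm{j})$ is regarded as a $k$-algebra with unity $E(\bm{a},\bm{j})$. *)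

(* Defs.v *)
From HB Require Import structures.
From mathcomp Require Import all_boot all_order all_algebra.
From mathcomp Require Import boolp classical_sets.
From mathcomp Require Import complex.
From Stdlib Require Rdefinitions.
From mathcomp Require Import Rstruct.

Set Implicit Arguments.
Unset Strict Implicit.
Unset Printing Implicit Defensive.

Import Order.TTheory GRing.Theory Num.Theory.

Local Open Scope classical_set_scope.
Local Open Scope ring_scope.
Local Open Scope quotient_scope.

(* The associative unital K-algebra generated by G subject to the relations   *)
(* [rel]: formal expressions modulo the congruence generated by [rel] and the *)
(* axioms of K-algebras, i.e. the free K-algebra on G modulo the two-sided    *)
(* ideal generated by the relations.                                          *)

Inductive aexpr (K G : Type) : Type :=
| AGen of G
| AScal of K
| AAdd of aexpr K G & aexpr K G
| AMul of aexpr K G & aexpr K G.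
Arguments AGen {K G} _.
Arguments AScal {K G} _.

HB.instance Definition _ (K G : Type) := gen_eqMixin (aexpr K G).
HB.instance Definition _ (K G : Type) := gen_choiceMixin (aexpr K G).

Section Presentation.
Variables (K : fieldType) (G : Type).
Local Notation expr := (aexpr K G).
Variable rel : expr -> expr -> Prop.

Inductive acong : expr -> expr -> Prop :=
| acong_rel s t : rel s t -> acong s t
| acong_refl t : acong t t
| acong_sym s t : acong s t -> acong t s
| acong_trans t s u : acong s t -> acong t u -> acong s u
| acong_add s s' t t' :
    acong s s' -> acong t t' -> acong (AAdd s t) (AAdd s' t')
| acong_mul s s' t t' :
    acong s s' -> acong t t' -> acong (AMul s t) (AMul s' t')
| acong_addA s t u : acong (AAdd s (AAdd t u)) (AAdd (AAdd s t) u)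
| acong_addC s t : acong (AAdd s t) (AAdd t s)
| acong_add0 t : acong (AAdd (AScal 0) t) t
| acong_addN t : acong (AAdd (AMul (AScal (-1)) t) t) (AScal 0)
| acong_mulA s t u : acong (AMul s (AMul t u)) (AMul (AMul s t) u)
| acong_mul1l t : acong (AMul (AScal 1) t) t
| acong_mul1r t : acong (AMul t (AScal 1)) t
| acong_mulDl s t u : acong (AMul (AAdd s t) u) (AAdd (AMul s u) (AMul t u))
| acong_mulDr s t u : acong (AMul s (AAdd t u)) (AAdd (AMul s t) (AMul s u))
| acong_scalD a b : acong (AScal (a + b)) (AAdd (AScal a) (AScal b))
| acong_scalM a b : acong (AScal (a * b)) (AMul (AScal a) (AScal b))
| acong_scalC a t : acong (AMul (AScal a) t) (AMul t (AScal a)).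

Definition acongb (s t : expr) : bool := `[<acong s t>].

Fact acongb_equiv : equiv_class_of acongb.
Proof.
split=> [t|s t|t s u]; first by apply/asboolP/acong_refl.
- by apply/asboolP/asboolP => /acong_sym.
- by move=> /asboolP st /asboolP tu; apply/asboolP/(acong_trans st).
Qed.

Canonical acong_equiv := EquivRelPack acongb_equiv.

Definition presalg : Type := {eq_quot acong_equiv}.
HB.instance Definition _ := Choice.on presalg.
HB.instance Definition _ := EqQuotient.on presalg.

Definition pclass (t : expr) : presalg := \pi_presalg t.

Lemma pclassP s t : pclass s = pclass t <-> acong s t.
Proof.
split=> [/eqmodP/asboolP//|st]; apply/eqmodP; exact/asboolP.
Qed.

Lemma reprP t : acong (repr (pclass t)) t.
Proof. by apply/pclassP; rewrite /pclass reprK. Qed.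

Lemma pclassK (x : presalg) : pclass (repr x) = x.
Proof. exact: reprK. Qed.

Definition padd (x y : presalg) : presalg := pclass (AAdd (repr x) (repr y)).
Definition pmul (x y : presalg) : presalg := pclass (AMul (repr x) (repr y)).
Definition pscal (a : K) : presalg := pclass (AScal a).
Definition pscale (a : K) (x : presalg) : presalg := pmul (pscal a) x.
Definition popp (x : presalg) : presalg := pscale (-1) x.
Definition pgen (g : G) : presalg := pclass (AGen g).

Lemma paddE s t : padd (pclass s) (pclass t) = pclass (AAdd s t).
Proof. by apply/pclassP/acong_add; apply: reprP. Qed.

Lemma pmulE s t : pmul (pclass s) (pclass t) = pclass (AMul s t).
Proof. by apply/pclassP/acong_mul; apply: reprP. Qed.

Lemma presalg_ind (P : presalg -> Prop) :
  (forall t, P (pclass t)) -> forall x, P x.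
Proof. by move=> Pt x; rewrite -(pclassK x). Qed.

Local Ltac pauto := 
  rewrite /popp /pscale /pscal; repeat (elim/presalg_ind => ?);
  rewrite ?(paddE, pmulE); apply/pclassP.

Fact paddA : associative padd. Proof. by pauto; apply: acong_addA. Qed.
Fact paddC : commutative padd. Proof. by pauto; apply: acong_addC. Qed.
Fact padd0 : left_id (pscal 0) padd. Proof. by pauto; apply: acong_add0. Qed.
Fact paddN : left_inverse (pscal 0) popp padd.
Proof. by pauto; apply: acong_addN. Qed.
Fact pmulA : associative pmul. Proof. by pauto; apply: acong_mulA. Qed.
Fact pmul1l : left_id (pscal 1) pmul. Proof. by pauto; apply: acong_mul1l. Qed.
Fact pmul1r : right_id (pscal 1) pmul. Proof. by pauto; apply: acong_mul1r. Qed.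
Fact pmulDl : left_distributive pmul padd.
Proof. by pauto; apply: acong_mulDl. Qed.
Fact pmulDr : right_distributive pmul padd.
Proof. by pauto; apply: acong_mulDr. Qed.

HB.instance Definition _ := GRing.isPzRing.Build presalg
  paddA paddC padd0 paddN pmulA pmul1l pmul1r pmulDl pmulDr.

Fact pscalD a b : pscal (a + b) = pscal a + pscal b.
Proof. by rewrite /GRing.add /= paddE; apply/pclassP/acong_scalD. Qed.
Fact pscalM a b : pscal (a * b) = pscal a * pscal b.
Proof. by rewrite /GRing.mul /= pmulE; apply/pclassP/acong_scalM. Qed.
Fact pscalC a (x : presalg) : pscal a * x = x * pscal a.
Proof.
elim/presalg_ind: x => t; rewrite /GRing.mul /= !pmulE.
by apply/pclassP/acong_scalC.
Qed.

Fact pscaleA a b v : pscale a (pscale b v) = pscale (a * b) v.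
Proof. by rewrite /pscale pscalM; exact: pmulA. Qed.
Fact pscale1 : left_id 1 pscale.
Proof. exact: pmul1l. Qed.
Fact pscaleDr : right_distributive pscale +%R.
Proof. by move=> a u v; exact: pmulDr. Qed.
Fact pscaleDl v : {morph pscale^~ v : a b / a + b}.
Proof. by move=> a b /=; rewrite /pscale pscalD; exact: pmulDl. Qed.

HB.instance Definition _ := GRing.Zmodule_isLmodule.Build K presalg
  pscaleA pscale1 pscaleDr pscaleDl.

Fact pscaleAl (a : K) (u v : presalg) : a *: (u * v) = a *: u * v.
Proof. exact: pmulA. Qed.
Fact pscaleAr (a : K) (u v : presalg) : a *: (u * v) = u * (a *: v).
Proof.
by rewrite -[RHS]/(u * (pscal a * v)) mulrA -pscalC -mulrA.
Qed.

(* Existence part of the universal property. *)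
Section Lift.
Variables (B : algType K) (f : G -> B).

Fixpoint aeval (t : expr) : B :=
  match t with
  | AGen g => f g
  | AScal a => a%:A
  | AAdd s t => aeval s + aeval t
  | AMul s t => aeval s * aeval t
  end.

Hypothesis frel : forall s t, rel s t -> aeval s = aeval t.

Lemma aeval_cong s t : acong s t -> aeval s = aeval t.
Proof.
elim=> //= {s t}.
- by move=> t s u _ -> _ ->.
- by move=> s s' t t' _ -> _ ->.
- by move=> s s' t t' _ -> _ ->.
- by move=> s t u; rewrite addrA.
- by move=> s t; rewrite addrC.
- by move=> t; rewrite scale0r add0r.
- by move=> t; rewrite scaleN1r mulN1r addNr scale0r.
- by move=> s t u; rewrite mulrA.
- by move=> t; rewrite scale1r mul1r.
- by move=> t; rewrite scale1r mulr1.
- by move=> s t u; rewrite mulrDl.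
- by move=> s t u; rewrite mulrDr.
- by move=> a b; rewrite scalerDl.
- by move=> a b; rewrite mulr_algl scalerA.
- by move=> a t; rewrite mulr_algl mulr_algr.
Qed.

Definition plift (x : presalg) : B := aeval (repr x).

Lemma plift_pclass t : plift (pclass t) = aeval t.
Proof. exact/aeval_cong/reprP. Qed.

Lemma plift_gen g : plift (pgen g) = f g.
Proof. exact: plift_pclass. Qed.
Lemma pliftD x y : plift (x + y) = plift x + plift y.
Proof. exact: plift_pclass. Qed.
Lemma pliftM x y : plift (x * y) = plift x * plift y.
Proof. exact: plift_pclass. Qed.
Lemma plift_scal a : plift (pscal a) = a%:A.
Proof. exact: plift_pclass. Qed.
Lemma plift1 : plift 1 = 1.
Proof. by rewrite -[1 in LHS]/(pscal 1) plift_scal scale1r. Qed.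
Lemma pliftZ a x : plift (a *: x) = a *: plift x.
Proof. by rewrite -[a *: x]/(pscal a * x) pliftM plift_scal mulr_algl. Qed.
Lemma pliftN x : plift (- x) = - plift x.
Proof. by rewrite -[- x]/(-1 *: x) pliftZ scaleN1r. Qed.
Lemma presalg_neq0 : (1 : presalg) != 0.
Proof.
apply/eqP => /(congr1 plift); rewrite plift1 -[0 in RHS]/(pscal 0) plift_scal.
by rewrite scale0r => /eqP; rewrite oner_eq0.
Qed.
End Lift.

End Presentation.

(* The universal enveloping algebra of sl_2(C). *)

Definition C : closedFieldType := complex Rdefinitions.R.

Definition sl2 : Type := {A : 'M[C]_2 | \tr A == 0}.

Local Notation C_expr := (aexpr C sl2).

Inductive sl2_rel : C_expr -> C_expr -> Prop :=
| sl2_linear (c : C) (A B D : sl2) :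
    val D = c *: val A + val B ->
    sl2_rel (AGen D) (AAdd (AMul (AScal c) (AGen A)) (AGen B))
| sl2_bracket (A B D : sl2) :
    val D = val A *m val B - val B *m val A ->
    sl2_rel (AAdd (AGen D) (AMul (AGen B) (AGen A))) (AMul (AGen A) (AGen B)).

Definition UC : Type := presalg sl2_rel.

HB.instance Definition _ := GRing.PzRing.on UC.
HB.instance Definition _ := GRing.Lmodule.on UC.

Fact sl2_aug (s t : C_expr) :
  sl2_rel s t -> aeval (fun=> 0 : C^o) s = aeval (fun=> 0) t.
Proof. by case=> * /=; rewrite ?mulr0 ?addr0. Qed.

HB.instance Definition _ :=
  GRing.PzSemiRing_isNonZero.Build UC (presalg_neq0 sl2_aug).
HB.instance Definition _ :=
  GRing.Lmodule_isLalgebra.Build C UC (@pscaleAl _ _ sl2_rel).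
HB.instance Definition _ :=
  GRing.Lalgebra_isAlgebra.Build C UC (@pscaleAr _ _ sl2_rel).

Definition sl2X_mx : 'M[C]_2 := delta_mx 0 1.
Definition sl2Y_mx : 'M[C]_2 := delta_mx 1 0.
Definition sl2H_mx : 'M[C]_2 := delta_mx 0 0 - delta_mx 1 1.

Fact sl2X_tr : \tr sl2X_mx == 0.
Proof. by rewrite /mxtrace !big_ord_recl big_ord0 !mxE /= !addr0. Qed.
Fact sl2Y_tr : \tr sl2Y_mx == 0.
Proof. by rewrite /mxtrace !big_ord_recl big_ord0 !mxE /= !addr0. Qed.
Fact sl2H_tr : \tr sl2H_mx == 0.
Proof.
by rewrite /mxtrace !big_ord_recl big_ord0 !mxE /= !subr0 sub0r addr0 subrr.
Qed.

Definition UC_X : UC := pgen sl2_rel (exist _ sl2X_mx sl2X_tr).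
Definition UC_Y : UC := pgen sl2_rel (exist _ sl2Y_mx sl2Y_tr).
Definition UC_H : UC := pgen sl2_rel (exist _ sl2H_mx sl2H_tr).

Definition divpow (u : UC) (m : nat) : UC := (m`!%:R : C)^-1 *: u ^+ m.

Definition Hbinom (c : int) (m : nat) : UC :=
  (m`!%:R : C)^-1 *: \prod_(i < m) (UC_H + (c - i%:Z)%:~R).

(* The Z-form U_Z. *)

Definition UZ_set : set UC :=
  smallest [set S : set UC | subring_closed [pred u | u \in S]]
    [set u | exists m, u = divpow UC_X m \/ u = divpow UC_Y m].

Definition UZ_pred : {pred UC} := [pred u | u \in UZ_set].

Fact UZ_subring : subring_closed UZ_pred.
Proof.
split=> [|u v|u v]; rewrite !inE.
- by move=> S [[S1 _ _] _]; have := S1; rewrite !inE.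
- move=> uS vS S SP; have [[_ SB _] _] := SP.
  by have := SB u v; rewrite !inE; apply; [exact: uS | exact: vS].
- move=> uS vS S SP; have [[_ _ SM] _] := SP.
  by have := SM u v; rewrite !inE; apply; [exact: uS | exact: vS].
Qed.

HB.instance Definition _ := GRing.isSubringClosed.Build UC UZ_pred UZ_subring.

Record UZ : Type := MkUZ { UZval : UC; UZvalP : UZval \in UZ_pred }.
HB.instance Definition _ := [isSub for UZval].
HB.instance Definition _ := [Choice of UZ by <:].
HB.instance Definition _ := [SubChoice_isSubNzRing of UZ by <:].

(* The augmentation of U_Z, needed only to see that U_Z (x) k is not trivial. *)
Local Notation aug := (@plift _ _ sl2_rel C^o (fun=> 0)).

Fact aug_divpow u m : aug u = 0 -> exists z : int, aug (divpow u m) = z%:~R.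
Proof.
move=> u0; have augX n : aug (u ^+ n) = 0 ^+ n.
  elim: n => [|n IHn]; first by rewrite !expr0 (plift1 sl2_aug).
  by rewrite !exprS (pliftM sl2_aug) u0 !mul0r.
rewrite /divpow (pliftZ sl2_aug) augX expr0n.
case: m => [|m] /=; last by exists 0; rewrite scaler0.
by exists 1; rewrite fact0 invr1 scale1r.
Qed.

Fact aug_int (u : UZ) : exists z : int, aug (val u) == z%:~R.
Proof.
suff: exists z : int, aug (val u) = z%:~R by case=> z ->; exists z.
have := valP u; rewrite inE.
move=> /(_ [set v : UC | exists z : int, aug v = z%:~R]); apply; split.
  split; rewrite ?inE /=.
  - by exists 1; rewrite (plift1 sl2_aug).
  - move=> v w; rewrite !inE /= => -[a av] [b bw]; exists (a - b).
    by rewrite (pliftD sl2_aug) (pliftN sl2_aug) av bw intrB.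
  - move=> v w; rewrite !inE /= => -[a av] [b bw]; exists (a * b).
    by rewrite (pliftM sl2_aug) av bw intrM.
by move=> v [m [] ->]; apply: aug_divpow; rewrite (plift_gen sl2_aug).
Qed.

Definition augz (u : UZ) : int := xchoose (aug_int u).

Fact augzE (u : UZ) : aug (val u) = (augz u)%:~R.
Proof. exact/eqP/(xchooseP (aug_int u)). Qed.
Fact augzP (u : UZ) (z : int) : aug (val u) = z%:~R -> augz u = z.
Proof. by rewrite augzE => /(@intr_inj C). Qed.
Fact augzD u v : augz (u + v) = augz u + augz v.
Proof. by apply: augzP; rewrite rmorphD (pliftD sl2_aug) !augzE intrD. Qed.
Fact augzM u v : augz (u * v) = augz u * augz v.
Proof. by apply: augzP; rewrite rmorphM (pliftM sl2_aug) !augzE intrM. Qed.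
Fact augz1 : augz 1 = 1.
Proof. by apply: augzP; rewrite rmorph1 (plift1 sl2_aug). Qed.

(* The hyperalgebra U = U_Z (x)_Z k; the generator (u, c) is u (x) c. *)

Section Hyperalgebra.
Variable k : fieldType.

Local Notation k_expr := (aexpr k (UZ * k)).

Inductive tensor_rel : k_expr -> k_expr -> Prop :=
| tensor_Dl (u v : UZ) (c : k) :
    tensor_rel (AGen (u + v, c)) (AAdd (AGen (u, c)) (AGen (v, c)))
| tensor_Dr (u : UZ) (c d : k) :
    tensor_rel (AGen (u, c + d)) (AAdd (AGen (u, c)) (AGen (u, d)))
| tensor_M (u v : UZ) (c d : k) :
    tensor_rel (AGen (u * v, c * d)) (AMul (AGen (u, c)) (AGen (v, d)))
| tensor_scal (c : k) : tensor_rel (AGen (1, c)) (AScal c).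

Definition hyperalgebra : Type := presalg tensor_rel.

HB.instance Definition _ := GRing.PzRing.on hyperalgebra.
HB.instance Definition _ := GRing.Lmodule.on hyperalgebra.

Fact tensor_aug (s t : k_expr) : tensor_rel s t ->
  let f (g : UZ * k) : k^o := (augz g.1)%:~R * g.2 in aeval f s = aeval f t.
Proof.
case=> [u v c|u c d|u v c d|c] /=.
- by rewrite augzD intrD mulrDl.
- by rewrite mulrDr.
- by rewrite augzM intrM mulrACA.
- by rewrite augz1 mul1r -mulr_algl mulr1 /= [RHS]mulr1.
Qed.

HB.instance Definition _ :=
  GRing.PzSemiRing_isNonZero.Build hyperalgebra (presalg_neq0 tensor_aug).
HB.instance Definition _ :=
  GRing.Lmodule_isLalgebra.Build k hyperalgebra (@pscaleAl _ _ tensor_rel).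
HB.instance Definition _ :=
  GRing.Lalgebra_isAlgebra.Build k hyperalgebra (@pscaleAr _ _ tensor_rel).

(* The image in U of an element of U_Z (and 0 for an element of U(sl_2(C))    *)
(* outside of U_Z).                                                           *)
Definition to_U (u : UC) : hyperalgebra := pgen tensor_rel (insubd 0 u, 1).

Definition U_X (m : nat) : hyperalgebra := to_U (divpow UC_X m).
Definition U_Y (m : nat) : hyperalgebra := to_U (divpow UC_Y m).
Definition U_binom (c : int) (m : nat) : hyperalgebra := to_U (Hbinom c m).

Definition generated_subalg (G : set hyperalgebra) : set hyperalgebra :=
  smallest
    [set S : set hyperalgebra | GRing.subalg_closed [pred u | u \in S]] G.

Variable p : nat.

Definition U_sub (r : nat) : set hyperalgebra :=
  generated_subalg
    [set u | exists2 i, (i < r)%N & u = U_X (p ^ i) \/ u = U_Y (p ^ i)].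

Definition A_alg : set hyperalgebra :=
  generated_subalg
    [set u | exists i, u = U_binom 0 (p ^ i) \/ u = U_Y (p ^ i) * U_X (p ^ i)].

Definition A_sub (r : nat) : set hyperalgebra := A_alg `&` U_sub r.

Definition is_Fr' (Fr' : hyperalgebra -> hyperalgebra) : Prop :=
  forall m n m' : nat,
    Fr' (U_Y m * U_binom 0 n * U_X m') =
    U_Y (m * p) * U_binom 0 (n * p) * U_X (m' * p).

Definition mu (a : int) : hyperalgebra := U_binom (- a - 1) p.-1.

(* The set P of pairs (a, j), with j a rational number since j = 1/2 occurs.  *)
Definition in_P (aj : nat * rat) : bool :=
  if p == 2%N then aj \in [:: (0%N, 1 / 2%:R); (1%N, 0); (1%N, 1)]
  else (aj.1 < p)%N && (aj.2 \in [seq i%:R | i <- iota 0 (p.-1)./2.+1]).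

Definition psi : {poly 'F_p} := \prod_(i : 'F_p) ('X - (i ^+ 2)%:P).

Definition psi_eps (eps : bool) (j : 'F_p) : {poly 'F_p} :=
  if eps then psi %/ ('X - (j ^+ 2)%:P)
  else if j == 0 then \prod_(i : 'F_p | i != 0) ('X - (i ^+ 2)%:P)
  else 2%:R *: 'X * ('X + (j ^+ 2)%:P) *
       \prod_(i : 'F_p | [&& i != 0, i != j & i != - j]) ('X - (i ^+ 2)%:P).

(* F_p as the prime subfield of k (k has characteristic p). *)
Definition Fp_in (c : 'F_p) : k := (nat_of_ord c)%:R.

Definition B1 (eps : bool) (aj : nat * rat) : hyperalgebra :=
  if p == 2%N then
    if aj == (0%N, 1 / 2%:R) then
      if eps then mu 0 * U_Y 1 * U_X 1 else mu 0
    else if aj == (1%N, 0) then mu 1 * U_Y 1 * U_X 1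
    else mu 1 * U_Y 1 * U_X 1 + mu 1
  else
    let: (a, j) := aj in
    let shift : 'F_p := ((a%:R + 1) / 2%:R) ^+ 2 in
    horner_alg (mu a * U_Y 1 * U_X 1 + (Fp_in shift)%:A)
      (map_poly Fp_in (psi_eps eps (ratr j))) * mu a.

(* For p = 2 these inequalities also give the prescribed result: only (1, 0)  *)
(* is of type (A) or (C). The elements of P of types (B) and (D) are those    *)
(* that are not of type (A) or (C).                                           *)
Definition typeA (aj : nat * rat) : bool :=
  ~~ odd aj.1 &&
  ((p%:R - aj.1%:R + 1) / 2%:R <= aj.2 <= (p%:R - 1) / 2%:R).

Definition typeC (aj : nat * rat) : bool :=
  odd aj.1 && (0 <= aj.2 <= (aj.1%:R - 1) / 2%:R).

Definition s_shift (aj : nat * rat) : nat :=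
  if p == 2%N then 1%N
  else if odd aj.1 then (p - aj.1)./2 else (p - aj.1 + 1)./2.

(* The unique c_0, ..., c_{p-1} with B = mu_a sum_m c_m Y^m X^m.              *)
Definition B_coef (eps : bool) (aj : nat * rat) : {ffun 'I_p -> 'F_p} :=
  odflt [ffun=> 0]
    [pick c : {ffun 'I_p -> 'F_p} |
      B1 eps aj ==
        mu aj.1 * \sum_(m < p) Fp_in (c m) *: (U_Y 1 ^+ m * U_X 1 ^+ m)].

Variable Fr' : hyperalgebra -> hyperalgebra.

Definition Z_map (eps : bool) (z : hyperalgebra) (aj : nat * rat) :
    hyperalgebra :=
  if typeA aj || typeC aj then
    let s := s_shift aj in
    mu aj.1 * \sum_(m < p | (s <= m)%N)
      Fp_in (B_coef eps aj m) *:
        (U_Y 1 ^+ m * U_X 1 ^+ (m - s) * Fr' z * U_X 1 ^+ s)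
  else Fr' z * B1 eps aj.

(* The value on the empty sequence is not used (r >= 1). *)
Fixpoint B_seq (eaj : seq (bool * (nat * rat))) : hyperalgebra :=
  match eaj with
  | [::] => 1
  | [:: ea] => B1 ea.1 ea.2
  | ea :: eaj' => Z_map ea.1 (B_seq eaj') ea.2
  end.

Definition B_multi (r : nat) (eps : r.-tuple bool)
  (aj : r.-tuple (nat * rat)) : hyperalgebra := B_seq (zip eps aj).

Definition E_idem (r : nat) (aj : r.-tuple (nat * rat)) : hyperalgebra :=
  B_multi [tuple of nseq r false] aj.

End Hyperalgebra.

(* Symmetric algebras, for a subset S of a k-algebra which is a k-algebra     *)
(* with a unity e that may differ from 1.                                     *)

Section SymmetricAlgebra.
Variables (k : fieldType) (A : algType k) (S : set A) (e : A).

Definition algebra_with_unity : Prop :=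
  [/\ S e,
      forall x, S x -> e * x = x /\ x * e = x,
      forall (c : k) x y, S x -> S y -> S (c *: x + y)
    & forall x y, S x -> S y -> S (x * y)].

Definition finite_dimensional : Prop :=
  exists (n : nat) (b : 'I_n -> A), (forall i, S (b i)) /\
    forall x, S x -> exists c : 'I_n -> k, x = \sum_i c i *: b i.

Definition bilinear_on (beta : A -> A -> k) : Prop :=
  (forall (c : k) x y z, S x -> S y -> S z ->
     beta (c *: x + y) z = c * beta x z + beta y z) /\
  (forall (c : k) x y z, S x -> S y -> S z ->
     beta z (c *: x + y) = c * beta z x + beta z y).

Definition is_symmetric_algebra : Prop :=
  [/\ algebra_with_unity, finite_dimensional
    & exists beta : A -> A -> k,
      [/\ bilinear_on beta,
          forall x y z, S x -> S y -> S z -> beta (x * y) z = beta x (y * z),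
          forall x y, S x -> S y -> beta x y = beta y x
        & forall x, S x -> (forall y, S y -> beta x y = 0) -> x = 0]].

End SymmetricAlgebra.

(* Main.v *)
(* Put q = p^r.  An element of A_r is a sum of Y^(m) h_m X^(m), m < q, where  *)
(* the Cartan element h_m amounts to a q-periodic function on the integral    *)
(* weights, and A_r is commutative.  Let lambda be the linear form that sums  *)
(* the values of h_(q-1) over the weights mod q.  If m is least with h_m <> 0 *)
(* then u Y^(q-1-m) h X^(q-1-m) has leading part C(q-1, m)^2 times a function *)
(* that can be made nonzero at a single weight by the choice of h, and        *)
(* C(q-1, m) is a unit; so lambda(u v) is a nondegenerate form on A_r.  For   *)
(* an idempotent E of A_r, lambda(x y) is still nondegenerate on A_r E, since *)
(* x v = x (v E) for x in A_r E.                                              *)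
(* E(a, j) is idempotent by induction on r.  Multiplication of Fr'-images     *)
(* obeys the relations of the hyperalgebra up to terms containing Y^i X^i     *)
(* with p - a <= i < p next to an element of weight a.  For the types (B) and *)
(* (D) these terms are killed by B(a, j), because the corresponding product   *)
(* of linear factors times psi_j is divisible by psi.  For the types (A) and  *)
(* (C) the element Y^s b Fr'(z) X^s is conjugated to the weight a + 2s <= s   *)
(* mod p, where b X^s Y^s plays the role of B(a, j).                          *)

Require Import Defs.
From HB Require Import structures.
From mathcomp Require Import all_boot all_order all_algebra.
From mathcomp Require Import boolp classical_sets.
From mathcomp Require Import complex Rstruct finfield.
From mathcomp Require Import ring lra zify.

Set Implicit Arguments.
Unset Strict Implicit.
Unset Printing Implicit Defensive.

Import Order.TTheory GRing.Theory Num.Theory.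

Local Open Scope classical_set_scope.
Local Open Scope ring_scope.

(** * Integral binomials, finite differences and periodic functions *)

(** Put q = p^r. All computations take place in a normal form: A_r consists of the sums of Y^(m) h
    X^(m), m < q, with h a function on the weights modulo q ([Dform], identified with A_r by
    [A_subE]). The Cartan part multiplies like functions because binomials of index below q are
    q-periodic modulo p ([ibin_per], [thM]). Independence is supplied by the coefficient functionals
    [hcoef], obtained from modules induced from characters of the Cartan part.

    A_r is commutative ([Dform_comm]), so a linear form whose kernel contains no nonzero ideal makes
    it symmetric. The form chosen sums the function h_(q-1) over all weights modulo q. For nonzero
    u, take the largest m with h_m nonzero and multiply by Y^(q-1-m) h X^(q-1-m): smaller terms
    cannot reach order q-1, and the term m contributes the unit C(q-1, m)^2 times one value of h_m,
    selected by h ([Dform_frobenius]). The form passes to A_r e for every idempotent e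
    ([Dform_corner_symmetric]).

    It remains to see that E(a, j) is an idempotent of A_r ([B_seq_idem]). On level one, mu_a Y^m
    X^m is a product of linear factors in YX ([ev_W]), and the claim becomes that psi_j is
    idempotent modulo psi ([prim_poly_idem]). The induction rests on [Fr_mul]: Fr' is multiplicative
    after multiplication by an element of weight a that is killed by Y^(i) X^(i) for p - a <= i < p,
    since then, by Lucas, only the terms of index divisible by p survive straightening. For the
    types (B) and (D) this element is B(a, j) itself ([Fr_step_idem]); for (A) and (C) the factor
    Y^s moves the weight to 0 or 1, where another element takes this role ([sandwich_step_idem]). *)

Definition ibin (x : int) (m : nat) : int :=
  match x with
  | Posz n => 'C(n, m)%:Z
  | Negz n => (-1) ^+ m * 'C(n + m, m)%:Z
  end.

Lemma ibin0 x : ibin x 0 = 1.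
Proof. by case: x => n; rewrite /ibin ?addn0 bin0 ?expr0 ?mul1r. Qed.

Lemma ibin_nat (n m : nat) : ibin n%:Z m = 'C(n, m)%:Z.
Proof. by []. Qed.

Lemma ibin0n m : ibin 0 m.+1 = 0.
Proof. by rewrite -[0]/(0%N%:Z) ibin_nat bin0n. Qed.

Lemma ibinSr x m : m.+1%:Z * ibin x m.+1 = (x - m%:Z) * ibin x m.
Proof.
case: x => n; rewrite /ibin.
  rewrite -PoszM mul_bin_left; case: (leqP m n) => mn.
    by rewrite PoszM -subzn.
  by rewrite bin_small // muln0 mulr0.
rewrite NegzE exprS mulrCA -PoszM addnS -mul_bin_diag PoszM /=.
rewrite !intS PoszD; ring.
Qed.

Lemma ibin_fact x m : m`!%:Z * ibin x m = \prod_(i < m) (x - i%:Z).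
Proof.
elim: m => [|m IHm]; first by rewrite big_ord0 ibin0.
rewrite big_ord_recr /= -IHm factS mulnC PoszM -mulrA ibinSr; ring.
Qed.

Lemma mulSz_inj (m : nat) (a b : int) : m.+1%:Z * a = m.+1%:Z * b -> a = b.
Proof. by apply: mulfI. Qed.

Lemma ibinSl x m : (x + 1 - m%:Z) * ibin (x + 1) m = (x + 1) * ibin x m.
Proof.
elim: m => [|m IHm]; first by rewrite !ibin0 subr0.
apply: (@mulSz_inj m).
rewrite [LHS]mulrCA ibinSr [RHS]mulrCA ibinSr [RHS]mulrCA -IHm.
by rewrite -addn1 PoszD; ring.
Qed.

Lemma ibinS x m : ibin (x + 1) m.+1 = ibin x m.+1 + ibin x m.
Proof.
apply: (@mulSz_inj m); rewrite mulrDr !ibinSr ibinSl -addn1 PoszD; ring.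
Qed.

(** Vandermonde's identity with one summand nonnegative, by Pascal's rule and induction on that
    summand. *)
Lemma ibinD x (n m : nat) :
  ibin (x + n%:Z) m = \sum_(i < m.+1) 'C(n, i)%:Z * ibin x (m - i).
Proof.
elim: n m => [|n IHn] m.
  rewrite addr0 big_ord_recl /= mul1r subn0 big1 ?addr0 // => i _.
  by rewrite bin0n mul0r.
case: m => [|m]; first by rewrite big_ord1 /= !ibin0.
rewrite -addn1 PoszD addrA ibinS !IHn addn1.
rewrite [RHS]big_ord_recl [in LHS]big_ord_recl /= !bin0 -addrA; congr (_ + _).
rewrite -big_split; apply: eq_bigr => i _.
by rewrite /bump /= add1n subSS binS PoszD mulrDl.
Qed.

Section Newton.
Variable R : zmodType.

Definition fdiff (g : nat -> R) (i : nat) : R := g i.+1 - g i.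
(** The coefficients of Newton's forward interpolation, that is, of the expansion of g in the
    binomials C(i, l). *)
Definition newton (g : nat -> R) (l : nat) : R := iter l fdiff g 0.

Lemma newtonS g l : newton g l.+1 = newton (fdiff g) l.
Proof. by rewrite /newton iterSr. Qed.

Lemma newton_sum g n i : (i < n)%N ->
  g i = \sum_(l < n) newton g l *+ 'C(i, l).
Proof.
elim: i n g => [|i IHi] [|n] g //= i_n.
  by rewrite big_ord_recl big1 ?addr0.
rewrite big_ord_recl /= bin0 mulr1n -[newton g 0]/(g 0).
have -> : g i.+1 = g i + fdiff g i by rewrite /fdiff subrKC.
rewrite (IHi n.+1 g) ?(IHi n (fdiff g)) ?(ltnW i_n) //.
rewrite big_ord_recl /= bin0 -[newton g 0]/(g 0) mulr1n -addrA -big_split.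
congr (_ + _); apply: eq_bigr => l _.
by rewrite /= newtonS /bump add1n binS mulrnDr.
Qed.

(** A forward difference lowers the index of every binomial by one, so it shifts the coefficients
    [d]. *)
Lemma newton_uniq g (d : nat -> R) n :
  (forall i, g i = \sum_(l < n) d l *+ 'C(i, l)) ->
  forall l, newton g l = if (l < n)%N then d l else 0.
Proof.
move=> gd l; elim: l n d g gd => [|l IHl] n d g gd.
  rewrite /newton /= gd; case: n {gd} => [|n]; first by rewrite big_ord0.
  by rewrite big_ord_recl big1 ?addr0.
rewrite newtonS; case: n gd => [|n] gd.
  rewrite (IHl 0 d) // => i; rewrite /fdiff !gd !big_ord0 subr0 //.
rewrite ltnS (IHl n (fun l => d l.+1)) // => i.
rewrite /fdiff !gd !big_ord_recl !bin0 /= opprD addrACA subrr add0r.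
rewrite -sumrB; apply: eq_bigr => j _.
by rewrite /bump /= add1n binS mulrnDr addrAC subrr add0r.
Qed.

Lemma eq_newton g g' l : (forall i, (i <= l)%N -> g i = g' i) ->
  newton g l = newton g' l.
Proof.
elim: l g g' => [|l IHl] g g' gg'; first exact: gg'.
by rewrite !newtonS; apply: IHl => i il; rewrite /fdiff !gg' // ltnW.
Qed.

End Newton.

Lemma newton_morph (R S : zmodType) (f : {additive R -> S}) g l :
  newton (fun i => f (g i)) l = f (newton g l).
Proof.
elim: l g => [|l IHl] g //; rewrite !newtonS -IHl.
by congr (newton _ l); apply/funext => i; rewrite /fdiff raddfB.
Qed.

(** * Binomials modulo p, the Lucas congruence and periodic functions *)

Section CharP.
Variables (k : fieldType) (p : nat).
Hypothesis hp : p \in [pchar k].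

Let p_pr : prime p := pcharf_prime hp.

Lemma coef_1DXn (R : comNzRingType) (n i : nat) :
  ((1 + 'X) ^+ n : {poly R})`_i = 'C(n, i)%:R.
Proof.
elim: n i => [|n IHn] i.
  by rewrite expr0 coef1 bin0n.
rewrite exprS mulrDl mul1r coefD coefXM !IHn; case: i => [|i] /=.
  by rewrite !bin0 addr0.
by rewrite binS natrD.
Qed.

(** Compare coefficients in (1 + X)^(p^N) = 1 + X^(p^N). *)
Lemma bin_expp N i :
  'C(p ^ N, i)%:R = (i == 0)%:R + (i == p ^ N)%N%:R :> k.
Proof.
have pN : p.-nat (p ^ N)%N by rewrite pnatX pnat_id.
have chp : p \in [pchar {poly k}] by rewrite pchar_poly.
rewrite -coef_1DXn (exprDn_pchar _ _ _) ?expr1n.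
  by rewrite coefD coef1 coefXn.
by rewrite (eq_pnat _ (pcharf_eq chp)).
Qed.

(** By [bin_expp] only two terms of Vandermonde's sum survive modulo p. *)
Lemma ibinDp N x m :
  (ibin (x + (p ^ N)%:Z) m)%:~R =
  (ibin x m)%:~R + (if (p ^ N <= m)%N then (ibin x (m - p ^ N))%:~R else 0)
  :> k.
Proof.
have q0 : (0 < p ^ N)%N by rewrite expn_gt0 prime_gt0.
rewrite ibinD rmorph_sum /= big_ord_recl /= bin0 mul1r subn0; congr (_ + _).
transitivity (\sum_(i < m) (i.+1 == p ^ N)%N%:R *
    ((ibin x (m - i.+1))%:~R : k)).
  apply: eq_bigr => i _; rewrite rmorphM /= /bump add1n; congr (_ * _).
  by rewrite -[LHS]/('C(p ^ N, i.+1)%:R) bin_expp add0r.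
case: leqP => qm.
  have q1 : ((p ^ N).-1 < m)%N by rewrite prednK.
  rewrite (bigD1 (Ordinal q1)) //= prednK // eqxx mul1r big1 ?addr0 // => i.
  rewrite -val_eqE /= => /negPf ni.
  by rewrite -(prednK q0) eqSS ni mul0r.
rewrite big1 // => i _; rewrite (_ : _ == _ = false) ?mul0r //.
by apply: contraTF qm => /eqP <-; rewrite -leqNgt ltn_ord.
Qed.

Lemma ibin_per N x m : (m < p ^ N)%N ->
  (ibin (x + (p ^ N)%:Z) m)%:~R = (ibin x m)%:~R :> k.
Proof. by move=> mq; rewrite ibinDp leqNgt mq addr0. Qed.

(** Adding p to the upper argument acts on the index j through the same Pascal recursion as adding 1
    to x ([ibinDp] with N = 1), so the congruence propagates from x = 0 in both directions. *)
Lemma ibin_lucas (x : int) (j d l : nat) : (d < p)%N -> (l < p)%N ->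
  (ibin (x * p%:Z + d%:Z) (j * p + l))%:~R =
  (ibin x j)%:~R * 'C(d, l)%:R :> k.
Proof.
move=> dp lp.
have rec0 y : (ibin ((y + 1) * p%:Z + d%:Z) l)%:~R =
    (ibin (y * p%:Z + d%:Z) l)%:~R :> k.
  rewrite mulrDl mul1r addrAC -[p%:Z in X in ibin X]/((p ^ 1)%N%:Z).
  by rewrite ibin_per ?expn1.
have recS y i : (ibin ((y + 1) * p%:Z + d%:Z) (i.+1 * p + l))%:~R =
    (ibin (y * p%:Z + d%:Z) (i.+1 * p + l))%:~R +
    (ibin (y * p%:Z + d%:Z) (i * p + l))%:~R :> k.
  have := ibinDp 1 (y * p%:Z + d%:Z) (i.+1 * p + l); rewrite expn1.
  rewrite mulSn -addnA leq_addr addKn => <-.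
  by rewrite mulrDl mul1r addrAC.
have ibinSk y i : (ibin (y + 1) i.+1)%:~R =
  (ibin y i.+1)%:~R + (ibin y i)%:~R :> k by rewrite ibinS rmorphD.
have up y : (forall i, (ibin (y * p%:Z + d%:Z) (i * p + l))%:~R =
    (ibin y i)%:~R * 'C(d, l)%:R :> k) ->
  forall i, (ibin ((y + 1) * p%:Z + d%:Z) (i * p + l))%:~R =
    (ibin (y + 1) i)%:~R * 'C(d, l)%:R :> k.
  move=> Hy [|i]; last by rewrite recS !Hy ibinSk mulrDl.
  by rewrite mul0n add0n rec0 -[l]add0n -[X in (X + _)%N](mul0n p) Hy !ibin0.
have down y : (forall i, (ibin ((y + 1) * p%:Z + d%:Z) (i * p + l))%:~R =
    (ibin (y + 1) i)%:~R * 'C(d, l)%:R :> k) ->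
  forall i, (ibin (y * p%:Z + d%:Z) (i * p + l))%:~R =
    (ibin y i)%:~R * 'C(d, l)%:R :> k.
  move=> Hy; elim=> [|i IHi].
    by have := Hy 0; rewrite !mul0n !add0n rec0 !ibin0.
  have := Hy i.+1; rewrite recS ibinSk mulrDl IHi; exact: addIr.
elim: x j => [|n IHn|n IHn] j.
- rewrite mul0r add0r ibin_nat; case: j => [|j].
    by rewrite mul0n add0n ibin0 mul1r.
  rewrite ibin0n mul0r bin_small //; apply: leq_trans dp _.
  by rewrite mulSn -addnA leq_addr.
- by rewrite -addn1 PoszD; apply: up.
- apply: down => i; rewrite -addn1 PoszD opprD addrNK; exact: IHn.
Qed.

Definition per N (phi : int -> k) : Prop :=
  forall x, phi (x + (p ^ N)%:Z) = phi x.

Lemma perMz N phi : per N phi ->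
  forall x (z : int), phi (x + z * (p ^ N)%:Z) = phi x.
Proof.
move=> pphi x z; elim: z x => [|n IHn|n IHn] x.
- by rewrite mul0r addr0.
- by rewrite -addn1 PoszD mulrDl mul1r addrA pphi IHn.
- by rewrite -addn1 PoszD opprD mulrDl mulN1r addrA -pphi addrNK IHn.
Qed.

Lemma per_mod N phi : per N phi ->
  forall x, phi x = phi ((x %% (p ^ N)%:Z)%Z).
Proof.
by move=> pphi x; rewrite [in LHS](divz_eq x (p ^ N)%:Z) addrC perMz.
Qed.

Lemma modz_exp N x :
  exists2 i : nat, (i < p ^ N)%N & (x %% (p ^ N)%:Z)%Z = i%:Z.
Proof.
have q0 : (0 : int) < (p ^ N)%:Z by rewrite ltz_nat expn_gt0 prime_gt0.
have := modz_ge0 x (lt0r_neq0 q0); have := ltz_pmod x q0.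
by case: (x %% _)%Z => // i; rewrite ltz_nat => lti _; exists i.
Qed.

(** Both sides are periodic, and at 0, ..., p^N - 1 the truncated Newton formula is exact. *)
Lemma newton_per N phi : per N phi ->
  forall x, phi x = \sum_(l < p ^ N) newton (phi \o Posz) l * (ibin x l)%:~R.
Proof.
move=> pphi.
have pS : per N (fun x =>
    \sum_(l < p ^ N) newton (phi \o Posz) l * (ibin x l)%:~R).
  by move=> x; apply: eq_bigr => l _; rewrite ibin_per.
move=> x; rewrite (per_mod pphi) [RHS](per_mod pS).
have [i lti ->] := modz_exp N x.
rewrite -[phi i]/((phi \o Posz) i) (newton_sum _ lti).
by apply: eq_bigr => l _; rewrite ibin_nat -[RHS]/(_ * 'C(i, l)%:R) mulr_natr.
Qed.

Lemma newton_per0 N phi l : per N phi -> (p ^ N <= l)%N ->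
  newton (phi \o Posz) l = 0.
Proof.
move=> pphi ql.
rewrite (@newton_uniq _ _ (newton (phi \o Posz)) (p ^ N)) ?ltnNge ?ql //.
move=> i; rewrite /= (newton_per pphi); apply: eq_bigr => j _.
by rewrite ibin_nat -[LHS]/(_ * 'C(i, j)%:R) mulr_natr.
Qed.

End CharP.

Lemma natC_inj (m n : nat) : m%:R = n%:R :> C -> m = n.
Proof. by move=> mn; apply/eqP; rewrite -eqz_nat; apply/eqP/(@intr_inj C). Qed.

Lemma natC_neq0 (n : nat) : (0 < n)%N -> n%:R != 0 :> C.
Proof. by rewrite lt0n; apply: contraNneq => /(@natC_inj n 0) ->. Qed.

Lemma factC_neq0 (n : nat) : n`!%:R != 0 :> C.
Proof. exact/natC_neq0/fact_gt0. Qed.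

Lemma UC_gen_linear (c : C) (A B D : sl2) : val D = c *: val A + val B ->
  pgen sl2_rel D = c *: pgen sl2_rel A + pgen sl2_rel B.
Proof.
move=> hD; rewrite -[RHS]/(padd (pmul (pclass _ _) (pclass _ _)) (pclass _ _)).
by rewrite pmulE paddE; apply/pclassP/acong_rel/sl2_linear.
Qed.

Lemma UC_gen_bracket (A B D : sl2) :
  val D = val A *m val B - val B *m val A ->
  pgen sl2_rel D + pgen sl2_rel B * pgen sl2_rel A =
  pgen sl2_rel A * pgen sl2_rel B.
Proof.
move=> hD.
rewrite -[LHS]/(padd (pclass _ _) (pmul (pclass _ _) (pclass _ _))).
rewrite -[RHS]/(pmul (pclass _ _) (pclass _ _)).
by rewrite !pmulE paddE; apply/pclassP/acong_rel/sl2_bracket.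
Qed.

(** * The enveloping algebra of sl_2 *)

Definition mksl2 (A : 'M[C]_2) (trA : \tr A == 0) : sl2 :=
  exist (fun A => is_true (\tr A == 0)) A trA.

Lemma UC_XY : UC_X * UC_Y = UC_Y * UC_X + UC_H.
Proof.
rewrite addrC.
rewrite -(@UC_gen_bracket (mksl2 sl2X_tr) (mksl2 sl2Y_tr) (mksl2 sl2H_tr)) //=.
rewrite /sl2X_mx /sl2Y_mx /sl2H_mx !mul_delta_mx.
by apply/matrixP => i j; rewrite !mxE.
Qed.

Lemma sl2_scale_tr (c : C) (A : sl2) : \tr (c *: val A) == 0.
Proof. by case: A => A /= /eqP trA; rewrite mxtraceZ trA mulr0. Qed.

Lemma UC_gen_scale c (A : sl2) :
  pgen sl2_rel (mksl2 (sl2_scale_tr c A)) = c *: pgen sl2_rel A.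
Proof.
(* The linearity relation has the shape c A + B, so c A is written as (c - 1) A + A. *)
rewrite (@UC_gen_linear (c - 1) A A) /=; last first.
  by rewrite scalerBl scale1r subrK.
by rewrite scalerBl scale1r subrK.
Qed.

Lemma UC_HX : UC_H * UC_X = UC_X * (UC_H + 2%:R).
Proof.
have <- := @UC_gen_bracket (mksl2 sl2H_tr) (mksl2 sl2X_tr)
  (mksl2 (sl2_scale_tr 2%:R (mksl2 sl2X_tr))).
  by rewrite UC_gen_scale mulrDr addrC scaler_nat mulr_natr.
rewrite /= /sl2X_mx /sl2H_mx mulmxBl mulmxBr !mul_delta_mx_cond /=.
by rewrite !mulr0n !mulr1n subr0 sub0r opprK scaler_nat mulr2n.
Qed.

Lemma UC_HY : UC_H * UC_Y = UC_Y * (UC_H - 2%:R).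
Proof.
have <- := @UC_gen_bracket (mksl2 sl2H_tr) (mksl2 sl2Y_tr)
  (mksl2 (sl2_scale_tr (- 2%:R) (mksl2 sl2Y_tr))).
  by rewrite UC_gen_scale mulrBr addrC scaleNr scaler_nat mulr_natr.
rewrite /= /sl2Y_mx /sl2H_mx mulmxBl mulmxBr !mul_delta_mx_cond /=.
by rewrite !mulr0n !mulr1n subr0 sub0r scaleNr scaler_nat mulr2n opprD.
Qed.

(** * Binomial polynomials and integer-valued polynomials *)

Lemma polyC_int (R : nzRingType) (z : int) : (z%:~R)%:P = z%:~R :> {poly R}.
Proof. exact: rmorph_int. Qed.

Definition bpoly (c : int) (m : nat) : {poly C} :=
  (m`!%:R)^-1 *: \prod_(i < m) ('X + (c - i%:Z)%:~R).

Lemma bpoly0 c : bpoly c 0 = 1.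
Proof. by rewrite /bpoly big_ord0 fact0 invr1 scale1r. Qed.

Lemma bpolyS c m :
  m.+1%:R * bpoly c m.+1 = ('X + (c - m%:Z)%:~R) * bpoly c m.
Proof.
rewrite /bpoly -!scalerAr big_ord_recr /= [in RHS]mulrC mulr_natl.
by rewrite -scalerMnr scalerMnl -mulr_natl factS natrM invfM mulVKf ?natC_neq0.
Qed.

Lemma natC_poly_inj (n : nat) (f g : {poly C}) :
  n.+1%:R * f = n.+1%:R * g -> f = g.
Proof.
by apply: mulfI; rewrite -polyC_natr polyC_eq0 natC_neq0.
Qed.

Lemma bpoly_pascal c m : bpoly (c + 1) m.+1 = bpoly c m.+1 + bpoly c m.
Proof.
have shift i : ('X + (c + 1 - i%:Z)%:~R) * bpoly (c + 1) i =
               ('X + (c + 1)%:~R) * bpoly c i.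
  elim: i => [|i IHi]; first by rewrite !bpoly0 subr0.
  apply: (@natC_poly_inj i); rewrite mulrCA bpolyS [RHS]mulrCA bpolyS.
  rewrite [RHS]mulrCA -IHi mulrCA [RHS]mulrCA; congr (_ * (_ * _)).
  by rewrite intS opprD addrA addrK.
apply: (@natC_poly_inj m); rewrite mulrDr !bpolyS shift -mulrDl.
rewrite -[m.+1%:R]/((m.+1%:Z)%:~R) -addrA -intrD.
by congr (('X + _%:~R) * _); rewrite intS; ring.
Qed.

Lemma bpoly_horner c m (x : int) : (bpoly c m).[x%:~R] = (ibin (x + c) m)%:~R.
Proof.
apply: (mulfI (factC_neq0 m)); rewrite /bpoly hornerZ mulVKf ?factC_neq0 //.
rewrite -[m`!%:R]/((m`!%:Z)%:~R) -intrM ibin_fact horner_prod rmorph_prod /=.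
apply: eq_bigr => i _.
by rewrite hornerD hornerX -polyC_int hornerC -intrD addrA.
Qed.

Lemma size_bpoly c m : size (bpoly c m) = m.+1.
Proof.
rewrite /bpoly size_scale ?invr_eq0 ?factC_neq0 //.
under eq_bigr => i _ do rewrite -[(c - _)%:~R]opprK -intrN -polyC_int.
by rewrite -big_enum size_prod_XsubC size_enum_ord.
Qed.

Lemma lead_coef_bpoly c m : lead_coef (bpoly c m) = (m`!%:R)^-1.
Proof.
rewrite /bpoly lead_coefZ.
under eq_bigr => i _ do rewrite -[(c - _)%:~R]opprK -intrN -polyC_int.
by rewrite (monicP (monic_prod_XsubC _ _ _)) mulr1.
Qed.

Lemma bpoly_shift c m (d : int) :
  bpoly c m \Po ('X + (d%:~R)%:P) = bpoly (c + d) m.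
Proof.
rewrite /bpoly comp_polyZ rmorph_prod /=; congr (_ *: _); apply: eq_bigr => i _.
rewrite comp_polyD comp_polyX -polyC_int comp_polyC !polyC_int.
by rewrite -addrA -intrD addrCA addrA.
Qed.

Lemma eq_poly_nat (n : nat) (f g : {poly C}) :
  (size f <= n)%N -> (size g <= n)%N ->
  (forall i, (i < n)%N -> f.[i%:R] = g.[i%:R]) -> f = g.
Proof.
move=> sf sg fg; apply/eqP; rewrite -subr_eq0.
pose rs := [seq (i%:R : C) | i <- iota 0 n].
apply/eqP/(@roots_geq_poly_eq0 _ _ rs).
- apply/allP => x xrs; case/mapP: xrs => i; rewrite mem_iota /= add0n => ltin ->.
  by rewrite /root hornerD hornerN fg // subrr.
- by rewrite map_inj_uniq ?iota_uniq // => i j; apply: natC_inj.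
rewrite size_map size_iota (leq_trans (size_polyD _ _)) // size_polyN.
by rewrite geq_max sf sg.
Qed.

(** The values are recorded as integers because they are later reduced to [k]. *)
Definition intval (f : {poly C}) (g : int -> int) : Prop :=
  forall x : int, f.[x%:~R] = (g x)%:~R.

(** Polya's description of integer-valued polynomials: Newton's expansion has integer coefficients,
    and it agrees with f at enough points. *)
Lemma intval_newton n f g : intval f g -> (size f <= n)%N ->
  f = \sum_(l < n) (newton (g \o Posz) l)%:~R *: bpoly 0 l.
Proof.
move=> fg sf; apply: (@eq_poly_nat n) => // [|i ltin].
  apply: (leq_trans (size_sum _ _ _)); apply/bigmax_leqP => l _.
  by rewrite (leq_trans (size_scale_leq _ _)) // size_bpoly.
rewrite -[i%:R]/((i%:Z)%:~R) fg -[g i]/((g \o Posz) i) (newton_sum _ ltin).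
rewrite rmorph_sum horner_sum; apply: eq_bigr => l _.
by rewrite hornerZ bpoly_horner addr0 ibin_nat -intrM -mulr_natr natz.
Qed.

(** * Straightening of divided powers *)

Section SlTriple.
Variables (A : algType C) (X Y H : A).
Hypothesis XY : X * Y = Y * X + H.
Hypothesis HX : H * X = X * (H + 2%:R).
Hypothesis HY : H * Y = Y * (H - 2%:R).

Local Notation hH := (horner_alg H).

Definition dpow (u : A) (m : nat) : A := locked ((m`!%:R : C)^-1 *: u ^+ m).
Definition hbin (c : int) (m : nat) : A :=
  locked ((m`!%:R : C)^-1 *: \prod_(i < m) (H + (c - i%:Z)%:~R)).

Lemma dpowE u m : dpow u m = (m`!%:R : C)^-1 *: u ^+ m.
Proof. by rewrite /dpow -lock. Qed.

Local Notation Xd := (dpow X).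
Local Notation Yd := (dpow Y).

Lemma hornerH_X (f : {poly C}) :
  hH f * X = X * hH (f \Po ('X + (2%:~R)%:P)).
Proof.
elim/poly_ind: f => [|f c IHf]; first by rewrite comp_poly0 rmorph0 mul0r mulr0.
rewrite comp_poly_MXaddC polyC_int [in LHS]rmorphD [in RHS]rmorphD.
rewrite [in LHS]rmorphM [in RHS]rmorphM /= horner_algX !horner_algC.
rewrite mulrDl mulrDr mulr_algl mulr_algr; congr (_ + _).
rewrite -mulrA HX mulrA IHf -mulrA polyC_int [hH ('X + _)]rmorphD /=.
by rewrite horner_algX [hH _%:~R]rmorph_int.
Qed.

Lemma hornerH_Y (f : {poly C}) :
  hH f * Y = Y * hH (f \Po ('X + ((-2)%:~R)%:P)).
Proof.
elim/poly_ind: f => [|f c IHf]; first by rewrite comp_poly0 rmorph0 mul0r mulr0.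
rewrite comp_poly_MXaddC polyC_int [in LHS]rmorphD [in RHS]rmorphD.
rewrite [in LHS]rmorphM [in RHS]rmorphM /= horner_algX !horner_algC.
rewrite mulrDl mulrDr mulr_algl mulr_algr; congr (_ + _).
rewrite -mulrA HY mulrA IHf -mulrA polyC_int [hH ('X + _)]rmorphD /=.
by rewrite horner_algX [hH _%:~R]rmorph_int mulrNz.
Qed.

Lemma hbinE c m : hbin c m = hH (bpoly c m).
Proof.
rewrite /hbin -lock /bpoly linearZ /= rmorph_prod.
under [in RHS]eq_bigr => i _ do rewrite rmorphD /= horner_algX rmorph_int.
by rewrite mulr_algl.
Qed.

Lemma hornerH_Z (c : C) f : c *: hH f = hH (c%:P * f).
Proof. by rewrite rmorphM /= horner_algC mulr_algl. Qed.

Lemma dpow0 u : dpow u 0 = 1.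
Proof. by rewrite !dpowE fact0 invr1 scale1r expr0. Qed.

Lemma dpowS u m : u * dpow u m = m.+1%:R *: dpow u m.+1.
Proof.
rewrite !dpowE -scalerAr -exprS scalerA factS natrM invfM mulVKf //.
exact: natC_neq0.
Qed.

Lemma dpow1 u : dpow u 1 = u.
Proof. by rewrite -[RHS]mulr1 -(dpow0 u) dpowS scale1r. Qed.

Lemma dpowM u m n :
  dpow u m * dpow u n = 'C(m + n, m)%:R *: dpow u (m + n).
Proof.
rewrite !dpowE -scalerAl -scalerAr -exprD !scalerA; congr (_ *: _).
apply: (mulfI (factC_neq0 m)); apply: (mulfI (factC_neq0 n)).
apply: (mulfI (factC_neq0 (m + n))).
have := bin_fact (leq_addr n m); rewrite addKn => <-.
rewrite !natrM; have := factC_neq0 n; have := factC_neq0 m.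
have : 'C(m + n, m)%:R != 0 :> C by rewrite natC_neq0 // bin_gt0 leq_addr.
by move=> c0 m0 n0; field; rewrite c0 m0 n0.
Qed.

Lemma hornerH_Xn f n :
  hH f * X ^+ n = X ^+ n * hH (f \Po ('X + ((2 * n)%:Z%:~R)%:P)).
Proof.
elim: n f => [|n IHn] f; first by rewrite muln0 addr0 comp_polyXr mul1r mulr1.
rewrite exprS mulrA hornerH_X -[in LHS]mulrA IHn mulrA; congr (_ * hH _).
rewrite -comp_polyA comp_polyD comp_polyX comp_polyC; congr (f \Po _).
by rewrite -addrA -polyCD -intrD mulnS PoszD [2%:Z + _]addrC.
Qed.

Lemma hornerH_Yn f n :
  hH f * Y ^+ n = Y ^+ n * hH (f \Po ('X + ((- (2 * n)%:Z)%:~R)%:P)).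
Proof.
elim: n f => [|n IHn] f; first by rewrite muln0 addr0 comp_polyXr mul1r mulr1.
rewrite exprS mulrA hornerH_Y -[in LHS]mulrA IHn mulrA; congr (_ * hH _).
rewrite -comp_polyA comp_polyD comp_polyX comp_polyC; congr (f \Po _).
rewrite -addrA -polyCD -intrD; congr ('X + (_%:~R)%:P); lia.
Qed.

Lemma hornerH_Xd f n :
  hH f * Xd n = Xd n * hH (f \Po ('X + ((2 * n)%:Z%:~R)%:P)).
Proof. by rewrite dpowE -scalerAr hornerH_Xn -scalerAl. Qed.

Lemma hornerH_Yd f n :
  hH f * Yd n = Yd n * hH (f \Po ('X + ((- (2 * n)%:Z)%:~R)%:P)).
Proof. by rewrite dpowE -scalerAr hornerH_Yn -scalerAl. Qed.

Lemma hbin_Xd c l n : hbin c l * Xd n = Xd n * hbin (c + (2 * n)%:Z) l.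
Proof. by rewrite !hbinE hornerH_Xd bpoly_shift. Qed.

Lemma hbin_Yd c l n : hbin c l * Yd n = Yd n * hbin (c - (2 * n)%:Z) l.
Proof. by rewrite !hbinE hornerH_Yd bpoly_shift. Qed.

Lemma natC_scaler_inj (n : nat) (u v : A) :
  n.+1%:R *: u = n.+1%:R *: v -> u = v.
Proof. by apply: scalerI; rewrite natC_neq0. Qed.

Lemma X_Yd n : X * Yd n.+1 = Yd n.+1 * X + Yd n * hH ('X - (n%:Z)%:~R).
Proof.
elim: n => [|n IHn].
  by rewrite dpow1 dpow0 XY subr0 horner_algX mul1r.
apply: (@natC_scaler_inj n.+1).
rewrite scalerAr -dpowS mulrA XY mulrDl -mulrA IHn mulrDr !mulrA.
rewrite !dpowS scalerDr -!scalerAl -addrA; congr (_ + _).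
rewrite -[in X in _ + X](horner_algX H) hornerH_Yd comp_polyX.
rewrite !scalerAr !hornerH_Z -mulrDr -rmorphD /=; congr (_ * hH _).
rewrite !polyC_natr polyC_int -[n.+1%:R]/((n.+1%:Z)%:~R).
rewrite -[n.+2%:R]/((n.+2%:Z)%:~R) [(2 * _)%N]mulnC !PoszM !intS.
rewrite !(intrD, intrM, mulrNz).
by ring.
Qed.

(** Divided powers of negative order are zero; truncated subtraction alone would give 1. *)
Definition yy n j : A := if (j <= n)%N then Yd (n - j) else 0.

Lemma X_yy n j : X * yy n j =
  yy n j * X + yy n j.+1 * hH ('X + (j.+1%:Z - n%:Z)%:~R).
Proof.
rewrite /yy; case: ltngtP => [jn|jn|<-].
- rewrite -[(n - j)%N]prednK ?subn_gt0 // X_Yd -subnS; congr (_ + _ * hH _).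
  by rewrite -[in RHS](subnKC jn) PoszD opprD addrA subrr add0r mulrNz.
- by rewrite !(mul0r, mulr0) addr0.
- by rewrite subnn dpow0 mulr1 mul1r mul0r addr0.
Qed.

(** Kostant's commutation formula, by induction on m after multiplying by X on the left. *)
Lemma Xd_Yd m n : Xd m * Yd n =
  \sum_(j < m.+1) yy n j * hbin ((2 * j)%:Z - (m + n)%:Z) j * Xd (m - j).
Proof.
elim: m => [|m IHm].
  by rewrite big_ord1 /yy leq0n subn0 hbinE bpoly0 rmorph1 dpow0 mul1r !mulr1.
apply: (@natC_scaler_inj m); rewrite scalerAl -dpowS -mulrA IHm mulr_sumr.
(* [G1] collects the terms in which X passes to the right, [G2] the commutator terms with the index
   raised by one. The factor m + 1 - j makes [G1 m.+1] vanish, so both can be summed over the same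
   range; termwise the claim is then Pascal's rule. *)
pose G1 j : A := (m.+1%:R - j%:R) *: (yy n j *
  hbin ((2 * j)%:Z - (m + n)%:Z - 2) j * Xd (m.+1 - j)).
pose G2 j : A := if j is i.+1 then yy n j * (hH ('X + (j%:Z - n%:Z)%:~R) *
  hbin ((2 * i)%:Z - (m + n)%:Z) i) * Xd (m.+1 - j) else 0.
transitivity (\sum_(j < m.+2) (G1 j + G2 j)); last first.
  rewrite scaler_sumr; apply: eq_bigr => -[[|j] /= _] _.
    by rewrite addr0 /G1 !hbinE !bpoly0 subr0.
  rewrite /G1 /G2 !hbinE scalerAl scalerAr hornerH_Z -rmorphM -mulrDl -mulrDr.
  rewrite -rmorphD /= scalerAl scalerAr hornerH_Z.
  congr (_ * hH _ * _).
  have -> : (2 * j.+1)%:Z - (m.+1 + n)%:Z = (2 * j)%:Z - (m + n)%:Z + 1.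
    by lia.
  have -> : (2 * j.+1)%:Z - (m + n)%:Z - 2 = (2 * j)%:Z - (m + n)%:Z by lia.
  rewrite bpoly_pascal; set c := (2 * j)%:Z - (m + n)%:Z.
  have := bpolyS c j; set b1 := bpoly c j.+1; set b0 := bpoly c j => b01.
  rewrite polyCB !polyC_natr mulrBl b01.
  have -> : 'X + (j.+1%:Z - n%:Z)%:~R =
     'X + (c - j%:Z)%:~R + m.+1%:R :> {poly C}.
    rewrite -[m.+1%:R]/((m.+1%:Z)%:~R) -addrA -intrD; congr ('X + _%:~R).
    by rewrite /c; lia.
  by ring.
have G1m : G1 m.+1 = 0 by rewrite /G1 subrr scale0r.
rewrite [in RHS]big_split /= [X in _ = X + _]big_ord_recr /= G1m addr0.
rewrite [X in _ = _ + X]big_ord_recl /= add0r -big_split /=.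
apply: eq_bigr => -[j /= jm] _; rewrite /bump /= add1n !mulrA X_yy.
rewrite !mulrDl; congr (_ + _).
have := hbin_Xd ((2 * j)%:Z - (m + n)%:Z - (2 * 1)%:Z) j 1.
rewrite dpow1 subrK => hX; rewrite -(mulrA (yy n j) X) -hX /G1 -!mulrA.
by rewrite dpowS subSn // -!scalerAr -natrB ?(ltnW jm) // subSn.
Qed.

Lemma comp_poly_natr (n : nat) (f : {poly C}) : n%:R \Po f = n%:R.
Proof. by rewrite -!polyC_natr comp_polyC. Qed.

Lemma comp_poly_one (f : {poly C}) : 1 \Po f = 1.
Proof. by rewrite -polyC1 comp_polyC. Qed.

Lemma X_hornerH f : X * hH f = hH (f \Po ('X - 2%:R)) * X.
Proof.
rewrite hornerH_X -comp_polyA comp_polyB comp_polyX comp_poly_natr.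
by rewrite polyC_int addrK comp_polyXr.
Qed.

Lemma Xn_YX m : X ^+ m * (Y * X) =
  (Y * X + hH (m%:R * ('X + 1 - m%:R))) * X ^+ m.
Proof.
elim: m => [|m IHm]; first by rewrite mul0r rmorph0 addr0 mul1r mulr1.
rewrite exprS -mulrA IHm mulrA [RHS]mulrA; congr (_ * _).
rewrite mulrDr [X * (Y * X)]mulrA XY X_hornerH -mulrDl; congr (_ * _).
rewrite -addrA; congr (_ + _).
rewrite -[X in X + _](horner_algX H) -rmorphD /=; congr (hH _).
rewrite comp_polyM comp_polyB comp_polyD comp_polyX comp_poly_one.
rewrite !comp_poly_natr -[m.+1]addn1 natrD.
by ring.
Qed.

Lemma YX_hornerH f : Y * X * hH f = hH f * (Y * X).
Proof.
rewrite mulrA hornerH_Y -!mulrA hornerH_X; congr (_ * (_ * hH _)).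
rewrite -comp_polyA comp_polyD comp_polyX !polyC_int rmorph_int.
by rewrite -addrA -intrD addr0 comp_polyXr.
Qed.

(** Moving one more factor YX through X^m by [Xn_YX] produces exactly the Cartan correction that is
    subtracted. On weight a, completing the square in these factors yields the nodes ((a+1)/2 + l)^2
    used with psi. *)
Lemma Yn_Xn m : Y ^+ m * X ^+ m =
  \prod_(l < m) (Y * X - hH (l%:R * ('X + 1 + l%:R))).
Proof.
elim: m => [|m IHm]; first by rewrite big_ord0 mul1r.
rewrite big_ord_recr /= -IHm mulrBr -[_ * (Y * X)]mulrA Xn_YX mulrDl mulrDr.
rewrite mulrA [Y ^+ m * _]mulrA -exprSr -[Y ^+ m.+1 * X * _]mulrA -exprS.
rewrite -[_ * _ * hH _]mulrA -[LHS]addr0 -addrA; congr (_ + _).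
apply/esym/eqP; rewrite subr_eq0; apply/eqP; congr (_ * _).
rewrite hornerH_Xn; congr (_ * hH _).
rewrite comp_polyM comp_polyB comp_polyD comp_polyX comp_poly_one.
rewrite !comp_poly_natr polyC_int.
rewrite PoszM intrM -[(m%:Z)%:~R]/(m%:R).
by ring.
Qed.

End SlTriple.

(** * Induced modules and coefficient functionals *)

(* The endomorphisms of an infinite-dimensional space have no algType         *)
(* instance, so [plift] does not apply and the action is built directly, on   *)
(* the vectors satisfying P.                                                  *)
Section FunctionRepresentation.
Variables (K : fieldType) (G S : Type) (f : G -> (S -> K) -> (S -> K)).

Fixpoint act (t : aexpr K G) (v : S -> K) : S -> K :=
  match t with
  | AGen g => f g v
  | AScal a => fun s => a * v s
  | AAdd t1 t2 => fun s => act t1 v s + act t2 v s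
  | AMul t1 t2 => act t1 (act t2 v)
  end.

Variable P : (S -> K) -> Prop.
Let lc (a : K) (u v : S -> K) : S -> K := fun s => a * u s + v s.
Hypothesis P0 : P (fun=> 0).
Hypothesis Plc : forall a u v, P u -> P v -> P (lc a u v).
Hypothesis Pf : forall g v, P v -> P (f g v).
Hypothesis flc : forall g a u v, P u -> P v ->
  f g (lc a u v) = lc a (f g u) (f g v).

Let PZ a v : P v -> P (fun s => a * v s).
Proof.
move=> Pv; rewrite (_ : (fun s => _) = lc a v (fun=> 0)); first exact: Plc.
by apply/funext => s; rewrite /lc addr0.
Qed.

Let PD u v : P u -> P v -> P (fun s => u s + v s).
Proof.
move=> Pu Pv; rewrite (_ : (fun s => _) = lc 1 u v); first exact: Plc.
by apply/funext => s; rewrite /lc mul1r.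
Qed.

Lemma act_P t v : P v -> P (act t v).
Proof.
elim: t v => [g|a|t IHt u IHu|t IHt u IHu] v Pv /=.
- exact: Pf.
- exact: PZ.
- by apply: PD; [apply: IHt | apply: IHu].
- exact/IHt/IHu.
Qed.

Lemma act_lc t a u v : P u -> P v ->
  act t (lc a u v) = lc a (act t u) (act t v).
Proof.
elim: t u v => [g|b|t IHt w IHw|t IHt w IHw] u v Pu Pv /=.
- exact: flc.
- by apply/funext => s; rewrite /lc; ring.
- by rewrite IHt // IHw //; apply/funext => s; rewrite /lc; ring.
- by rewrite IHw // IHt //; apply: act_P.
Qed.

Let act_scale t a v : P v -> act t (fun s => a * v s) = fun s => a * act t v s.
Proof.
have lcE u : lc (a - 1) u u = fun s => a * u s.
  by apply/funext => s; rewrite /lc mulrBl mul1r subrK.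
by move=> Pv; rewrite -!lcE act_lc.
Qed.

Let act_add t u v : P u -> P v ->
  act t (fun s => u s + v s) = fun s => act t u s + act t v s.
Proof.
have lcE u' v' : lc 1 u' v' = fun s => u' s + v' s.
  by apply/funext => s; rewrite /lc mul1r.
by move=> Pu Pv; rewrite -!lcE act_lc.
Qed.

Variable rel : aexpr K G -> aexpr K G -> Prop.
Hypothesis frel : forall s t, rel s t -> forall v, P v -> act s v = act t v.

Lemma act_cong s t : acong rel s t -> forall v, P v -> act s v = act t v.
Proof.
elim=> /= {s t}.
- exact: frel.
- by [].
- by move=> s t _ IH v Pv; rewrite IH.
- by move=> t s u _ IH1 _ IH2 v Pv; rewrite IH1 // IH2.
- by move=> s s' t t' _ IH1 _ IH2 v Pv; rewrite IH1 // IH2.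
- by move=> s s' t t' _ IH1 _ IH2 v Pv; rewrite IH2 // IH1 //; apply: act_P.
- by move=> s t u v Pv; apply/funext => x; rewrite addrA.
- by move=> s t v Pv; apply/funext => x; rewrite addrC.
- by move=> t v Pv; apply/funext => x; rewrite mul0r add0r.
- by move=> t v Pv; apply/funext => x; rewrite mulN1r addNr mul0r.
- by [].
- by move=> t v Pv; apply/funext => x; rewrite mul1r.
- by move=> t v Pv; rewrite act_scale //; apply/funext => x; rewrite mul1r.
- by [].
- by move=> s t u v Pv; rewrite act_add //; apply: act_P.
- by move=> a b v Pv; apply/funext => x; rewrite mulrDl.
- by move=> a b v Pv; apply/funext => x; rewrite mulrA.
- by move=> a t v Pv; rewrite act_scale.
Qed.

Definition pact (x : presalg rel) (v : S -> K) : S -> K := act (repr x) v.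

Lemma pact_pclass t v : P v -> pact (pclass rel t) v = act t v.
Proof. by move=> Pv; apply: act_cong => //; apply: reprP. Qed.

Lemma pact_P x v : P v -> P (pact x v).
Proof. exact: act_P. Qed.

Lemma pact_gen g v : P v -> pact (pgen rel g) v = f g v.
Proof. exact: pact_pclass. Qed.

Lemma pactM x y v : P v -> pact (x * y) v = pact x (pact y v).
Proof. exact: pact_pclass. Qed.

Lemma pact1 v : P v -> pact 1 v = v.
Proof.
move=> Pv; rewrite -[LHS]/(pact (pclass rel (AScal 1)) v) pact_pclass //.
by apply/funext => s /=; rewrite mul1r.
Qed.

Lemma pactD x y v s : P v -> pact (x + y) v s = pact x v s + pact y v s.
Proof.
move=> Pv.
exact: (congr1 (fun g => g s) (pact_pclass (AAdd (repr x) (repr y)) Pv)).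
Qed.

Lemma pactZ a x v s : P v -> pact (a *: x) v s = a * pact x v s.
Proof.
move=> Pv; have Px := pact_P x Pv.
rewrite -[LHS]/(pact (pscal rel a * x) v s) pactM //.
exact: (congr1 (fun g => g s) (pact_pclass (AScal a) Px)).
Qed.

Lemma pact_lc x a u v : P u -> P v ->
  pact x (fun s => a * u s + v s) = fun s => a * pact x u s + pact x v s.
Proof. exact: act_lc. Qed.

End FunctionRepresentation.

Lemma dpow_UC u m : dpow u m = divpow u m.
Proof. by rewrite dpowE. Qed.

Lemma hbin_UC c m : hbin UC_H c m = Hbinom c m.
Proof. by rewrite /hbin -lock. Qed.

Local Notation hH := (horner_alg UC_H).

Lemma X_UZ m : divpow UC_X m \in UZ_pred.
Proof. by rewrite inE; apply: sub_gen_smallest; exists m; left. Qed.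

Lemma Y_UZ m : divpow UC_Y m \in UZ_pred.
Proof. by rewrite inE; apply: sub_gen_smallest; exists m; right. Qed.

Lemma int_UZ (z : int) u : u \in UZ_pred -> z%:~R *: u \in UZ_pred.
Proof. by move=> uZ; rewrite scaler_int rpredMz. Qed.

(** For c = 0 it is the last term of the straightened X^(n) Y^(n), whose other terms involve
    binomials of lower index. A general c reduces to c = 0 by an integral Newton expansion. *)
Lemma hbin_UZ n c : hbin UC_H c n \in UZ_pred.
Proof.
elim/ltn_ind: n c => n IHn.
have hn : hbin UC_H 0 n \in UZ_pred.
  have := Xd_Yd UC_XY UC_HX UC_HY n n; rewrite big_ord_recr /= /yy leqnn !subnn.
  rewrite !dpow0 mul1r mulr1 (_ : _ - _ = 0); last by lia.
  set s := \sum_(_ < n) _ => XYn.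
  have -> : hbin UC_H 0 n = - s + dpow UC_X n * dpow UC_Y n.
    by rewrite XYn addKr.
  rewrite rpredD ?rpredN ?rpred_sum //.
    move=> [j /= jn] _; rewrite (ltnW jn) rpredM ?dpow_UC ?X_UZ //.
    by rewrite rpredM ?IHn ?Y_UZ.
  by rewrite rpredM ?dpow_UC ?X_UZ ?Y_UZ.
move=> c; rewrite hbinE.
have cE : intval (bpoly c n) (fun x => ibin (x + c) n) by exact: bpoly_horner.
rewrite (intval_newton cE (n := n.+1)) ?size_bpoly //.
rewrite rmorph_sum rpred_sum //= => -[l /= ln] _.
rewrite -mul_polyC -hornerH_Z -hbinE int_UZ //.
by move: ln; rewrite ltnS leq_eqVlt => /orP [/eqP ->|/IHn].
Qed.

Lemma intval_UZ f g : intval f g -> hH f \in UZ_pred.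
Proof.
move=> fg; rewrite (intval_newton fg (leqnn _)).
rewrite rmorph_sum rpred_sum //= => l _.
by rewrite -mul_polyC -hornerH_Z -hbinE int_UZ // hbin_UZ.
Qed.

Section PBW.
(* Left module induced from the character H = b of C[H], in the basis         *)
(* Y^(i) X^(j) v_b: [F (i, j)] is the coefficient at that vector.             *)
Variable b : int.

(** The two terms come from X Y^(i+1) = Y^(i+1) X + Y^(i) (H - i), where X^(j) v_b has weight b +
    2j. *)
Definition opX (F : nat * nat -> C) : nat * nat -> C := fun '(i, j) =>
  j%:R * F (i, j.-1) + (b%:~R + j%:R + j%:R - i%:R) * F (i.+1, j).
Definition opY (F : nat * nat -> C) : nat * nat -> C := fun '(i, j) =>
  i%:R * F (i.-1, j).
Definition opH (F : nat * nat -> C) : nat * nat -> C := fun '(i, j) =>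
  (b%:~R + j%:R + j%:R - i%:R - i%:R) * F (i, j).

Definition op_sl2 (A : sl2) (F : nat * nat -> C) : nat * nat -> C := fun s =>
  val A 0 1 * opX F s + val A 1 0 * opY F s + val A 0 0 * opH F s.

Lemma op_sl2_lc A a u v : op_sl2 A (fun s => a * u s + v s) =
  (fun s => a * op_sl2 A u s + op_sl2 A v s).
Proof.
by apply/funext => -[i j]; rewrite /op_sl2 /opX /opY /opH; ring.
Qed.

Lemma sl2_11 (A : sl2) : val A 1 1 = - val A 0 0.
Proof.
case: A => A /=; rewrite /mxtrace !big_ord_recl big_ord0 addr0 addrC => h.
have -> : 1 = lift ord0 ord0 :> 'I_2 by apply/val_inj.
by apply/eqP; rewrite -addr_eq0.
Qed.

Lemma mulmx2E (A B : 'M[C]_2) i j :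
  (A *m B) i j = A i 0 * B 0 j + A i 1 * B 1 j.
Proof.
rewrite mxE !big_ord_recl big_ord0 addr0.
by have -> : 1 = lift ord0 ord0 :> 'I_2 by apply/val_inj.
Qed.

Lemma op_sl2_rel s t : sl2_rel s t -> forall F, True ->
  act op_sl2 s F = act op_sl2 t F.
Proof.
case=> [c A B D hD|A B D hD] F _; apply/funext => -[i j] /=.
  by rewrite /op_sl2 hD !mxE; ring.
have hDE k l : val D k l =
    val A k 0 * val B 0 l + val A k 1 * val B 1 l -
    (val B k 0 * val A 0 l + val B k 1 * val A 1 l).
  by rewrite hD -!mulmx2E !mxE.
rewrite /op_sl2 !hDE !sl2_11 /opX /opY /opH.
move: (val A 0 0) (val A 0 1) (val A 1 0) (val B 0 0) (val B 0 1) (val B 1 0).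
move=> a1 a2 a3 b1 b2 b3.
by case: i j => [|i] [|j] /=; rewrite ?mulrS; ring.
Qed.

Definition uact : UC -> (nat * nat -> C) -> nat * nat -> C :=
  @pact _ _ _ op_sl2 sl2_rel.

Let Plc (a : C) (u v : nat * nat -> C) (_ _ : True) : True := I.
Let Pf (A : sl2) (v : nat * nat -> C) (_ : True) : True := I.
Let flc A a u v (_ _ : True) := op_sl2_lc A a u v.

Lemma uactM x y v : uact (x * y) v = uact x (uact y v).
Proof. exact: (pactM (P := fun=> True) I Plc Pf flc op_sl2_rel). Qed.

Lemma uact1 v : uact 1 v = v.
Proof. exact: (pact1 (P := fun=> True) I Plc Pf flc op_sl2_rel). Qed.

Lemma uactD x y v s : uact (x + y) v s = uact x v s + uact y v s.
Proof. exact: (pactD (P := fun=> True) I Plc Pf flc op_sl2_rel). Qed.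

Lemma uactZ a x v s : uact (a *: x) v s = a * uact x v s.
Proof. exact: (pactZ (P := fun=> True) I Plc Pf flc op_sl2_rel). Qed.

Lemma uactN x v s : uact (- x) v s = - uact x v s.
Proof. by rewrite -scaleN1r uactZ mulN1r. Qed.

Lemma uact_gen A v : uact (pgen sl2_rel A) v = op_sl2 A v.
Proof. exact: (pact_gen (P := fun=> True) I Plc Pf flc op_sl2_rel). Qed.

Lemma uact_scale x a v :
  uact x (fun s => a * v s) = fun s => a * uact x v s.
Proof.
rewrite (_ : (fun s => a * v s) = fun s => (a - 1) * v s + v s).
  rewrite /uact (pact_lc (P := fun=> True) I Plc Pf flc) //.
  by apply/funext => s; rewrite mulrBl mul1r subrK.
by apply/funext => s; rewrite mulrBl mul1r subrK.
Qed.

Lemma uact_X v : uact UC_X v = opX v.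
Proof.
rewrite uact_gen; apply/funext => s.
by rewrite /op_sl2 /= !mxE /= mul1r !mul0r !addr0.
Qed.

Lemma uact_Y v : uact UC_Y v = opY v.
Proof.
rewrite uact_gen; apply/funext => s.
by rewrite /op_sl2 /= !mxE /= mul1r !mul0r addr0 add0r.
Qed.

Lemma uact_H v : uact UC_H v = opH v.
Proof.
rewrite uact_gen; apply/funext => s.
by rewrite /op_sl2 /= !mxE /= !subr0 mul1r !mul0r !add0r.
Qed.

Definition vec (i j : nat) : nat * nat -> C := fun s => (s == (i, j))%:R.

Lemma opX_vec j : opX (vec 0 j) = fun s => j.+1%:R * vec 0 j.+1 s.
Proof.
apply/funext => -[i' [|j']]; rewrite /opX /vec !xpair_eqE /= ?mulr0 ?mul0r.
  by rewrite ?andbF ?mulr0 ?addr0.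
rewrite addr0 eqSS; case: (j' =P j) => [->|_]; first by [].
by rewrite andbF !mulr0.
Qed.

Lemma opY_vec i j : opY (vec i j) = fun s => i.+1%:R * vec i.+1 j s.
Proof.
apply/funext => -[[|i'] j']; rewrite /opY /vec !xpair_eqE /= ?mulr0 ?mul0r //.
rewrite eqSS; case: eqP => [->|_]; first by [].
by rewrite !mulr0.
Qed.

Lemma opH_vec i j : opH (vec i j) =
  fun s => (b + (2 * j)%:Z - (2 * i)%:Z)%:~R * vec i j s.
Proof.
apply/funext => -[i' j']; rewrite /opH /vec xpair_eqE.
case: eqP => [->|_]; last by rewrite !mulr0.
case: eqP => [->|_]; last by rewrite !mulr0.
rewrite intrB intrD !PoszM !intrM -[(i%:Z)%:~R]/(i%:R) -[(j%:Z)%:~R]/(j%:R).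
by ring.
Qed.

Lemma uact_hornerH f i j : uact (hH f) (vec i j) =
  fun s => f.[(b + (2 * j)%:Z - (2 * i)%:Z)%:~R] * vec i j s.
Proof.
elim/poly_ind: f => [|f c IHf].
  by rewrite rmorph0 -(scale0r 0) horner0; apply/funext => s; rewrite uactZ !mul0r.
rewrite rmorphD rmorphM /= horner_algX horner_algC; apply/funext => s.
rewrite uactD uactM uact_H opH_vec uact_scale IHf uactZ.
rewrite hornerMXaddC mulrDl; congr (_ + _); first by ring.
congr (c * _).
by rewrite uact1.
Qed.

Lemma uact_Xd n : uact (dpow UC_X n) (vec 0 0) = vec 0 n.
Proof.
elim: n => [|n IHn]; first by rewrite dpow0 uact1.
apply/funext => s; apply: (mulfI (natC_neq0 (ltn0Sn n))).
by rewrite -uactZ -dpowS uactM IHn uact_X opX_vec.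
Qed.

Lemma uact_Yd m n : uact (dpow UC_Y m) (vec 0 n) = vec m n.
Proof.
elim: m => [|m IHm]; first by rewrite dpow0 uact1.
apply/funext => s; apply: (mulfI (natC_neq0 (ltn0Sn m))).
by rewrite -uactZ -dpowS uactM IHm uact_Y opY_vec.
Qed.

(** A monomial sends v_b to a multiple of a single basis vector, and as b varies the multiple runs
    through values of f at integers: monomials are thus told apart by these coefficients. *)
Lemma uact_mon m f g n s : intval f g ->
  uact (dpow UC_Y m * hH f * dpow UC_X n) (vec 0 0) s =
  (g (b + (2 * n)%:Z) * (s == (m, n)))%:~R.
Proof.
move=> fg; rewrite !uactM uact_Xd uact_hornerH uact_scale uact_Yd.
by rewrite muln0 subr0 fg intrM -[X in _ = _ * X]/((_ : bool)%:R).
Qed.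

End PBW.

(** Kostant's Z-form as an additive group. Integer-valued polynomials replace the binomials in H, so
    that shifts and products in the Cartan part keep the same shape. *)
Inductive KZ : UC -> Prop :=
| KZ_mon m f g n : intval f g ->
    KZ (dpow UC_Y m * hH f * dpow UC_X n)
| KZ_sub u v : KZ u -> KZ v -> KZ (u - v).

Lemma KZ0 : KZ 0.
Proof.
have := @KZ_mon 0 0 (fun=> 0) 0; rewrite rmorph0 mulr0 mul0r; apply.
by move=> x; rewrite horner0.
Qed.

Lemma KZN u : KZ u -> KZ (- u).
Proof. by rewrite -[- u]add0r; apply: KZ_sub KZ0. Qed.

Lemma KZD u v : KZ u -> KZ v -> KZ (u + v).
Proof. by move=> uK /KZN vK; rewrite -[v]opprK; apply: KZ_sub. Qed.

Lemma KZ_nat n u : KZ u -> KZ (n%:R *: u).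
Proof.
move=> uK; elim: n => [|n IHn]; first by rewrite scale0r; exact: KZ0.
by rewrite -natr1 scalerDl scale1r; apply: KZD.
Qed.

Lemma intvalM f f' g g' : intval f g -> intval f' g' ->
  intval (f * f') (fun x => g x * g' x).
Proof. by move=> fg fg' x; rewrite hornerM fg fg' intrM. Qed.

Lemma intval_shift f g (d : int) : intval f g ->
  intval (f \Po ('X + (d%:~R)%:P)) (fun x => g (x + d)).
Proof. by move=> fg x; rewrite horner_comp hornerD hornerX hornerC -intrD fg. Qed.

Lemma Xd_hornerH n f : dpow UC_X n * hH f =
  hH (f \Po ('X + ((- (2 * n)%:Z)%:~R)%:P)) * dpow UC_X n.
Proof.
rewrite (hornerH_Xd UC_HX) -comp_polyA comp_polyD comp_polyX comp_polyC.
by rewrite -addrA -polyCD -intrD subrr addr0 comp_polyXr.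
Qed.

Lemma KZ_X n u : KZ u -> KZ (dpow UC_X n * u).
Proof.
elim=> [m f g n' fg|v w _ IHv _ IHw]; last by rewrite mulrBr; apply: KZ_sub.
rewrite !mulrA (Xd_Yd UC_XY UC_HX UC_HY) !mulr_suml.
elim/big_ind: _ => [||j _]; [exact: KZ0 | exact: KZD | rewrite /yy].
case: ifP => _; last by rewrite !mul0r; exact: KZ0.
rewrite -[_ * _ * hH f]mulrA Xd_hornerH !mulrA.
rewrite -[_ * _ * dpow _ n']mulrA dpowM -!scalerAr.
apply: KZ_nat; rewrite hbinE -[_ * _ * hH _]mulrA -rmorphM.
apply: KZ_mon; apply: intvalM; last exact: intval_shift.
exact: bpoly_horner.
Qed.

Lemma KZ_Y n u : KZ u -> KZ (dpow UC_Y n * u).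
Proof.
elim=> [m f g n' fg|v w _ IHv _ IHw]; last by rewrite mulrBr; apply: KZ_sub.
rewrite !mulrA dpowM -!scalerAl; apply: KZ_nat; exact: KZ_mon.
Qed.

(** The elements v with v [KZ] contained in [KZ] form a subring containing the generators; apply u
    to 1. *)
Lemma UZ_KZ u : u \in UZ_pred -> KZ u.
Proof.
rewrite inE => /(_ [set v | forall w, KZ w -> KZ (v * w)]) h.
rewrite -[u]mulr1; apply: h; last first.
  have := @KZ_mon 0 1 (fun=> 1) 0; rewrite rmorph1 !dpow0 !mulr1; apply.
  by move=> x; rewrite hornerC.
split; last first.
  move=> v [m [->|->]] w wK; rewrite -dpow_UC.
    exact: KZ_X.
  exact: KZ_Y.
split; rewrite ?inE /=.
- by move=> w; rewrite mul1r.
- move=> v w; rewrite !inE /= => vK wK x xK.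
  by rewrite mulrBl; apply: KZ_sub; [apply: vK | apply: wK].
- move=> v w; rewrite !inE /= => vK wK x xK.
  by rewrite -mulrA; apply/vK/wK.
Qed.

(** * Coefficient functionals on the hyperalgebra *)

Section Functional.
Variables (k : fieldType).
Variables (b : int) (i j : nat).

Lemma UZ_coef_int (u : UZ) :
  exists z : int, uact b (val u) (vec 0 0) (i, j) == z%:~R.
Proof.
elim: (UZ_KZ (valP u)) => [m f g n fg|v w _ [z /eqP zv] _ [z' /eqP zw]].
  by eexists; rewrite (uact_mon _ _ _ _ fg).
by exists (z - z'); rewrite uactD uactN zv zw intrB.
Qed.

Definition UZ_coef (u : UZ) : k := (xchoose (UZ_coef_int u))%:~R.

Lemma UZ_coefE (u : UZ) (z : int) :
  uact b (val u) (vec 0 0) (i, j) = z%:~R -> UZ_coef u = z%:~R.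
Proof.
rewrite (eqP (xchooseP (UZ_coef_int u))) /UZ_coef => /(@intr_inj C).
by move=> ->.
Qed.

Lemma UZ_coefD : {morph UZ_coef : u v / u + v}.
Proof.
move=> u v; rewrite {2 3}/UZ_coef -intrD; apply: UZ_coefE.
rewrite rmorphD uactD intrD.
by congr (_ + _); apply/eqP; rewrite (xchooseP (UZ_coef_int _)).
Qed.

(** Right translation of the argument turns the additive maps from U_Z to k into a left module over
    U_Z (x) k. Translating [UZ_coef] and evaluating at 1 defines a functional on the hyperalgebra
    without recourse to a basis. *)
Definition gen_fun (g : UZ * k) (phi : UZ -> k) : UZ -> k :=
  fun v => g.2 * phi (v * g.1).

Definition additive_fun (phi : UZ -> k) : Prop := {morph phi : u v / u + v}.

Let P0 : additive_fun (fun=> 0).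
Proof. by move=> u v; rewrite addr0. Qed.

Let Plc (a : k) (u v : UZ -> k) :
  additive_fun u -> additive_fun v -> additive_fun (fun s => a * u s + v s).
Proof. by move=> uA vA s t; rewrite uA vA mulrDr addrACA. Qed.

Let Pf g v : additive_fun v -> additive_fun (gen_fun g v).
Proof. by move=> vA s t; rewrite /gen_fun mulrDl vA mulrDr. Qed.

Let flc g (a : k) (u v : UZ -> k) : additive_fun u -> additive_fun v ->
  gen_fun g (fun s => a * u s + v s) =
  fun s => a * gen_fun g u s + gen_fun g v s.
Proof. by move=> _ _; apply/funext => s; rewrite /gen_fun; ring. Qed.

Let frel s t : @tensor_rel k s t -> forall v, additive_fun v ->
  act gen_fun s v = act gen_fun t v.
Proof.
case=> [u v c|u c d|u v c d|c] phi phiA; apply/funext => x /=;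
  rewrite /gen_fun /=.
- by rewrite mulrDr phiA mulrDr.
- by rewrite mulrDl.
- by rewrite mulrA mulrA.
- by rewrite mulr1.
Qed.

Definition hyp_coef (x : hyperalgebra k) : k :=
  pact gen_fun x UZ_coef 1.

Lemma hyp_coefD : {morph hyp_coef : x y / x + y}.
Proof. by move=> x y; apply: (pactD P0 Plc Pf flc frel _ _ _ UZ_coefD). Qed.

Lemma hyp_coefZ a x : hyp_coef (a *: x) = a * hyp_coef x.
Proof. exact: (pactZ P0 Plc Pf flc frel _ _ _ UZ_coefD). Qed.

Lemma hyp_coef_to_U (u : UC) (z : int) : u \in UZ_pred ->
  uact b u (vec 0 0) (i, j) = z%:~R -> hyp_coef (to_U k u) = z%:~R.
Proof.
move=> uZ uz; rewrite /hyp_coef /to_U.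
rewrite (pact_gen P0 Plc Pf flc frel _ UZ_coefD) /gen_fun /= !mul1r.
by apply: UZ_coefE; rewrite insubdK.
Qed.

Lemma hyp_coef_mon m f g n : intval f g ->
  hyp_coef (to_U k (dpow UC_Y m * hH f * dpow UC_X n)) =
  (g (b + (2 * n)%:Z))%:~R * ((i, j) == (m, n))%:R.
Proof.
move=> fg; rewrite (hyp_coef_to_U _ (uact_mon _ _ _ _ fg)) ?intrM //.
by rewrite !rpredM ?(intval_UZ fg) // dpow_UC ?X_UZ ?Y_UZ.
Qed.

End Functional.

(** Compare leading coefficients: 1/(l! m!) against the top Newton coefficient divided by (l+m)!. *)
Lemma newton_ibinM_top l m :
  newton (fun i : nat => ibin i%:Z l * ibin i%:Z m) (l + m) = 'C(l + m, l)%:Z.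
Proof.
have fg : intval (bpoly 0 l * bpoly 0 m) (fun x => ibin x l * ibin x m).
  by apply: intvalM => x; rewrite bpoly_horner addr0.
have sf : size (bpoly 0 l * bpoly 0 m) = (l + m).+1.
  by rewrite size_mul -?size_poly_gt0 size_bpoly // size_bpoly addnS.
have lc : (bpoly 0 l * bpoly 0 m)`_(l + m) = (l`!%:R)^-1 * (m`!%:R)^-1.
  by rewrite -!(lead_coef_bpoly 0) -lead_coefM lead_coefE sf.
have := intval_newton fg (n := (l + m).+1); rewrite sf => /(_ (leqnn _)).
move=> /(congr1 (fun f : {poly C} => f`_(l + m))).
rewrite lc big_ord_recr /= coefD coef_sum big1 ?add0r; last first.
  by move=> [i /= im] _; rewrite coefZ nth_default ?mulr0 // size_bpoly.
rewrite coefZ; have -> : (bpoly 0 (l + m))`_(l + m) = ((l + m)`!%:R)^-1.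
  by rewrite -(lead_coef_bpoly 0) lead_coefE size_bpoly.
move=> /(congr1 (fun x => x * (l + m)`!%:R)).
rewrite mulfVK ?factC_neq0 // -(bin_fact (leq_addr m l)) addKn => h.
apply: (@intr_inj C); rewrite -[RHS]/('C(l + m, l)%:R) -h !natrM.
by field; rewrite !factC_neq0.
Qed.

(** * Relations and functionals of the hyperalgebra, collected in a record *)

Section HypData.
Variable k : fieldType.

(* The facts about the hyperalgebra needed below.  The functional given by    *)
(* [hcoef] is the coefficient of Y^(i) . X^(j) on the vector of weight b; it  *)
(* expresses the independence of the basis.                                   *)
Record hyp_data (A : algType k) := HypData {
  hX : nat -> A;
  hY : nat -> A;
  hb : int -> nat -> A;
  hX0 : hX 0 = 1;
  hY0 : hY 0 = 1;
  hXM : forall m n, hX m * hX n = 'C(m + n, m)%:R *: hX (m + n);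
  hYM : forall m n, hY m * hY n = 'C(m + n, m)%:R *: hY (m + n);
  hbX : forall c l n, hb c l * hX n = hX n * hb (c + (2 * n)%:Z) l;
  hbY : forall c l n, hb c l * hY n = hY n * hb (c - (2 * n)%:Z) l;
  hXY : forall m n, hX m * hY n = \sum_(j < m.+1)
    (if (j <= n)%N then hY (n - j) else 0) *
    hb ((2 * j)%:Z - (m + n)%:Z) j * hX (m - j);
  hbE : forall c l M, (l < M)%N -> hb c l = \sum_(i < M)
    (newton (fun x : nat => ibin (x%:Z + c) l) i)%:~R *: hb 0 i;
  hbM : forall l m M, (l + m < M)%N -> hb 0 l * hb 0 m = \sum_(i < M)
    (newton (fun x : nat => ibin x%:Z l * ibin x%:Z m) i)%:~R *: hb 0 i;
  hYX_comm : forall m n,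
    (hY m * hX m) * (hY n * hX n) = (hY n * hX n) * (hY m * hX m);
  hYX_prod : forall m, hY 1 ^+ m * hX 1 ^+ m =
    \prod_(l < m) (hY 1 * hX 1 - l%:R * (hb 0 1 + 1 + l%:R));
  hcoef : forall (b : int) (i j : nat), exists lam : A -> k,
    [/\ {morph lam : x y / x + y}, forall c x, lam (c *: x) = c * lam x
      & forall m c l n, lam (hY m * hb c l * hX n) =
          (ibin (b + (2 * n)%:Z + c) l)%:~R * ((i, j) == (m, n))%:R]
}.

Lemma to_U_rel (s t : aexpr k (UZ * k)) : tensor_rel s t ->
  pclass (@tensor_rel k) s = pclass (@tensor_rel k) t.
Proof. by move=> st; apply/pclassP/acong_rel. Qed.

Lemma insubd_UZ (u : UC) : u \in UZ_pred -> val (insubd (0 : UZ) u) = u.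
Proof. by move=> uZ; rewrite insubdK. Qed.

Lemma to_UD u v : u \in UZ_pred -> v \in UZ_pred ->
  to_U k (u + v) = to_U k u + to_U k v.
Proof.
move=> uZ vZ; rewrite /to_U; have -> : insubd 0 (u + v) =
    insubd 0 u + insubd 0 v :> UZ.
  by apply/val_inj; rewrite rmorphD /= !insubd_UZ ?rpredD.
rewrite -[RHS]/(padd (pclass _ _) (pclass _ _)) paddE.
exact/to_U_rel/tensor_Dl.
Qed.

Lemma to_UM u v : u \in UZ_pred -> v \in UZ_pred ->
  to_U k (u * v) = to_U k u * to_U k v.
Proof.
move=> uZ vZ; rewrite /to_U; have -> : insubd 0 (u * v) =
    insubd 0 u * insubd 0 v :> UZ.
  by apply/val_inj; rewrite rmorphM /= !insubd_UZ ?rpredM.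
rewrite -[RHS]/(pmul (pclass _ _) (pclass _ _)) pmulE.
by rewrite -[in LHS](mulr1 (1 : k)); apply/to_U_rel/tensor_M.
Qed.

Lemma to_U1 : to_U k 1 = 1.
Proof.
rewrite /to_U; have -> : insubd 0 1 = 1 :> UZ.
  by apply/val_inj; rewrite rmorph1 insubd_UZ ?rpred1.
exact/to_U_rel/tensor_scal.
Qed.

Lemma to_U0 : to_U k 0 = 0.
Proof.
by apply: (addrI (to_U k 0)); rewrite -to_UD ?rpred0 // !addr0.
Qed.

Lemma to_UN u : u \in UZ_pred -> to_U k (- u) = - to_U k u.
Proof.
move=> uZ; apply: (addrI (to_U k u)); rewrite subrr -to_UD ?rpredN //.
by rewrite subrr to_U0.
Qed.

Lemma to_UZ (z : int) u : u \in UZ_pred ->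
  to_U k (z%:~R *: u) = z%:~R *: to_U k u.
Proof.
move=> uZ; rewrite !scaler_int.
elim: z => [|n IHn|n IHn]; first by rewrite !mulr0z to_U0.
  by rewrite -!pmulrn !mulrS to_UD ?pmulrn ?IHn // rpredMz.
rewrite !mulrNz -!pmulrn to_UN ?rpredMn // !pmulrn; move: IHn.
rewrite !mulrNz -!pmulrn to_UN ?rpredMn // => /oppr_inj h.
by rewrite !mulrS to_UD ?rpredMn // h.
Qed.

Lemma to_U_sum (I : finType) (P : pred I) (F : I -> UC) :
  (forall i, P i -> F i \in UZ_pred) ->
  to_U k (\sum_(i | P i) F i) = \sum_(i | P i) to_U k (F i).
Proof.
move=> FZ; have [_ ->] : (\sum_(i | P i) F i \in UZ_pred) /\
  to_U k (\sum_(i | P i) F i) = \sum_(i | P i) to_U k (F i); last by [].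
apply: (big_rec2 (fun u x => u \in UZ_pred /\ to_U k u = x)).
  by rewrite to_U0 rpred0.
by move=> i u x /FZ FiZ [uZ <-]; rewrite to_UD // rpredD.
Qed.

Lemma to_U_prod (I : Type) (r : seq I) (F : I -> UC) :
  (forall i, F i \in UZ_pred) ->
  to_U k (\prod_(i <- r) F i) = \prod_(i <- r) to_U k (F i).
Proof.
move=> FZ; elim: r => [|i r IHr]; first by rewrite !big_nil to_U1.
by rewrite !big_cons to_UM ?IHr // rpred_prod.
Qed.

Lemma to_UX u n : u \in UZ_pred -> to_U k (u ^+ n) = to_U k u ^+ n.
Proof.
move=> uZ; elim: n => [|n IHn]; first by rewrite !expr0 to_U1.
by rewrite !exprS to_UM ?rpredX // IHn.
Qed.

Let dX m : dpow UC_X m \in UZ_pred. Proof. by rewrite dpow_UC X_UZ. Qed.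
Let dY m : dpow UC_Y m \in UZ_pred. Proof. by rewrite dpow_UC Y_UZ. Qed.

Let XE m : U_X k m = to_U k (dpow UC_X m).
Proof. by rewrite dpow_UC. Qed.
Let YE m : U_Y k m = to_U k (dpow UC_Y m).
Proof. by rewrite dpow_UC. Qed.
Let bE c m : U_binom k c m = to_U k (hbin UC_H c m).
Proof. by rewrite hbin_UC. Qed.

Lemma to_U_newton f g M : intval f g -> (size f <= M)%N ->
  to_U k (horner_alg UC_H f) = \sum_(i < M)
    (newton (fun x : nat => g x%:Z) i)%:~R *: U_binom k 0 i.
Proof.
move=> fg sf; rewrite (intval_newton fg sf) rmorph_sum to_U_sum /=.
  apply: eq_bigr => i _.
  by rewrite -mul_polyC -hornerH_Z -hbinE to_UZ ?hbin_UZ // bE.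
by move=> i _; rewrite -mul_polyC -hornerH_Z -hbinE int_UZ // hbin_UZ.
Qed.

(** By [Yn_Xn] both sides are built from YX and polynomials in H, which commute because YX has
    weight zero. *)
Lemma YX_commC m n : GRing.comm (dpow UC_Y m * dpow UC_X m)
  (dpow UC_Y n * dpow UC_X n).
Proof.
have HC (f f' : {poly C}) :
    GRing.comm (horner_alg UC_H f) (horner_alg UC_H f').
  by rewrite /GRing.comm -!rmorphM mulrC.
have tC (f : {poly C}) : GRing.comm (UC_Y * UC_X) (horner_alg UC_H f).
  exact: (YX_hornerH UC_HX UC_HY).
have gC (f f' : {poly C}) : GRing.comm (UC_Y * UC_X - horner_alg UC_H f)
    (UC_Y * UC_X - horner_alg UC_H f').
  apply: commrB; apply/commr_sym; apply: commrB; try exact: HC.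
  - by [].
  - exact: tC.
  - exact/commr_sym/tC.
have: GRing.comm (UC_Y ^+ m * UC_X ^+ m) (UC_Y ^+ n * UC_X ^+ n).
  rewrite !(Yn_Xn UC_XY UC_HX).
  apply: commr_prod => i _; apply/commr_sym; apply: commr_prod => j _.
  exact: gC.
rewrite /GRing.comm !dpowE => h.
by rewrite -!(scalerAl, scalerAr) h !scalerA mulrC.
Qed.

Definition hyp_data_U : hyp_data (hyperalgebra k).
Proof.
refine (@HypData _ (U_X k) (U_Y k) (U_binom k) _ _ _ _ _ _ _ _ _ _ _ _).
- by rewrite XE dpow0 to_U1.
- by rewrite YE dpow0 to_U1.
- move=> m n; rewrite !XE -to_UM // dpowM.
  by rewrite -[_%:R in LHS]/(('C(m + n, m)%:Z)%:~R) to_UZ.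
- move=> m n; rewrite !YE -to_UM // dpowM.
  by rewrite -[_%:R in LHS]/(('C(m + n, m)%:Z)%:~R) to_UZ.
- by move=> c l n; rewrite !bE !XE -!to_UM ?hbin_UZ // (hbin_Xd UC_HX).
- by move=> c l n; rewrite !bE !YE -!to_UM ?hbin_UZ // (hbin_Yd UC_HY).
- move=> m n; rewrite XE YE -to_UM // (Xd_Yd UC_XY UC_HX UC_HY) to_U_sum.
    apply: eq_bigr => j _; rewrite /yy; case: ifP => _; last first.
      by rewrite !mul0r to_U0.
    by rewrite !to_UM ?rpredM ?hbin_UZ // bE XE YE.
  move=> j _; rewrite /yy; case: ifP => _; last by rewrite !mul0r rpred0.
  by rewrite !rpredM ?hbin_UZ.
- move=> c l M lM; rewrite bE hbinE.
  apply: (@to_U_newton _ (fun x => ibin (x + c) l)); last by rewrite size_bpoly.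
  exact: bpoly_horner.
- move=> l m M lmM; rewrite !bE -to_UM ?hbin_UZ // !hbinE -rmorphM.
  apply: (@to_U_newton _ (fun x => ibin x l * ibin x m)).
    by apply: intvalM => x; rewrite bpoly_horner addr0.
  by rewrite size_mul -?size_poly_gt0 !size_bpoly //= addnS.
- by move=> m n; rewrite !YE !XE -!to_UM ?rpredM // YX_commC.
- move=> m; have YZ : UC_Y \in UZ_pred by rewrite -(dpow1 UC_Y).
  have XZ : UC_X \in UZ_pred by rewrite -(dpow1 UC_X).
  have HZ : UC_H \in UZ_pred.
    have := hbin_UZ 1 0; rewrite hbinE.
    have := bpolyS 0 0; rewrite bpoly0 mul1r mulr1 subr0 addr0 => ->.
    by rewrite horner_algX.
  have bH : U_binom k 0 1 = to_U k UC_H.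
    rewrite bE hbinE; have := bpolyS 0 0.
    by rewrite bpoly0 mul1r mulr1 subr0 addr0 => ->; rewrite horner_algX.
  rewrite XE YE !dpow1 -!to_UX // -!to_UM ?rpredX // (Yn_Xn UC_XY UC_HX).
  have sH (l : nat) : horner_alg UC_H (l%:R * ('X + 1 + l%:R)) =
      l%:R * (UC_H + 1 + l%:R).
    by rewrite rmorphM !rmorphD /= horner_algX rmorph1 !rmorph_nat.
  have natU (l : nat) : to_U k (l%:R) = l%:R.
    elim: l => [|l IHl]; rewrite ?to_U0 // -!natr1.
    by rewrite to_UD ?rpred1 ?rpred_nat // IHl to_U1.
  rewrite to_U_prod; last first.
    move=> l; rewrite sH rpredB // rpredM ?rpred_nat //.
    by rewrite ?rpredD ?rpred1 ?rpred_nat.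
  apply: eq_bigr => l _; rewrite sH bH.
  rewrite to_UD ?rpredN ?rpredM ?rpredD ?rpred1 ?rpred_nat //.
  rewrite to_UN ?rpredM ?rpredD ?rpred1 ?rpred_nat //.
  rewrite !to_UM ?rpredD ?rpred1 ?rpred_nat //.
  by rewrite !to_UD ?rpredD ?rpred1 ?rpred_nat // !natU to_U1.
- move=> b i j; exists (@hyp_coef k b i j); split.
  + exact: hyp_coefD.
  + exact: hyp_coefZ.
  move=> m c l n; rewrite XE YE bE -!to_UM ?rpredM ?hbin_UZ // hbinE.
  have bcl : intval (bpoly c l) (fun x => ibin (x + c) l).
    exact: bpoly_horner.
  exact: (hyp_coef_mon _ _ _ _ _ _ bcl).
Defined.

End HypData.

(** * Binomials and base-p digits, indicators of weights *)

Section Binomials.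
Variables (k : fieldType) (p : nat).
Hypothesis hp : p \in [pchar k].
Let p_pr : prime p := pcharf_prime hp.

(** By periodicity a + b may be lowered by p^N, which makes it smaller than a. *)
Lemma bin_wrap N a b : (a < p ^ N)%N -> (b < p ^ N)%N -> (p ^ N <= a + b)%N ->
  'C(a + b, a)%:R = 0 :> k.
Proof.
move=> aq bq qab; have := ibin_per hp (a + b - p ^ N)%N%:Z aq.
rewrite -PoszD subnK // !ibin_nat => h.
rewrite -[LHS]/((Posz 'C(a + b, a))%:~R) h bin_small //.
by rewrite ltn_subLR // addnC ltn_add2r.
Qed.

Lemma bin_mulp a b : 'C(a * p, b * p)%:R = 'C(a, b)%:R :> k.
Proof.
have p0 := prime_gt0 p_pr.
have := ibin_lucas hp a%:Z b p0 p0; rewrite bin0 mulr1 addn0 addr0 -PoszM.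
by rewrite !ibin_nat.
Qed.

Lemma bin_low j i : (i < p)%N -> 'C(j * p + i, i)%:R = 1 :> k.
Proof.
move=> ip; have := ibin_lucas hp j%:Z 0 ip ip; rewrite mul0n ibin0 mul1r binn.
by rewrite -PoszM -PoszD ibin_nat.
Qed.

Lemma bin_digit i e m : (m < p ^ i)%N ->
  'C(e * p ^ i + m, p ^ i)%:R = e%:R :> k.
Proof.
move=> mi; elim: e => [|e IHe]; first by rewrite mul0n add0n bin_small.
have := ibinDp hp i (e * p ^ i + m)%N%:Z (p ^ i).
rewrite leqnn subnn ibin0 -PoszD addnAC -mulSnr !ibin_nat => h.
by rewrite -[LHS]/((Posz 'C(e.+1 * p ^ i + m, p ^ i))%:~R) h -natr1 -IHe.
Qed.

(** The binomial is the top base-p digit of m, which lies between 1 and p - 1. *)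
Lemma bin_lead_neq0 i m : (p ^ i <= m)%N -> (m < p ^ i.+1)%N ->
  'C(m, p ^ i)%:R != 0 :> k.
Proof.
move=> im mi; have q0 : (0 < p ^ i)%N by rewrite expn_gt0 prime_gt0.
rewrite (divn_eq m (p ^ i)) bin_digit ?ltn_mod //.
rewrite -(dvdn_pcharf hp) gtnNdvd //; first by rewrite divn_gt0.
by rewrite ltn_divLR // -expnS.
Qed.

Lemma bin_pred_neq0 N m : (m < p ^ N)%N -> 'C((p ^ N).-1, m)%:R != 0 :> k.
Proof.
have q0 : (0 < p ^ N)%N by rewrite expn_gt0 prime_gt0.
suff h : (m < p ^ N)%N -> 'C((p ^ N).-1, m)%:R = (-1) ^+ m :> k.
  by move=> /h ->; rewrite signr_eq0.
elim: m => [|m IHm] mN; first by rewrite bin0.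
have := bin_expp hp N m.+1; rewrite -[X in 'C(X, _)%N](prednK q0) binS natrD.
rewrite (ltn_eqF mN) addr0 IHm ?(ltnW mN) // => /eqP.
by rewrite addr_eq0 => /eqP ->; rewrite exprS mulN1r.
Qed.

(** Its image under [th] is the idempotent projecting to the weights congruent to a; for N = 1 this
    is mu_a ([mu_th]). *)
Definition dlt N (a x : int) : k := ((x == a %[mod (p ^ N)%:Z])%Z)%:R.

Lemma dlt_per N a : per p N (dlt N a).
Proof. by move=> x; rewrite /dlt addrC -{1}[(p ^ N)%:Z]mul1r modzMDl. Qed.

Lemma dltM N (phi : int -> k) a x : per p N phi ->
  phi x * dlt N a x = phi a * dlt N a x.
Proof.
move=> pphi; rewrite /dlt; case: eqP => xa; last by rewrite !mulr0.
by rewrite (per_mod pphi) xa -(per_mod pphi).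
Qed.

Lemma dlt_sum N (c x : int) :
  \sum_(b < p ^ N) dlt N (b%:Z + c) x = 1 :> k.
Proof.
have [i iq xi] := modz_exp hp N (x - c).
rewrite (bigD1 (Ordinal iq)) //= big1 ?addr0 => [|b bi].
  by rewrite /dlt -xi modzDml subrK eqxx.
rewrite /dlt; case: eqP => // xb; case/negP: bi; rewrite -val_eqE /=.
rewrite -eqz_nat -xi -(modzDml x) xb modzDml addrK.
by rewrite modz_small // lez_nat ltz_nat /= ltn_ord.
Qed.

Lemma dltC N a x : dlt N a x = dlt N x a.
Proof. by rewrite /dlt eq_sym. Qed.

Lemma dlt_shift N a x c : dlt N a (x + c) = dlt N (a - c) x.
Proof.
by rewrite /dlt !eqz_mod_dvd opprB addrA.
Qed.

Lemma perM N (phi psi : int -> k) : per p N phi -> per p N psi ->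
  per p N (fun x => phi x * psi x).
Proof. by move=> a b x; rewrite a b. Qed.

Lemma per_shift N (phi : int -> k) c : per p N phi ->
  per p N (fun x => phi (x + c)).
Proof. by move=> a x; rewrite addrAC a. Qed.

Lemma per_ibin N c l : (l < p ^ N)%N ->
  per p N (fun x => (ibin (x + c) l)%:~R : k).
Proof. by move=> lN x; rewrite addrAC ibin_per. Qed.

Lemma per_fdiv N (phi : int -> k) : per p N phi ->
  per p N.+1 (fun x => phi (x %/ p%:Z)%Z).
Proof.
move=> a x; rewrite expnSr PoszM addrC divzMDl 1?addrC ?a //.
by rewrite eqz_nat -lt0n prime_gt0.
Qed.

End Binomials.

(** * Cartan elements as periodic functions, and the Frobenius form *)

Section HypAlgebra.
Variables (k : fieldType) (p : nat).
Hypothesis hp : p \in [pchar k].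
Let p_pr : prime p := pcharf_prime hp.
Variables (A : algType k) (d : hyp_data A).

Local Notation X := (hX d).
Local Notation Y := (hY d).
Local Notation hb := (hb d).
Local Notation per := (per p).

Lemma hb0 : hb 0 0 = 1.
Proof.
have := hXY d 0 0; rewrite big_ord1 /= !(hX0, hY0) !mul1r mulr1.
by rewrite subrr.
Qed.

(* The element of the Cartan part that acts on weights by the function phi,  *)
(* read off its Newton expansion at 0, ..., p^N - 1.                         *)
Definition th N (phi : int -> k) : A :=
  locked (\sum_(l < p ^ N) newton (phi \o Posz) l *: hb 0 l).

Lemma thE N phi :
  th N phi = \sum_(l < p ^ N) newton (phi \o Posz) l *: hb 0 l.
Proof. by rewrite /th -lock. Qed.

Lemma eq_th N phi psi : (forall i, (i < p ^ N)%N -> phi i%:Z = psi i%:Z) ->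
  th N phi = th N psi.
Proof.
move=> e; rewrite !thE; apply: eq_bigr => l _; congr (_ *: _).
by apply: eq_newton => i il; apply/e/(leq_ltn_trans il).
Qed.

Lemma th_lc N a phi psi :
  th N (fun x => a * phi x + psi x) = a *: th N phi + th N psi.
Proof.
rewrite !thE scaler_sumr -big_split; apply: eq_bigr => l _ /=.
rewrite scalerA -scalerDl; congr (_ *: _).
have aux (f g : nat -> k) m :
    newton (fun i => a * f i + g i) m = a * newton f m + newton g m.
  elim: m f g => [|m IHm] f g //; rewrite !newtonS -IHm.
  by congr (newton _ m); apply/funext => i; rewrite /fdiff; ring.
exact: aux.
Qed.

Lemma th0 N : th N (fun=> 0) = 0.
Proof.
have := th_lc N (-1) (fun=> 0) (fun=> 0).
by rewrite scaleN1r addNr => <-; apply: eq_th => i _; rewrite mulr0 addr0.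
Qed.

Lemma thD N phi psi : th N (fun x => phi x + psi x) = th N phi + th N psi.
Proof.
rewrite -[th N phi]scale1r -th_lc.
by apply: eq_th => i _; rewrite mul1r.
Qed.

Lemma thZ N a phi : th N (fun x => a * phi x) = a *: th N phi.
Proof.
rewrite -[RHS]addr0 -(th0 N) -th_lc.
by apply: eq_th => i _; rewrite addr0.
Qed.

Lemma th_sum N (I : Type) (s : seq I) (F : I -> int -> k) :
  th N (fun x => \sum_(i <- s) F i x) = \sum_(i <- s) th N (F i).
Proof.
elim: s => [|i s IHs].
  by rewrite big_nil -(th0 N); apply: eq_th => j _; rewrite big_nil.
by rewrite big_cons -IHs -thD; apply: eq_th => j _; rewrite big_cons.
Qed.

Lemma hb_th N c l : (l < p ^ N)%N ->
  hb c l = th N (fun x => (ibin (x + c) l)%:~R).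
Proof.
move=> lN; rewrite (hbE d c lN) thE; apply: eq_bigr => i _; congr (_ *: _).
by rewrite -(newton_morph (intr : {additive int -> k})).
Qed.

Lemma th_one N : th N (fun=> 1) = 1.
Proof.
rewrite -hb0 (hb_th (N := N)) ?expn_gt0 ?prime_gt0 //.
by apply: eq_th => i _; rewrite ibin0.
Qed.

(** The product expands into binomials of index up to l + m, but the product function is
    p^N-periodic, so its Newton coefficients from p^N on vanish in k. *)
Lemma hbM_th N l m : (l < p ^ N)%N -> (m < p ^ N)%N ->
  hb 0 l * hb 0 m = th N (fun x => (ibin x l)%:~R * (ibin x m)%:~R).
Proof.
move=> lN mN; have lmN : (l + m < p ^ N + p ^ N)%N.
  by rewrite -addnS leq_add // ltnW.
rewrite (hbM d lmN) thE big_split_ord /= [X in _ + X]big1 ?addr0 => [|i _].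
  apply: eq_bigr => i _; congr (_ *: _).
  rewrite -(newton_morph (intr : {additive int -> k})); congr (newton _ i).
  by apply/funext => j; rewrite /= intrM.
rewrite -(newton_morph (intr : {additive int -> k})).
have pe : per N (fun x => (ibin x l)%:~R * (ibin x m)%:~R : k).
  by move=> x; rewrite !ibin_per.
have := newton_per0 hp pe (leq_addr i (p ^ N)).
rewrite (_ : _ \o _ = (fun j : nat => (ibin j l * ibin j m)%:~R)).
  by move=> ->; rewrite scale0r.
by apply/funext => j; rewrite /= intrM.
Qed.

(** Bilinearity reduces this to binomials, that is, to [hbM_th]; [th N] sees only the values at 0,
    ..., p^N - 1, where Newton's formula is exact. *)
Lemma thM N phi psi : th N phi * th N psi = th N (fun x => phi x * psi x).
Proof.
pose f l := newton (phi \o Posz) l; pose g l := newton (psi \o Posz) l.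
transitivity (\sum_(l < p ^ N) \sum_(m < p ^ N) (f l * g m) *:
    th N (fun x => (ibin x l)%:~R * (ibin x m)%:~R)).
  rewrite 2!thE mulr_suml; apply: eq_bigr => l _; rewrite mulr_sumr.
  apply: eq_bigr => m _; rewrite -scalerAl -scalerAr scalerA.
  by rewrite (hbM_th (N := N)).
transitivity (\sum_(l < p ^ N) \sum_(m < p ^ N)
    th N (fun x => (f l * g m) * ((ibin x l)%:~R * (ibin x m)%:~R))).
  by apply: eq_bigr => l _; apply: eq_bigr => m _; rewrite thZ.
under eq_bigr => l _ do rewrite -th_sum.
rewrite -th_sum; apply: eq_th => i iq.
rewrite -[phi i]/((phi \o Posz) i) -[psi i]/((psi \o Posz) i).
rewrite (newton_sum (phi \o Posz) iq) (newton_sum (psi \o Posz) iq) mulr_suml.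
apply: eq_bigr => l _; rewrite mulr_sumr; apply: eq_bigr => m _.
rewrite !ibin_nat -[newton (phi \o Posz) l *+ _]mulr_natr.
by rewrite -[newton (psi \o Posz) m *+ _]mulr_natr mulrACA.
Qed.

Lemma thC N M phi psi : th N phi * th M psi = th M psi * th N phi.
Proof.
rewrite !thE mulr_suml mulr_sumr; apply: eq_bigr => l _.
rewrite mulr_suml mulr_sumr; apply: eq_bigr => m _.
rewrite -!scalerAl -!scalerAr !scalerA mulrC; congr (_ *: _).
have lm : (l + m < (l + m).+1)%N by [].
rewrite (hbM d lm) (@hbM _ _ d m l (l + m).+1) ?(addnC m) //.
apply: eq_bigr => i _; congr (_%:~R *: _); congr (newton _ i).
by apply/funext => j; rewrite mulrC.
Qed.

Lemma th_up N M phi : per N phi -> (N <= M)%N -> th M phi = th N phi.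
Proof.
move=> pphi NM; have qq : (p ^ N <= p ^ M)%N by rewrite leq_exp2l ?prime_gt1.
rewrite !thE -(subnKC qq) big_split_ord /= [X in _ + X]big1 ?addr0 // => i _.
by rewrite (newton_per0 hp pphi) ?leq_addr // scale0r.
Qed.

Lemma th_X N phi n : per N phi ->
  th N phi * X n = X n * th N (fun x => phi (x + (2 * n)%:Z)).
Proof.
move=> pphi; transitivity (X n * \sum_(l < p ^ N)
    th N (fun x => newton (phi \o Posz) l * (ibin (x + (2 * n)%:Z) l)%:~R)).
  rewrite !thE mulr_suml mulr_sumr; apply: eq_bigr => l _.
  rewrite -scalerAl hbX add0r (hb_th _ (ltn_ord l)) scalerAr -thZ.
  by [].
rewrite -th_sum; congr (_ * _); apply: eq_th => i _.
by rewrite [RHS](newton_per hp pphi).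
Qed.

Lemma th_Y N phi n : per N phi ->
  th N phi * Y n = Y n * th N (fun x => phi (x - (2 * n)%:Z)).
Proof.
move=> pphi; transitivity (Y n * \sum_(l < p ^ N)
    th N (fun x => newton (phi \o Posz) l * (ibin (x - (2 * n)%:Z) l)%:~R)).
  rewrite !thE mulr_suml mulr_sumr; apply: eq_bigr => l _.
  rewrite -scalerAl hbY add0r (hb_th _ (ltn_ord l)) scalerAr -thZ.
  by [].
rewrite -th_sum; congr (_ * _); apply: eq_th => i _.
by rewrite [RHS](newton_per hp pphi).
Qed.

Lemma X_th N phi n : per N phi ->
  X n * th N phi = th N (fun x => phi (x - (2 * n)%:Z)) * X n.
Proof.
move=> pphi; rewrite th_X; last exact: per_shift.
by congr (_ * _); apply: eq_th => i _; rewrite addrK.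
Qed.

Lemma Y_th N phi n : per N phi ->
  Y n * th N phi = th N (fun x => phi (x + (2 * n)%:Z)) * Y n.
Proof.
move=> pphi; rewrite th_Y; last exact: per_shift.
by congr (_ * _); apply: eq_th => i _; rewrite subrK.
Qed.

Lemma th_mod N phi : exists2 psi, per N psi & th N phi = th N psi.
Proof.
exists (fun x => phi (x %% (p ^ N)%:Z)%Z).
  by move=> x; rewrite addrC -{1}[(p ^ N)%:Z]mul1r modzMDl.
by apply: eq_th => i iq; rewrite modz_small // lez_nat ltz_nat.
Qed.

Lemma X_wrap N a b : (a < p ^ N)%N -> (b < p ^ N)%N -> (p ^ N <= a + b)%N ->
  X a * X b = 0.
Proof. by move=> aq bq abq; rewrite hXM (bin_wrap hp aq bq abq) scale0r. Qed.

Lemma Y_wrap N a b : (a < p ^ N)%N -> (b < p ^ N)%N -> (p ^ N <= a + b)%N ->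
  Y a * Y b = 0.
Proof. by move=> aq bq abq; rewrite hYM (bin_wrap hp aq bq abq) scale0r. Qed.

(** Straighten X^(m) Y^(n) and gather the Cartan factors in the middle; m < p^N keeps the new
    binomials periodic. *)
Lemma mon_mul N m n phi psi : per N phi -> per N psi -> (m < p ^ N)%N ->
  (Y m * th N phi * X m) * (Y n * th N psi * X n) =
  \sum_(j < m.+1) (if (j <= n)%N then Y m * Y (n - j) *
    th N (fun x => phi (x - (2 * (n - j))%:Z) *
      (ibin (x + ((2 * j)%:Z - (m + n)%:Z)) j)%:~R *
      psi (x - (2 * (m - j))%:Z)) * (X (m - j) * X n) else 0).
Proof.
move=> pphi ppsi mq; rewrite -!mulrA [X m * (Y n * _)]mulrA hXY.
rewrite mulr_suml !mulr_sumr. apply: eq_bigr => -[j /= jm] _.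
case: ifP => _; last by rewrite !(mul0r, mulr0).
rewrite -!mulrA [X (m - j) * (th N psi * _)]mulrA X_th // -!mulrA.
rewrite [th N phi * (Y _ * _)]mulrA th_Y // -!mulrA.
rewrite (hb_th (N := N)); last exact: leq_ltn_trans mq.
by rewrite -!thM !mulrA.
Qed.

(** The normal form of the elements of A_r; see [A_subE]. *)
Definition Dform r (u : A) : Prop := exists phi : nat -> int -> k,
  (forall m, per r (phi m)) /\
  u = \sum_(m < p ^ r) Y m * th r (phi m) * X m.

Lemma Dform_lc r a u v : Dform r u -> Dform r v -> Dform r (a *: u + v).
Proof.
move=> [phi [pphi ->]] [psi [ppsi ->]].
exists (fun m x => a * phi m x + psi m x); split.
  by move=> m x; rewrite pphi ppsi.
rewrite scaler_sumr -big_split; apply: eq_bigr => m _.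
by rewrite th_lc mulrDr mulrDl -scalerAr -scalerAl.
Qed.

Lemma Dform0 r : Dform r 0.
Proof.
exists (fun _ _ => 0); split=> //; rewrite big1 // => m _.
by rewrite th0 mulr0 mul0r.
Qed.

Lemma Dform_mon r m phi : (m < p ^ r)%N -> Dform r (Y m * th r phi * X m).
Proof.
move=> mq; have [psi ppsi ->] := th_mod r phi.
exists (fun n x => if n == m then psi x else 0); split.
  by move=> n x; case: eqP.
rewrite (bigD1 (Ordinal mq)) //= eqxx big1 ?addr0 // => n.
by rewrite -val_eqE /= => /negPf ->; rewrite th0 mulr0 mul0r.
Qed.

Lemma Dform_sum r (I : Type) (s : seq I) (P : pred I) (F : I -> A) :
  (forall i, P i -> Dform r (F i)) -> Dform r (\sum_(i <- s | P i) F i).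
Proof.
move=> FD; elim/big_ind: _ => //; first exact: Dform0.
by move=> u v uD vD; rewrite -[u]scale1r; apply: Dform_lc.
Qed.

(** [lam] adds, over the weights b modulo p^r, the coefficient of Y^(q-1) X^(q-1) on v_b, with q =
    p^r. If it vanishes on all multiples of u, the functions [phi m] vanish by descending induction
    on m. *)
Lemma Dform_frobenius r : exists lam : A -> k,
  [/\ {morph lam : x y / x + y}, forall c x, lam (c *: x) = c * lam x &
   forall u, Dform r u ->
    (forall v, Dform r v -> lam (u * v) = 0) -> u = 0].
Proof.
have q0 : (0 < p ^ r)%N by rewrite expn_gt0 prime_gt0.
pose q1 := (p ^ r).-1; have q1E : q1.+1 = (p ^ r)%N by rewrite prednK.
have [L HL] := choice (fun b : int => hcoef d b q1 q1).
pose lam x : k := \sum_(b < p ^ r) L b%:Z x.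
have lamD : {morph lam : x y / x + y}.
  move=> x y; rewrite /lam -big_split; apply: eq_bigr => b _.
  by case: (HL b%:Z) => LD _ _; rewrite LD.
have lamZ c x : lam (c *: x) = c * lam x.
  rewrite /lam mulr_sumr; apply: eq_bigr => b _.
  by case: (HL b%:Z) => _ LZ _; rewrite LZ.
have lam0 : lam 0 = 0 by rewrite -(scale0r 0) lamZ mul0r.
have lam_sum (I : Type) (s : seq I) (F : I -> A) :
    lam (\sum_(i <- s) F i) = \sum_(i <- s) lam (F i).
  by elim: s => [|i s IHs]; rewrite ?big_nil // !big_cons lamD IHs.
have lam_mon m n phi : per r phi -> lam (Y m * th r phi * X n) =
    \sum_(b < p ^ r) phi (b%:Z + (2 * n)%:Z) * ((q1, q1) == (m, n))%:R.
  move=> pphi; rewrite !thE mulr_sumr mulr_suml lam_sum.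
  rewrite /lam exchange_big; apply: eq_bigr => b _ /=.
  case: (HL b%:Z) => _ LZ Lmon; rewrite (newton_per hp pphi) mulr_suml.
  apply: eq_bigr => l _; rewrite -scalerAr -scalerAl LZ Lmon addr0.
  by rewrite mulrA.
exists lam; split=> // u [phi [pphi uE]] uv0.
suff phi0 n : (n <= p ^ r)%N -> forall m, (p ^ r - n <= m < p ^ r)%N ->
    forall x, phi m x = 0.
  rewrite uE big1 // => m _; rewrite (_ : phi m = fun=> 0).
    by rewrite th0 mulr0 mul0r.
  by apply/funext => x; apply: (phi0 (p ^ r)%N); rewrite // subnn ltn_ord.
elim: n => [|n IHn] nq m; first by rewrite subn0 ltnNge => /andP [->].
move=> /andP [nm mq]; have [nm'|mn] := leqP (p ^ r - n) m.
  by apply: IHn; [exact: ltnW | rewrite nm' mq].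
have big0 m' : (m < m' < p ^ r)%N -> forall x, phi m' x = 0.
  move=> /andP [mm' m'q]; apply: IHn; first exact: ltnW.
  by rewrite m'q andbT; lia.
move=> a.
(* The complementary order: only the term j = 0 of the m-th summand then reaches order q - 1. *)
pose n' := (q1 - m)%N; have n'q : (n' < p ^ r)%N.
  by rewrite /n' -q1E ltnS leq_subr.
have mq1 : (m <= q1)%N by rewrite -ltnS q1E.
(* The shift makes the arguments of [phi m] and of the indicator agree after straightening, so the
   sum over the weights leaves [phi m a]. *)
pose psi x := dlt k p r a (x + ((2 * m)%:Z - (2 * n')%:Z)).
have ppsi : per r psi by apply/per_shift/dlt_per.
have := uv0 _ (Dform_mon psi n'q); rewrite uE mulr_suml lam_sum.
rewrite (bigD1 (Ordinal mq)) //= [X in _ + X]big1 ?addr0; last first.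
  move=> [m' /= m'q]; rewrite -val_eqE /= => m'm.
  have [mm'|m'm'] := ltnP m m'.
    rewrite (_ : phi m' = fun=> 0).
      by rewrite th0 mulr0 !mul0r.
    by apply/funext => x; apply: big0; rewrite mm'.
  have {m'm m'm'} m'm : (m' < m)%N by rewrite ltn_neqAle m'm.
  rewrite mon_mul // lam_sum big1 // => -[j /= jm] _.
  case: ifP => // jn; rewrite hYM hXM -!scalerAl -!scalerAr !lamZ lam_mon.
    rewrite big1 ?mulr0 // => b _; rewrite (_ : _ == _ = false) ?mulr0 //.
    apply/negP => /eqP [] e _; move: m'm.
    have := subnK mq1; rewrite -/n' e => h.
    suff : (m <= m')%N by rewrite leqNgt => /negP.
    by lia.
  apply: perM; last exact: per_shift.
  by apply: perM; [exact: per_shift | apply: per_ibin => //; lia].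
rewrite mon_mul // lam_sum big_ord_recl /= [X in _ + X]big1 ?addr0; last first.
  move=> [j /= jm] _; case: ifP => // jn.
  rewrite hYM hXM -!scalerAl -!scalerAr !lamZ lam_mon.
    rewrite big1 ?mulr0 // => b _; rewrite (_ : _ == _ = false) ?mulr0 //.
    apply/negP => /eqP [] e _; move: jn jm e; rewrite /bump /= /n'.
    by lia.
  apply: perM; last exact: per_shift.
  apply: perM; [exact: per_shift | apply: per_ibin => //].
  by rewrite /bump /=; lia.
rewrite !subn0 hYM hXM -!scalerAl -!scalerAr !lamZ.
have mn' : (m + n')%N = q1 by rewrite subnKC.
rewrite mn' lam_mon; last first.
  apply: perM; last exact: per_shift.
  by apply: perM; [exact: per_shift | apply: per_ibin].
rewrite eqxx.
under eq_bigr => b _ do rewrite ibin0 !mulr1.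
set s := \sum_(b < _) _; suff -> : s = phi m a.
  move/eqP; rewrite !mulf_eq0 !(negPf (bin_pred_neq0 hp _)) //=.
  by move/eqP.
transitivity (\sum_(b < p ^ r) phi m a *
    dlt k p r (b%:Z + ((2 * q1)%:Z - (2 * n')%:Z)) a).
  apply: eq_bigr => b _; rewrite dltC /psi.
  rewrite (_ : b%:Z + (2 * q1)%:Z - (2 * m)%:Z + ((2 * m)%:Z - (2 * n')%:Z) =
     b%:Z + (2 * q1)%:Z - (2 * n')%:Z); last by ring.
  by rewrite dltM // addrA.
by rewrite -mulr_sumr dlt_sum ?mulr1.
Qed.

End HypAlgebra.

(** * Generators of A and of U_r *)

Section Generators.
Variables (k : fieldType) (p : nat).
Hypothesis hp : p \in [pchar k].
Let p_pr : prime p := pcharf_prime hp.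
Variables (A : algType k) (d : hyp_data A).

Local Notation X := (hX d).
Local Notation Y := (hY d).
Local Notation hb := (hb d).
Local Notation per := (per p).
Local Notation th := (th p d).
Local Notation Dform := (Dform p d).

Lemma th_YX_comm N phi m : per N phi ->
  th N phi * (Y m * X m) = Y m * X m * th N phi.
Proof.
move=> pphi; rewrite mulrA (th_Y hp) // -!mulrA (X_th hp) // .
Qed.

Lemma mon_YX N phi m : per N phi ->
  Y m * th N phi * X m = th N (fun x => phi (x + (2 * m)%:Z)) * (Y m * X m).
Proof. by move=> pphi; rewrite (Y_th hp) // mulrA. Qed.

(** Both monomials are Cartan elements times Y^(m) X^(m); the latter have weight zero and commute
    among themselves. *)
Lemma mon_comm N M phi psi m n : per N phi -> per M psi ->
  GRing.comm (Y m * th N phi * X m) (Y n * th M psi * X n).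
Proof.
move=> pphi ppsi; rewrite !mon_YX // /GRing.comm.
have p1 := per_shift (2 * m)%:Z pphi.
have p2 := per_shift (2 * n)%:Z ppsi.
apply: commrM; apply/commr_sym; apply: commrM; rewrite /GRing.comm.
- exact: thC.
- by rewrite th_YX_comm.
- by rewrite th_YX_comm.
- exact: hYX_comm.
Qed.

Lemma Dform_comm r s u v : Dform r u -> Dform s v -> u * v = v * u.
Proof.
move=> [phi [pphi ->]] [psi [ppsi ->]].
apply: commr_sum => m _; apply/commr_sym; apply: commr_sum => n _.
exact: mon_comm.
Qed.

Lemma th_Dform_comm N r phi u : per N phi -> Dform r u ->
  th N phi * u = u * th N phi.
Proof.
move=> pphi [psi [ppsi ->]].
have -> : th N phi = Y 0 * th N phi * X 0 by rewrite hX0 hY0 mul1r mulr1.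
by apply: commr_sum => m _; apply: mon_comm.
Qed.

Definition is_subalg (S : A -> Prop) : Prop :=
  [/\ S 1, forall a u v, S u -> S v -> S (a *: u + v)
    & forall u v, S u -> S v -> S (u * v)].

Section Subalg.
Variable S : A -> Prop.
Hypothesis Salg : is_subalg S.

Let S1 : S 1. Proof. by case: Salg. Qed.
Let Slc a u v : S u -> S v -> S (a *: u + v).
Proof. by case: Salg => _ h _; apply: h. Qed.
Let SM u v : S u -> S v -> S (u * v). Proof. by case: Salg => _ _; apply. Qed.
Let S0 : S 0. Proof. by rewrite -(addNr 1) -scaleN1r; apply: Slc. Qed.
Let SZ a u : S u -> S (a *: u).
Proof. by move=> Su; rewrite -[_ *: _]addr0; apply: Slc. Qed.
Let SD u v : S u -> S v -> S (u + v).
Proof. by move=> Su Sv; rewrite -[u]scale1r; apply: Slc. Qed.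
Let SB u v : S u -> S v -> S (u - v).
Proof. by move=> Su Sv; rewrite -scaleN1r addrC; apply: Slc. Qed.
Let Ssum (I : finType) (F : I -> A) : (forall i, S (F i)) -> S (\sum_i F i).
Proof. by move=> SF; elim/big_ind: _ => //; exact: SD. Qed.

Let scale_back (c : k) (u v : A) : c != 0 -> c *: u = v -> S v -> S u.
Proof. by move=> c0 <- Sv; rewrite -[u](scalerK c0); apply: SZ. Qed.

Lemma hb_subalg n c : (forall l, (l <= n)%N -> S (hb 0 l)) -> S (hb c n).
Proof.
move=> Sl; rewrite (hbE d c (ltnSn n)); apply: Ssum => i.
by apply/SZ/Sl; rewrite -ltnS ltn_ord.
Qed.

Lemma th_subalg N phi : (forall l, (l < p ^ N)%N -> S (hb 0 l)) ->
  S (th N phi).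
Proof. by move=> Sl; rewrite thE; apply: Ssum => i; apply/SZ/Sl. Qed.

(* The last step uses that the top base-p digit of m is a unit. *)
Lemma top_digit_ind (Q : nat -> Prop) M : Q 0 ->
  (forall m i, (m < M)%N -> (p ^ i <= m)%N -> (m < p ^ i.+1)%N ->
    (forall n, (n < m)%N -> Q n) -> Q m) ->
  forall m, (m < M)%N -> Q m.
Proof.
move=> Q0 step; elim/ltn_ind => -[|m] IHm mM //.
apply: (step _ (trunc_log p m.+1)) => //.
- by rewrite trunc_logP ?prime_gt1.
- by rewrite trunc_log_ltn ?prime_gt1.
by move=> n nm; apply: IHm => //; apply: ltn_trans mM.
Qed.

(** With p^i the top power of p below n, the product of the binomials of index n - p^i and p^i has
    leading term C(n, p^i) times the binomial of index n, by [newton_ibinM_top]. *)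
Lemma hb_gen : (forall i, S (hb 0 (p ^ i))) -> forall n, S (hb 0 n).
Proof.
move=> Sp n; apply: (@top_digit_ind (fun n => S (hb 0 n)) n.+1) => //.
  by rewrite hb0.
move=> {}n i _ ni ni1 IHn; have q0 : (0 < p ^ i)%N by rewrite expn_gt0 prime_gt0.
have nE : (n - p ^ i + p ^ i)%N = n by rewrite subnK.
have := hbM d (leqnn (n - p ^ i + p ^ i).+1).
rewrite big_ord_recr /= newton_ibinM_top nE.
rewrite (bin_sub ni).
set s := \sum_(_ < n) _ => h.
apply: (scale_back (bin_lead_neq0 hp ni ni1)) (erefl _) _.
rewrite -[_ *: _](addKr s); rewrite addrC.
have -> : s + 'C(n, p ^ i)%:R *: hb 0 n = hb 0 (n - p ^ i) * hb 0 (p ^ i).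
  by rewrite h.
apply: SB; last by apply: Ssum => j; apply/SZ/IHn.
apply: SM => //; apply: IHn.
by rewrite ltn_subrL q0 (leq_trans q0).
Qed.

Lemma X_gen r : (forall i, (i < r)%N -> S (X (p ^ i))) ->
  forall m, (m < p ^ r)%N -> S (X m).
Proof.
move=> Sp; apply: top_digit_ind; first by rewrite hX0.
move=> m i mr mi mi1 IHm.
have q0 : (0 < p ^ i)%N by rewrite expn_gt0 prime_gt0.
have ir : (i < r)%N by rewrite -(ltn_exp2l _ _ (prime_gt1 p_pr)) (leq_ltn_trans mi).
apply: (scale_back (bin_lead_neq0 hp mi mi1)) (_ : _ = X (p ^ i) * X (m - p ^ i)) _.
  by rewrite hXM subnKC.
apply: SM; first exact: Sp.
by apply: IHm; rewrite ltn_subrL q0 (leq_trans q0).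
Qed.

Lemma Y_gen r : (forall i, (i < r)%N -> S (Y (p ^ i))) ->
  forall m, (m < p ^ r)%N -> S (Y m).
Proof.
move=> Sp; apply: top_digit_ind; first by rewrite hY0.
move=> m i mr mi mi1 IHm.
have q0 : (0 < p ^ i)%N by rewrite expn_gt0 prime_gt0.
have ir : (i < r)%N by rewrite -(ltn_exp2l _ _ (prime_gt1 p_pr)) (leq_ltn_trans mi).
apply: (scale_back (bin_lead_neq0 hp mi mi1)) (_ : _ = Y (p ^ i) * Y (m - p ^ i)) _.
  by rewrite hYM subnKC.
apply: SM; first exact: Sp.
by apply: IHm; rewrite ltn_subrL q0 (leq_trans q0).
Qed.

Lemma hb_XY_gen q : (forall m, (m < q)%N -> S (X m)) ->
  (forall m, (m < q)%N -> S (Y m)) -> forall n, (n < q)%N -> S (hb 0 n).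
Proof.
move=> SX SY; elim/ltn_ind => n IHn nq.
have := hXY d n n; rewrite big_ord_recr /= leqnn !subnn hX0 hY0 mul1r mulr1.
rewrite (_ : _ - _ = 0); last by lia.
set s := \sum_(_ < n) _ => h; rewrite -[hb 0 n](addKr s) -h addrC.
apply: SB; first by apply: SM; [apply: SX | apply: SY].
apply: Ssum => -[j /= jn]; rewrite (ltnW jn).
have nj : (n - j < q)%N by apply: leq_ltn_trans nq; rewrite leq_subr.
apply: SM; last exact: SX; apply: SM; first exact: SY.
by apply: hb_subalg => l lj; apply: IHn; [exact: leq_ltn_trans jn | lia].
Qed.

Lemma Dform_U r : (forall i, (i < r)%N -> S (X (p ^ i))) ->
  (forall i, (i < r)%N -> S (Y (p ^ i))) -> forall u, Dform r u -> S u.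
Proof.
move=> SX SY u [phi [_ ->]]; apply: Ssum => m.
apply: SM; last exact: (X_gen SX); apply: SM; first exact: (Y_gen SY).
by apply: th_subalg; apply: hb_XY_gen; [exact: X_gen | exact: Y_gen].
Qed.

(** The same triangularity: the term j = 0 of the product of the elements of orders m - p^i and p^i
    is C(m, p^i)^2 Y^(m) X^(m), and the other terms are Cartan multiples of elements of order m -
    j. *)
Lemma YX_gen : (forall n, S (hb 0 n)) -> (forall i, S (Y (p ^ i) * X (p ^ i))) ->
  forall m, S (Y m * X m).
Proof.
move=> Sb Sp m; apply: (@top_digit_ind (fun m => S (Y m * X m)) m.+1) => //.
  by rewrite hX0 hY0 mul1r.
move=> {}m i _ mi mi1 IHm.
have q0 : (0 < p ^ i)%N by rewrite expn_gt0 prime_gt0.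
have mE : (m - p ^ i + p ^ i)%N = m by rewrite subnK.
have m'm : (m - p ^ i < m)%N by rewrite ltn_subrL q0 (leq_trans q0).
have p1 : per i.+1 (fun=> 1 : k) by [].
have := mon_mul hp d (p ^ i) p1 p1 (ltn_trans m'm mi1).
rewrite (th_one hp) !mulr1 big_ord_recl /= !subn0.
set s := \sum_(_ < _) _.
rewrite (_ : th _ _ = 1); last first.
  by rewrite -(th_one hp d i.+1); apply: eq_th => x _; rewrite ibin0 !mulr1.
rewrite mulr1 hYM hXM mE (bin_sub mi) => h.
have c0 := bin_lead_neq0 hp mi mi1.
apply: (scale_back (mulf_neq0 c0 c0)) (erefl _) _.
have -> : 'C(m, p ^ i)%:R * 'C(m, p ^ i)%:R *: (Y m * X m) =
    Y (m - p ^ i) * X (m - p ^ i) * (Y (p ^ i) * X (p ^ i)) - s.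
  by rewrite h addrK -scalerAl -scalerAr scalerA.
apply: SB; first by apply: SM => //; apply: IHm.
apply: Ssum => -[j /= jm]; case: ifP => // ji; rewrite hYM hXM.
rewrite -!scalerAl -!scalerAr; do 2!apply: SZ.
have e : (m - p ^ i + (p ^ i - bump 0 j) = m - p ^ i - bump 0 j + p ^ i)%N.
  by move: ji jm; rewrite /bump /=; lia.
rewrite e mon_YX; last first.
  apply: perM => //; apply: perM => //; apply: (per_ibin hp).
  by move: jm; rewrite /bump /=; lia.
apply: SM; first exact: th_subalg.
by apply: IHm; move: jm ji; rewrite /bump /=; lia.
Qed.

Lemma Dform_A r : (forall i, S (hb 0 (p ^ i))) ->
  (forall i, S (Y (p ^ i) * X (p ^ i))) -> forall u, Dform r u -> S u.
Proof.
move=> Sb SYX u [phi [pphi ->]]; apply: Ssum => m; rewrite mon_YX //.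
apply: SM; first by apply: th_subalg => l _; apply: hb_gen.
by apply: YX_gen => // n; apply: hb_gen.
Qed.

End Subalg.

(** The PBW form of U_r. It contains 1 and is stable under the generators of U_r, hence contains
    U_r. *)
Definition Uform r (u : A) : Prop := exists phi : nat -> nat -> int -> k,
  (forall m n, per r (phi m n)) /\
  u = \sum_(m < p ^ r) \sum_(n < p ^ r) Y m * th r (phi m n) * X n.

Lemma Uform_lc r a u v : Uform r u -> Uform r v -> Uform r (a *: u + v).
Proof.
move=> [phi [pphi ->]] [psi [ppsi ->]].
exists (fun m n x => a * phi m n x + psi m n x); split.
  by move=> m n x; rewrite pphi ppsi.
rewrite scaler_sumr -big_split; apply: eq_bigr => m _ /=.
rewrite scaler_sumr -big_split; apply: eq_bigr => n _ /=.
by rewrite th_lc mulrDr mulrDl -scalerAr -scalerAl.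
Qed.

Lemma Uform0 r : Uform r 0.
Proof.
exists (fun _ _ _ => 0); split=> //; rewrite big1 // => m _.
by rewrite big1 // => n _; rewrite th0 mulr0 mul0r.
Qed.

Lemma Uform_mon r m n phi : (m < p ^ r)%N -> (n < p ^ r)%N ->
  Uform r (Y m * th r phi * X n).
Proof.
move=> mq nq; have [psi ppsi ->] := th_mod p d r phi.
exists (fun m' n' x => if (m' == m) && (n' == n) then psi x else 0); split.
  by move=> m' n' x; case: ifP.
rewrite (bigD1 (Ordinal mq)) //= (bigD1 (Ordinal nq)) //= !eqxx /=.
rewrite big1 ?addr0 => [|n' n'n].
  rewrite big1 ?addr0 // => m' m'm; rewrite big1 // => n' _.
  move: m'm; rewrite -val_eqE /= => /negPf ->.
  by rewrite th0 mulr0 mul0r.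
move: n'n; rewrite -val_eqE /= => /negPf ->.
by rewrite th0 mulr0 mul0r.
Qed.

Lemma UformD r u v : Uform r u -> Uform r v -> Uform r (u + v).
Proof. by move=> uU vU; rewrite -[u]scale1r; apply: Uform_lc. Qed.

Lemma UformZ r a u : Uform r u -> Uform r (a *: u).
Proof. by move=> uU; rewrite -[_ *: _]addr0; apply: Uform_lc uU (Uform0 r). Qed.

Lemma Uform_sum r (I : Type) (s : seq I) (P : pred I) (F : I -> A) :
  (forall i, P i -> Uform r (F i)) -> Uform r (\sum_(i <- s | P i) F i).
Proof.
by move=> FD; elim/big_ind: _ => //; [exact: Uform0 | exact: UformD].
Qed.

Lemma Uform_Y r a u : (a < p ^ r)%N -> Uform r u -> Uform r (Y a * u).
Proof.
move=> ar [phi [pphi ->]]; rewrite mulr_sumr; apply: Uform_sum => m _.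
rewrite mulr_sumr; apply: Uform_sum => n _; rewrite !mulrA.
have [amq|amq] := ltnP (a + m) (p ^ r); last first.
  by rewrite (Y_wrap hp d ar (ltn_ord m) amq) !mul0r; apply: Uform0.
by rewrite hYM -!scalerAl; apply/UformZ/Uform_mon.
Qed.

Lemma Uform_X r a u : (a < p ^ r)%N -> Uform r u -> Uform r (X a * u).
Proof.
move=> ar [phi [pphi ->]]; rewrite mulr_sumr; apply: Uform_sum => m _.
rewrite mulr_sumr; apply: Uform_sum => n _; rewrite !mulrA hXY !mulr_suml.
apply: Uform_sum => -[j /= ja] _; case: ifP => _; last first.
  by rewrite !mul0r; apply: Uform0.
have jr : (j < p ^ r)%N by lia.
rewrite -(mulrA _ (X _) (th _ _)) (X_th hp) // -!mulrA.
have [amq|amq] := ltnP (a - j + n) (p ^ r); last first.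
  rewrite (@X_wrap _ _ hp _ d r (a - j) n) ?mulr0 //; first exact: Uform0.
  by lia.
rewrite hXM -!scalerAr; apply/UformZ; rewrite (@hb_th _ p _ d r) //.
rewrite !mulrA -(mulrA _ (th _ _) (th _ _)) (thM hp); apply: Uform_mon => //.
exact: leq_ltn_trans (leq_subr _ _) (ltn_ord m).
Qed.

Lemma Uform1 r : Uform r 1.
Proof.
have q0 : (0 < p ^ r)%N by rewrite expn_gt0 prime_gt0.
have := Uform_mon (fun=> 1) q0 q0.
by rewrite hX0 hY0 (th_one hp) !mul1r.
Qed.

(* Conjugating by the weight idempotents kills the components Y^(m) h X^(n)  *)
(* with m <> n.                                                               *)
Lemma Uform_weight0 r u : Uform r u ->
  (forall N phi, per N phi -> th N phi * u = u * th N phi) -> Dform r u.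
Proof.
move=> [phi [pphi uE]] uC.
pose v := \sum_(m < p ^ r) Y m * th r (phi m m) * X m.
have vD : Dform r v by exists (fun m => phi m m).
suff <- : v = u by [].
apply/eqP; rewrite -subr_eq0.
(* Level r + 2 separates the shifts: for distinct m, n < p^r the numbers 2m and 2n differ modulo
   p^(r+2) >= 4 p^r, also when p = 2. *)
pose e a := th r.+2 (dlt k p r.+2 a).
have ee a : e a * e a = e a.
  rewrite /e (thM hp); apply: eq_th => x _.
  by rewrite /dlt; case: eqP; rewrite ?mulr1 ?mulr0.
have e1 : \sum_(a < p ^ r.+2) e (a%:Z + 0) = 1.
  rewrite -(th_one hp d r.+2) /e -(th_sum p d r.+2 (index_enum _)
    (fun (a : 'I_(p ^ r.+2)) => dlt k p r.+2 (a%:Z + 0))).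
  by apply: eq_th => x _; rewrite (dlt_sum hp).
have eC a : e a * (v - u) = (v - u) * e a.
  rewrite mulrBr mulrBl uC; last exact: dlt_per.
  by rewrite (th_Dform_comm _ vD) //; apply: dlt_per.
rewrite -[v - u]mul1r -e1 mulr_suml big1 // => a _.
rewrite -ee -mulrA eC mulrA; set b := a%:Z + 0.
have -> : e b * (v - u) * e b = \sum_(m < p ^ r) \sum_(n < p ^ r | n != m :> nat)
    - (e b * (Y m * th r (phi m n) * X n) * e b).
  rewrite uE /v -sumrB mulr_sumr mulr_suml; apply: eq_bigr => m _.
  rewrite (bigD1 m) //= opprD addrA subrr add0r mulrN mulNr mulr_sumr mulr_suml.
  by rewrite sumrN.
rewrite big1 // => m _; rewrite big1 // => n nm; apply/eqP; rewrite oppr_eq0.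
have pd := dlt_per k p r.+2 b.
rewrite /e !mulrA (th_Y hp) // -!mulrA (X_th hp) //.
rewrite [th r _ * (th _ _ * _)]mulrA thC -[th r.+2 _ * th r _ * _]mulrA.
rewrite [th r.+2 _ * (th r.+2 _ * _)]mulrA (thM hp).
rewrite (@eq_th _ p _ d _ _ (fun=> 0)) ?th0 ?(mul0r, mulr0) // => x _.
rewrite -![in dlt _ _ _ _ (_ - _)]/(_ + - _) !dlt_shift /dlt.
case: eqP => xm; rewrite ?mul0r //; case: eqP => xn; rewrite ?mulr0 //.
exfalso; move/eqP: xm; rewrite xn eqz_mod_dvd => /dvdzP [z].
have : (p ^ r.+2 >= 4 * p ^ r)%N.
  by rewrite !expnS mulnA leq_mul2r (leq_mul (prime_gt1 p_pr) (prime_gt1 p_pr)) orbT.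
move: nm (ltn_ord m) (ltn_ord n) => /eqP nm mq nq q4 zE.
have : z != 0 by apply/eqP => z0; move: zE; rewrite z0 mul0r; lia.
move=> z0; have : (1 <= `|z|)%N by rewrite absz_gt0.
move: zE => /(congr1 absz); rewrite abszM absz_nat => zE z1.
have : (p ^ r.+2 <= `|z| * p ^ r.+2)%N by rewrite leq_pmull.
by rewrite -zE; lia.
Qed.

End Generators.

(** * Products of Fr'-images *)

Section Frobenius.
Variables (k : fieldType) (p : nat).
Hypothesis hp : p \in [pchar k].
Let p_pr : prime p := pcharf_prime hp.
Variables (A : algType k) (d : hyp_data A).

Local Notation X := (hX d).
Local Notation Y := (hY d).
Local Notation hb := (hb d).
Local Notation per := (per p).
Local Notation th := (th p d).
Local Notation Dform := (Dform p d).

Lemma DformZ r a u : Dform r u -> Dform r (a *: u).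
Proof. by move=> uD; rewrite -[_ *: _]addr0; apply: Dform_lc uD (Dform0 p d r). Qed.

Lemma DformM r u v : Dform r u -> Dform r v -> Dform r (u * v).
Proof.
move=> [phi [pphi ->]] [psi [ppsi ->]]; rewrite mulr_suml.
apply: Dform_sum => m _; rewrite mulr_sumr; apply: Dform_sum => n _.
rewrite mon_mul //; apply: Dform_sum => -[j /= jm] _.
case: ifP => jn; last exact: Dform0.
have [mnq|mnq] := ltnP (m + (n - j)) (p ^ r); last first.
  rewrite (@Y_wrap _ _ hp _ d r) ?mul0r //; first exact: Dform0.
  by apply: leq_ltn_trans (ltn_ord n); rewrite leq_subr.
have e : (m - j + n = m + (n - j))%N by lia.
rewrite hYM hXM -!scalerAl -!scalerAr; do 2!apply: DformZ.
by rewrite e; apply: Dform_mon.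
Qed.

Lemma Dform_up r s u : (r <= s)%N -> Dform r u -> Dform s u.
Proof.
move=> rs [phi [pphi ->]]; apply: Dform_sum => m _.
rewrite -(th_up hp d (pphi m) rs); apply: Dform_mon.
by apply: leq_trans (ltn_ord m) _; rewrite leq_exp2l ?prime_gt1.
Qed.

Lemma hbc0 c : hb c 0 = 1.
Proof. by rewrite (hbE d c (ltnSn 0)) big_ord1 hb0 /newton /= ibin0 scale1r. Qed.

Lemma X1_exp n : X 1 ^+ n = n`!%:R *: X n.
Proof.
elim: n => [|n IHn]; first by rewrite hX0 scale1r.
rewrite exprS IHn -scalerAr hXM scalerA add1n bin1 -natrM mulnC.
by rewrite factS.
Qed.

Lemma Y1_exp n : Y 1 ^+ n = n`!%:R *: Y n.
Proof.
elim: n => [|n IHn]; first by rewrite hY0 scale1r.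
rewrite exprS IHn -scalerAr hYM scalerA add1n bin1 -natrM mulnC.
by rewrite factS.
Qed.

Lemma fact_neq0 i : (i < p)%N -> i`!%:R != 0 :> k.
Proof.
elim: i => [|i IHi] ip; first by rewrite fact0 oner_neq0.
rewrite factS natrM mulf_neq0 ?IHi ?(ltnW ip) //.
by rewrite -(dvdn_pcharf hp) gtnNdvd.
Qed.

Lemma natp0 n : (n * p)%:R = 0 :> k.
Proof. by apply/eqP; rewrite -(dvdn_pcharf hp) dvdn_mull. Qed.

Lemma X_comm m n : GRing.comm (X m) (X n).
Proof.
rewrite /GRing.comm !hXM addnC; congr (_%:R *: _).
by rewrite -(bin_sub (leq_addr m n)) addKn.
Qed.

Lemma Y_comm m n : GRing.comm (Y m) (Y n).
Proof.
rewrite /GRing.comm !hYM addnC; congr (_%:R *: _).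
by rewrite -(bin_sub (leq_addr m n)) addKn.
Qed.

(* Elements of A_1 commute with the Fr'-images. *)
Definition C1 (u : A) : Prop :=
  [/\ forall m, GRing.comm u (X (m * p)), forall m, GRing.comm u (Y (m * p)),
      forall N phi, per N phi -> GRing.comm u (th N phi)
    & GRing.comm u (Y 1 * X 1)].

(** The algebra A_1 by generators, so that its commutation properties follow by induction. *)
Inductive A1 : A -> Prop :=
| A1_th psi : per 1 psi -> A1 (th 1 psi)
| A1_t : A1 (Y 1 * X 1)
| A1_lc a u v : A1 u -> A1 v -> A1 (a *: u + v)
| A1_M u v : A1 u -> A1 v -> A1 (u * v).

(** The correction term ends in X^(mp-1) X = mp X^(mp) = 0. *)
Lemma X_pY1 m : X (m * p) * Y 1 * X 1 = Y 1 * X 1 * X (m * p).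
Proof.
case: m => [|m]; first by rewrite mul0n hX0 mul1r mulr1.
have mp0 : (0 < m.+1 * p)%N by rewrite muln_gt0 (prime_gt0 p_pr).
rewrite hXY -(prednK mp0) !big_ord_recl /= !subn0 subnn hbc0 hY0 mul1r mulr1.
rewrite big1 => [|i _]; last by rewrite !mul0r.
rewrite addr0 /bump /= addn0 subSS subn0 mulrDl -!mulrA.
rewrite [X _.-1 * X 1]hXM [in 'C(_, _)%N]addn1 binSn prednK // natp0 scale0r.
rewrite mulr0 addr0; congr (_ * _); exact: X_comm.
Qed.

Lemma t_Yp m : Y 1 * X 1 * Y (m * p) = Y (m * p) * (Y 1 * X 1).
Proof.
case: m => [|m]; first by rewrite mul0n hY0 mul1r mulr1.
have mp0 : (0 < m.+1 * p)%N by rewrite muln_gt0 (prime_gt0 p_pr).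
rewrite -mulrA hXY !big_ord_recl big_ord0 /= /bump /= addn0 !subn0 subnn mp0.
rewrite hbc0 hX0 mulr1 mulr1 addr0 mulrDr !mulrA.
rewrite [Y 1 * Y (_ - 1)%N]hYM subnKC // bin1 natp0 scale0r mul0r addr0.
by rewrite Y_comm.
Qed.

Lemma per1_shift (psi : int -> k) (z : int) : per 1 psi ->
  forall x, psi (x + z * p%:Z) = psi x.
Proof. by move=> ppsi x; have := perMz ppsi x z; rewrite expn1. Qed.

Lemma comm_lc a (u v w : A) : GRing.comm u w -> GRing.comm v w ->
  GRing.comm (a *: u + v) w.
Proof.
rewrite /GRing.comm mulrDl mulrDr -scalerAl -scalerAr => uw vw.
by rewrite uw vw.
Qed.

Lemma A1_C1 u : A1 u -> C1 u.
Proof.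
elim=> {u} [psi ppsi||a u v _ [u1 u2 u3 u4] _ [v1 v2 v3 v4]
  |u v _ [u1 u2 u3 u4] _ [v1 v2 v3 v4]].
- split.
  + move=> m; rewrite /GRing.comm (th_X hp) //; congr (_ * _).
    by apply: eq_th => i _; rewrite mulnA PoszM per1_shift.
  + move=> m; rewrite /GRing.comm (th_Y hp) //; congr (_ * _).
    by apply: eq_th => i _; rewrite mulnA PoszM -mulNr per1_shift.
  + by move=> N phi _; apply: thC.
  + exact: (th_YX_comm hp).
- split=> //.
  + by move=> m; rewrite /GRing.comm -X_pY1 mulrA.
  + by move=> m; rewrite /GRing.comm t_Yp.
  + by move=> N phi pphi; apply/commr_sym; apply: (th_YX_comm hp).
- split.
  + by move=> m; apply: comm_lc.
  + by move=> m; apply: comm_lc.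
  + by move=> N phi pphi; apply: comm_lc; [apply: u3 | apply: v3].
  + exact: comm_lc.
- split.
  + by move=> m; apply/commr_sym/commrM; apply/commr_sym.
  + by move=> m; apply/commr_sym/commrM; apply/commr_sym.
  + by move=> N phi pphi; apply/commr_sym/commrM; apply/commr_sym;
      [apply: u3 | apply: v3].
  + by apply/commr_sym/commrM; apply/commr_sym.
Qed.

Lemma A1_comm u v : A1 u -> A1 v -> GRing.comm u v.
Proof.
move=> /A1_C1 [_ _ u3 u4]; elim=> {v} [psi /u3||a v w _ uv _ uw|v w _ uv _ uw] //.
  by apply: commrD => //; rewrite /GRing.comm -scalerAl -scalerAr uv.
exact: commrM.
Qed.

Lemma A1_one : A1 1.
Proof. by rewrite -(th_one hp d 1); apply: A1_th. Qed.

Lemma A1_0 : A1 0.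
Proof. by rewrite -(th0 p d 1); apply: A1_th. Qed.

Lemma A1_Z a u : A1 u -> A1 (a *: u).
Proof. by move=> uA; rewrite -[_ *: _]addr0; apply: A1_lc A1_0. Qed.

Lemma A1_D u v : A1 u -> A1 v -> A1 (u + v).
Proof. by move=> uA vA; rewrite -[u]scale1r; apply: A1_lc. Qed.

Lemma A1_Dform u : A1 u -> Dform 1 u.
Proof.
have mon0 m psi : (m < p)%N -> Dform 1 (Y m * th 1 psi * X m).
  by move=> mp; apply: Dform_mon; rewrite expn1.
elim=> {u} [psi ppsi||a u v _ uD _ vD|u v _ uD _ vD].
- by have := mon0 0 psi (prime_gt0 p_pr); rewrite hX0 hY0 mul1r mulr1.
- by have := mon0 1 (fun=> 1) (prime_gt1 p_pr); rewrite (th_one hp) mulr1.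
- exact: Dform_lc.
- exact: DformM.
Qed.

Lemma hb1E : hb 0 1 = th 1 (fun x => x%:~R).
Proof.
rewrite (@hb_th _ p _ d 1) ?expn1 ?prime_gt1 //; apply: eq_th => i _.
by rewrite addr0 ibin_nat bin1.
Qed.

Lemma per1_int : per 1 (fun x => x%:~R : k).
Proof.
by move=> x; rewrite expn1 rmorphD /= -[p%:~R]/(p%:R) (pcharf0 hp) addr0.
Qed.

Lemma XY1 : X 1 * Y 1 = Y 1 * X 1 + hb 0 1.
Proof.
rewrite hXY !big_ord_recl big_ord0 /= /bump /= hbc0 hX0 hY0 mul1r !mulr1 addr0.
by rewrite (_ : _ - _ = 0).
Qed.

Lemma X1_A1 u : A1 u -> exists2 u', A1 u' & X 1 * u = u' * X 1.
Proof.
elim=> {u} [psi ppsi||a u v _ [u' u'A uE] _ [v' v'A vE]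
  |u v _ [u' u'A uE] _ [v' v'A vE]].
- exists (th 1 (fun x => psi (x - (2 * 1)%:Z))); last exact: (X_th hp).
  by apply: A1_th; apply: per_shift.
- exists (Y 1 * X 1 + hb 0 1); last by rewrite mulrA XY1.
  by apply: A1_D; [exact: A1_t | rewrite hb1E; apply/A1_th/per1_int].
- exists (a *: u' + v'); first exact: A1_lc.
  by rewrite mulrDr mulrDl -scalerAr -scalerAl uE vE.
- exists (u' * v'); first exact: A1_M.
  by rewrite mulrA uE -mulrA vE mulrA.
Qed.

Lemma X1n_A1 n u : A1 u -> exists2 u', A1 u' & X 1 ^+ n * u = u' * X 1 ^+ n.
Proof.
move=> uA; elim: n => [|n [u' u'A uE]]; first by exists u; rewrite ?mul1r ?mulr1.
have [v vA vE] := X1_A1 u'A; exists v => //.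
by rewrite exprS -mulrA uE mulrA vE -mulrA.
Qed.

Lemma XnYn_A1 n : A1 (X 1 ^+ n * Y 1 ^+ n).
Proof.
elim: n => [|n IHn]; first by rewrite mulr1; apply: A1_one.
have [u uA uE] := X1_A1 IHn.
rewrite exprS exprSr mulrA -[X 1 * _ * _]mulrA uE -mulrA XY1.
apply: A1_M => //; apply: A1_D; first exact: A1_t.
by rewrite hb1E; apply/A1_th/per1_int.
Qed.

Lemma YnXn_A1 n : A1 (Y 1 ^+ n * X 1 ^+ n).
Proof.
have nA m : A1 m%:R.
  by rewrite -scaler_nat; apply/A1_Z/A1_one.
rewrite hYX_prod; elim/big_ind: _ => [||i _].
- exact: A1_one.
- exact: A1_M.
rewrite addrC -mulNr -scaleN1r; apply: A1_D A1_t.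
apply: A1_M; first exact/A1_Z/nA.
apply: A1_D (nA _); apply: A1_D A1_one.
by rewrite hb1E; apply/A1_th/per1_int.
Qed.

Variable Fr : {linear A -> A}.
Hypothesis hFr : forall m n m',
  Fr (Y m * hb 0 n * X m') = Y (m * p) * hb 0 (n * p) * X (m' * p).

Local Notation fdiv phi := (fun x => phi (x %/ p%:Z)%Z).

Lemma ibin_fdiv x l : (ibin x (l * p))%:~R = (ibin (x %/ p%:Z)%Z l)%:~R :> k.
Proof.
have [dd ddp xd] := modz_exp hp 1 x; rewrite expn1 in ddp xd.
rewrite {1}(divz_eq x p%:Z) xd -[(l * p)%N]addn0.
by rewrite (ibin_lucas hp _ _ ddp (prime_gt0 p_pr)) bin0 mulr1.
Qed.

(** On the Cartan part Fr' is the pullback along division of weights by p with remainder, by the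
    Lucas congruence with low digit zero ([ibin_fdiv]). *)
Lemma Fr_mon N phi m n : per N phi ->
  Fr (Y m * th N phi * X n) = Y (m * p) * th N.+1 (fdiv phi) * X (n * p).
Proof.
move=> pphi; rewrite thE mulr_sumr mulr_suml linear_sum.
transitivity (Y (m * p) * (\sum_(l < p ^ N) th N.+1 (fun x =>
    newton (phi \o Posz) l * (ibin (x %/ p%:Z)%Z l)%:~R)) * X (n * p)).
  rewrite mulr_sumr mulr_suml; apply: eq_bigr => l _.
  rewrite -scalerAr -scalerAl linearZ /= hFr thZ -scalerAr -scalerAl.
  rewrite (@hb_th _ p _ d N.+1); last first.
    by rewrite expnSr ltn_pmul2r ?prime_gt0.
  congr (_ *: (_ * _ * _)); apply: eq_th => i _.
  by rewrite addr0 ibin_fdiv.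
rewrite -th_sum; congr (_ * _ * _); apply: eq_th => i _.
by rewrite [RHS](newton_per hp pphi).
Qed.

Lemma Fr_Dform N z : Dform N z -> Dform N.+1 (Fr z).
Proof.
move=> [phi [pphi ->]]; rewrite linear_sum; apply: Dform_sum => m _ /=.
rewrite Fr_mon //; apply: Dform_mon.
by rewrite expnSr ltn_pmul2r ?prime_gt0.
Qed.

Lemma Fr_C1 N z u : Dform N z -> C1 u -> GRing.comm u (Fr z).
Proof.
move=> [phi [pphi ->]] [u1 u2 u3 _]; rewrite linear_sum.
apply: commr_sum => m _ /=; rewrite Fr_mon //.
apply: commrM => //; apply: commrM => //; apply: (u3 N.+1).
exact: (per_fdiv hp).
Qed.

Lemma sum_multiples (F : nat -> A) m :
  (forall J, (J %% p != 0)%N -> F J = 0) ->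
  \sum_(J < (m * p).+1) F J = \sum_(j < m.+1) F (j * p)%N.
Proof.
move=> F0; elim: m => [|m IHm]; first by rewrite mul0n !big_ord1 mul0n.
rewrite [RHS]big_ord_recr /= -IHm mulSn addnC -addSn big_split_ord /=.
congr (_ + _); have p0 := prime_gt0 p_pr.
have p1 : (p.-1 < p)%N by rewrite prednK.
rewrite (bigD1 (Ordinal p1)) //= big1 ?addr0 => [|i ip].
  by rewrite addSnnS prednK // mulSnr.
apply: F0; rewrite addSnnS modnMDl modn_small; first by [].
rewrite ltn_neqAle ltn_ord andbT; apply: contra ip => /eqP e.
by apply/eqP/val_inj => /=; lia.
Qed.

Lemma X_split m i : (i < p)%N -> X (m * p + i) = X i * X (m * p).
Proof.
move=> ip; by rewrite hXM [(i + _)%N]addnC (bin_low hp) // scale1r.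
Qed.

Lemma Y_split m i : (i < p)%N -> Y (m * p + i) = Y (m * p) * Y i.
Proof.
move=> ip; rewrite hYM -(bin_sub (leq_addr i (m * p))) addKn.
by rewrite (bin_low hp) // scale1r.
Qed.

Section Beta.
Variables (beta : A) (a : nat).
Hypotheses (betaC : C1 beta) (ap : (a < p)%N).
Hypothesis beta_wt : th 1 (dlt k p 1 a%:Z) * beta = beta.
Hypothesis beta_kill : forall i, (p - a <= i < p)%N -> Y i * X i * beta = 0.

(** Write J = j1 p + r0 and i = p - r0. Both outer orders have low digit i, so a factor Y^(i) h
    X^(i) stands next to beta. For i >= p - a it is killed by hypothesis. For i < p - a the shift of
    h is divisible by p after passing X^(i), so on weight a the Lucas congruence gives the factor
    C(a, r0), zero because r0 > a. *)
Lemma beta_term m n J : (J <= m * p)%N -> (J %% p != 0)%N ->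
  (if (J <= n * p)%N then Y (n * p - J) else 0) *
    hb ((2 * J)%:Z - (m * p + n * p)%:Z) J * X (m * p - J) * beta = 0.
Proof.
move=> Jm Jp; case: ifP => Jn; last by rewrite !mul0r.
have p0 := prime_gt0 p_pr.
set j1 := (J %/ p)%N; set r0 := (J %% p)%N in Jp *.
have r0p : (r0 < p)%N by rewrite ltn_mod.
have JE : J = (j1 * p + r0)%N by exact: divn_eq.
have r00 : (0 < r0)%N by rewrite lt0n.
have lt_j1 n' : (J <= n' * p)%N -> (n' * p - J = (n' - j1.+1) * p + (p - r0))%N.
  move=> Jn'; have j1n : (j1 < n')%N.
    rewrite -(ltn_pmul2r p0); apply: leq_trans Jn'.
    by rewrite JE -addn1 leq_add2l.
  by rewrite mulnBl mulSn; have := leq_mul j1n (leqnn p); rewrite mulSn JE; lia.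
rewrite (lt_j1 _ Jm) (lt_j1 _ Jn); set i := (p - r0)%N.
have ip : (i < p)%N by rewrite /i; lia.
rewrite X_split // Y_split //; set c := _ - _.
have [b1 _ _ _] := betaC.
have Jq : (J < p ^ J.+1)%N.
  by apply: leq_trans (ltn_expl _ (prime_gt1 p_pr)) _; rewrite leq_exp2l ?prime_gt1.
suff key : Y i * hb c J * X i * beta = 0.
  transitivity (Y ((n - j1.+1) * p) * (Y i * hb c J * X i * beta) *
    X ((m - j1.+1) * p)); first by rewrite -!mulrA b1.
  by rewrite key mulr0 mul0r.
have [aip|ia] := leqP (p - a) i.
  rewrite (@hb_th _ p _ d J.+1) // (Y_th hp); last exact: (per_ibin hp).
  by rewrite -2!mulrA [Y i * (X i * _)]mulrA beta_kill ?aip ?mulr0.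
rewrite -[Y i * _ * _]mulrA hbX -beta_wt -!mulrA [hb _ _ * (th _ _ * _)]mulrA.
rewrite (@hb_th _ p _ d J.+1) // -(@th_up _ _ hp _ d 1 J.+1); first last.
- by [].
- exact: dlt_per.
rewrite (thM hp) (@eq_th _ p _ d _ _ (fun=> 0)) ?th0 ?(mul0r, mulr0) //.
move=> x _; rewrite /dlt; case: eqP => xa; last by rewrite mulr0.
rewrite mulr1; have -> : x%:Z + (c + (2 * i)%:Z) =
    ((x%:Z %/ p%:Z)%Z + (2 * (j1%:Z + 1) - m%:Z - n%:Z)) * p%:Z + a%:Z.
  rewrite {1}(divz_eq x%:Z p%:Z) -[X in (_ %% X)%Z]/((p%N)%:Z).
  move: xa; rewrite expn1 => ->; rewrite modz_small ?lez_nat ?ltz_nat //.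
  rewrite /c JE /i !PoszM -subzn ?(ltnW r0p) // !PoszD !PoszM; ring.
rewrite JE (ibin_lucas hp _ _ ap r0p) (@bin_small a) ?mulr0 //.
by move: ia; rewrite /i; lia.
Qed.

(** Only the indices J = jp remain, and for them Lucas turns the binomial into the one of index j at
    x divided by p: this is the formula for X^(m) Y^(n) with all orders multiplied by p. *)
Lemma Fr_straighten N m n : (m * p < p ^ N)%N ->
  X (m * p) * Y (n * p) * beta = \sum_(j < m.+1)
    (if (j <= n)%N then Y ((n - j) * p) else 0) *
    th N (fun x => (ibin ((x %/ p%:Z)%Z + ((2 * j)%:Z - (m + n)%:Z)) j)%:~R) *
    X ((m - j) * p) * beta.
Proof.
move=> mN; rewrite hXY mulr_suml.
pose F J := if (J <= m * p)%N then
   (if (J <= n * p)%N then Y (n * p - J) else 0) *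
    hb ((2 * J)%:Z - (m * p + n * p)%:Z) J * X (m * p - J) * beta else 0.
transitivity (\sum_(J < (m * p).+1) F J).
  apply: eq_bigr => -[J /= JM] _; have Jm : (J <= m * p)%N by [].
  by rewrite /F Jm.
rewrite sum_multiples => [|J Jp]; last first.
  by rewrite /F; case: ifP => // Jm; apply: beta_term.
have p0 := prime_gt0 p_pr.
apply: eq_bigr => -[j /= jm] _; rewrite /F !leq_pmul2r // -!mulnBl.
have -> : (j <= m)%N by [].
congr (_ * _ * _ * _); rewrite (@hb_th _ p _ d N); last first.
  by apply: leq_ltn_trans mN; rewrite leq_pmul2r.
apply: eq_th => x _; rewrite ibin_fdiv; congr ((ibin _ j)%:~R).
have -> : (2 * (j * p))%:Z - (m * p + n * p)%:Z =
    ((2 * j)%:Z - (m + n)%:Z) * p%:Z.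
  by rewrite !PoszD !PoszM; ring.
by rewrite addrC divzMDl 1?addrC // eqz_nat -lt0n.
Qed.

Lemma Fr_mul_mon N m n phi psi : per N phi -> per N psi -> (m < p ^ N)%N ->
  Fr (Y m * th N phi * X m) * Fr (Y n * th N psi * X n) * beta =
  Fr ((Y m * th N phi * X m) * (Y n * th N psi * X n)) * beta.
Proof.
move=> pphi ppsi mN; rewrite (mon_mul hp d n pphi ppsi mN) !Fr_mon //.
rewrite linear_sum mulr_suml.
have mN1 : (m * p < p ^ N.+1)%N by rewrite expnSr ltn_pmul2r ?prime_gt0.
have [b1 b2 b3 _] := betaC.
have pf := per_fdiv hp pphi; have pg := per_fdiv hp ppsi.
transitivity (Y (m * p) * th N.+1 (fdiv phi) * (X (m * p) * Y (n * p) * beta) *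
    th N.+1 (fdiv psi) * X (n * p)).
  by rewrite -!mulrA -b1 [th _ (fdiv psi) * (beta * _)]mulrA -(b3 _ _ pg) -!mulrA.
rewrite (Fr_straighten n mN1) !mulr_sumr !mulr_suml; apply: eq_bigr => -[j /= jm] _.
case: ifP => jn; last by rewrite linear0 !(mul0r, mulr0).
set g := th N.+1 (fun x => (ibin _ j)%:~R).
transitivity (Y (m * p) * Y ((n - j) * p) *
  (th N.+1 (fun x => phi ((x - (2 * ((n - j) * p))%:Z) %/ p%:Z)%Z) * g *
   th N.+1 (fun x => psi ((x - (2 * ((m - j) * p))%:Z) %/ p%:Z)%Z)) *
  (X ((m - j) * p) * X (n * p)) * beta).
  rewrite -!mulrA [th _ (fdiv phi) * (Y _ * _)]mulrA (th_Y hp) // -!mulrA.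
  congr (_ * (_ * (_ * (_ * _)))).
  by rewrite [beta * _]mulrA (b3 _ _ pg) -mulrA b1 mulrA (X_th hp) // -mulrA.
congr (_ * _); rewrite !hYM !hXM -!scalerAl -!scalerAr.
have FrZ c u : Fr (c *: u) = c *: Fr u by rewrite linearZ.
rewrite 2!FrZ Fr_mon; last first.
  apply: perM; last exact: per_shift.
  by apply: perM; [exact: per_shift | apply: (per_ibin hp); lia].
rewrite -!mulnDl !(bin_mulp hp) /g !(thM hp); congr (_ *: (_ *: (_ * _ * _))).
have pz (c x : int) : ((x - c * p%:Z) %/ p%:Z)%Z = (x %/ p%:Z)%Z - c.
  by rewrite -mulNr addrC divzMDl 1?addrC // eqz_nat -lt0n prime_gt0.
by apply: eq_th => x _; rewrite !mulnA !PoszM !pz.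
Qed.

Lemma Fr_mul N z z' : Dform N z -> Dform N z' ->
  Fr z * Fr z' * beta = Fr (z * z') * beta.
Proof.
move=> [phi [pphi ->]] [psi [ppsi ->]]; rewrite mulr_suml !linear_sum /=.
rewrite !mulr_suml; apply: eq_bigr => m _; rewrite !mulr_sumr linear_sum /=.
rewrite !mulr_suml; apply: eq_bigr => n _.
exact: Fr_mul_mon.
Qed.

End Beta.

(* The step for types (B) and (D). *)
Lemma Fr_step_idem N z B a : Dform N z -> z * z = z -> A1 B -> B * B = B ->
  (a < p)%N -> th 1 (dlt k p 1 a%:Z) * B = B ->
  (forall i, (p - a <= i < p)%N -> Y i * X i * B = 0) ->
  Dform N.+1 (Fr z * B) /\ (Fr z * B) * (Fr z * B) = Fr z * B.
Proof.
move=> zD zz BA BB ap Bwt Bkill; have BC := A1_C1 BA; split.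
  apply: DformM; first exact: Fr_Dform.
  exact: (Dform_up (ltn0Sn N) (A1_Dform BA)).
rewrite -mulrA [B * _]mulrA (Fr_C1 zD BC) -mulrA BB mulrA.
by rewrite (Fr_mul BC ap Bwt Bkill zD zD) zz.
Qed.

(** The monomials of Fr z can be pulled out around Y^s g X^s, their Cartan part being shifted by 2s,
    so the result depends on g only through Y^s g X^s. *)
Lemma A1_sandwich N z g g' s : Dform N z -> A1 g -> A1 g' ->
  Y 1 ^+ s * g * X 1 ^+ s = Y 1 ^+ s * g' * X 1 ^+ s ->
  Y 1 ^+ s * g * Fr z * X 1 ^+ s = Y 1 ^+ s * g' * Fr z * X 1 ^+ s.
Proof.
move=> [phi [pphi ->]] /A1_C1 [_ g2 g3 _] /A1_C1 [_ g2' g3' _] gg'.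
rewrite linear_sum !mulr_sumr !mulr_suml; apply: eq_bigr => m _ /=.
rewrite Fr_mon //; have pf := per_fdiv hp (pphi m).
have Xs : GRing.comm (X 1 ^+ s) (X (m * p)) by apply/commr_sym/commrX/X_comm.
have Ys : GRing.comm (Y 1 ^+ s) (Y (m * p)) by apply/commr_sym/commrX/Y_comm.
have key h : GRing.comm h (Y (m * p)) -> (forall N phi, per N phi ->
    GRing.comm h (th N phi)) ->
  Y 1 ^+ s * h * (Y (m * p) * th N.+1 (fdiv (phi m)) * X (m * p)) * X 1 ^+ s =
  Y (m * p) * (Y 1 ^+ s * h * X 1 ^+ s) *
  th N.+1 (fun x => phi m ((x + (2 * s)%:Z) %/ p%:Z)%Z) * X (m * p).
  move=> h2 h3; rewrite -!mulrA -Xs [h * (Y _ * _)]mulrA h2 !mulrA Ys.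
  rewrite -!mulrA; congr (_ * (_ * (_ * _))); rewrite !mulrA; congr (_ * _).
  by rewrite !X1_exp -scalerAr -scalerAl (th_X hp).
by rewrite (key g) // (key g') // gg'.
Qed.

Lemma sandwich_Dform N z g s : Dform N z -> A1 g ->
  A1 (Y 1 ^+ s * g * X 1 ^+ s) ->
  Dform N.+1 (Y 1 ^+ s * g * Fr z * X 1 ^+ s).
Proof.
move=> [phi [pphi ->]] /A1_C1 [_ g2 g3 _] BA.
have [B1 _ B3 _] := A1_C1 BA.
rewrite linear_sum !mulr_sumr !mulr_suml; apply: Dform_sum => m _ /=.
rewrite Fr_mon //; have pf := per_fdiv hp (pphi m).
have Xs : GRing.comm (X 1 ^+ s) (X (m * p)) by apply/commr_sym/commrX/X_comm.
have Ys : GRing.comm (Y 1 ^+ s) (Y (m * p)) by apply/commr_sym/commrX/Y_comm.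
have -> : Y 1 ^+ s * g * (Y (m * p) * th N.+1 (fdiv (phi m)) * X (m * p)) *
    X 1 ^+ s =
  (Y (m * p) * th N.+1 (fun x => phi m ((x + (2 * s)%:Z) %/ p%:Z)%Z) *
    X (m * p)) * (Y 1 ^+ s * g * X 1 ^+ s).
  transitivity (Y (m * p) * (Y 1 ^+ s * g * X 1 ^+ s) *
      th N.+1 (fun x => phi m ((x + (2 * s)%:Z) %/ p%:Z)%Z) * X (m * p)).
    rewrite -!mulrA -Xs [g * (Y _ * _)]mulrA g2 !mulrA Ys.
    rewrite -!mulrA; congr (_ * (_ * (_ * _))); rewrite !mulrA; congr (_ * _).
    by rewrite !X1_exp -scalerAr -scalerAl (th_X hp).
  have pf2 := per_shift (2 * s)%:Z pf.
  move: (Y 1 ^+ s * g * X 1 ^+ s) B1 B3 {BA} => Bs B1 B3.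
  by rewrite -(mulrA (Y _) Bs) (B3 _ _ pf2) -!mulrA B1.
apply: DformM; last exact: (Dform_up (ltn0Sn N) (A1_Dform BA)).
by apply: Dform_mon; rewrite expnSr ltn_pmul2r ?prime_gt0.
Qed.

(* The step for types (A) and (C): with W = X^s Y^s, which lies in A1, the     *)
(* square of Y^s b Fr(z) X^s is Y^s b (b W) Fr(z)^2 X^s, and b W satisfies    *)
(* the hypotheses of [Fr_mul] since X^i b X^s is in A1 X^(i+s) = 0.           *)
Lemma sandwich_step_idem N z b B s a :
  Dform N z -> z * z = z -> A1 b -> (s < p)%N -> (a < p)%N -> (a <= s)%N ->
  th 1 (dlt k p 1 a%:Z) * b = b ->
  B = Y 1 ^+ s * b * X 1 ^+ s -> A1 B -> B * B = B ->
  let E := Y 1 ^+ s * b * Fr z * X 1 ^+ s in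
  Dform N.+1 E /\ E * E = E.
Proof.
move=> zD zz bA sp ap as_ bwt BE BA BB E; split.
  by apply: sandwich_Dform => //; rewrite -BE.
have p0 := prime_gt0 p_pr.
pose W := X 1 ^+ s * Y 1 ^+ s; have WA : A1 W by apply: XnYn_A1.
have bWA : A1 (b * W) by apply: A1_M.
have bW_kill i : (p - a <= i < p)%N -> Y i * X i * (b * W) = 0.
  move=> /andP [ai ip].
  have [u uA uE] := X1n_A1 i bA.
  have i0 : i`!%:R != 0 :> k.
    exact: fact_neq0.
  have Xi : X i * b = u * X i.
    apply: (scalerI i0); rewrite scalerAl -X1_exp uE X1_exp scalerAr.
    by rewrite -scalerAr.
  rewrite /W -!mulrA [X i * (b * _)]mulrA Xi X1_exp -!mulrA.
  rewrite [X i * (_ * _)]mulrA -scalerAr (@X_wrap _ _ hp _ d 1) ?expn1 //.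
    by rewrite scaler0 mul0r !mulr0.
  by move: ai; lia.
have bWwt : th 1 (dlt k p 1 a%:Z) * (b * W) = b * W by rewrite mulrA bwt.
have FC u : A1 u -> GRing.comm u (Fr z) by move=> /A1_C1 uC; apply: (Fr_C1 zD).
transitivity (Y 1 ^+ s * (b * (b * W)) * Fr z * X 1 ^+ s).
  transitivity (Y 1 ^+ s * (b * (Fr z * Fr z * (b * W))) * X 1 ^+ s).
    rewrite -{1}(mulrA (Fr z)) -(FC _ bWA) /E /W -!mulrA.
    rewrite [X 1 ^+ s * (Y 1 ^+ s * _)]mulrA -/W [W * (b * _)]mulrA.
    by rewrite (A1_comm WA bA) /W -!mulrA; congr (_ * (_ * _)); rewrite !mulrA.
  rewrite (Fr_mul (A1_C1 bWA) ap bWwt bW_kill zD zD) zz -(FC _ bWA).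
  by rewrite -!mulrA.
(* The required equality Y^s b (b W) X^s = Y^s b X^s is B B = B, since W commutes with b. *)
rewrite /E; apply: (A1_sandwich zD _ bA); first exact: A1_M.
rewrite (A1_comm bA WA) -BE -BB BE /W.
by rewrite !mulrA.
Qed.

End Frobenius.

(** * The polynomials psi_j *)

(** Newton interpolation with arbitrary nodes: the coefficient of the product of the first s factors
    is the value of the cofactor at the next node, and subtracting that term gains one more
    factor. *)
Lemma newton_basis (F : fieldType) (node : nat -> F) (f : {poly F}) s n :
  (size f <= n)%N -> \prod_(l < s) ('X - (node l)%:P) %| f ->
  exists c : nat -> F, (forall m, (m < s)%N -> c m = 0) /\
    f = \sum_(m < n) c m *: \prod_(l < m) ('X - (node l)%:P).
Proof.
have sW m : size (\prod_(l < m) ('X - (node l)%:P)) = m.+1.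
  by rewrite -big_enum size_prod_XsubC size_enum_ord.
move: {2}(n - s)%N (erefl (n - s)%N) => e; elim: e s f => [|e IHe] s f ens sf Wf.
  exists (fun=> 0); split=> //.
  rewrite big1 => [|m _]; last by rewrite scale0r.
  have [->|f0] := eqVneq f 0; first by [].
  have := dvdp_leq f0 Wf; rewrite sW => /leq_trans /(_ sf).
  by lia.
case/dvdpP: Wf => g fE; pose c := g.[node s].
have sn : (s < n)%N by lia.
have [|||c' [c'0 fE']] := IHe s.+1 (f - c *: \prod_(l < s) ('X - (node l)%:P)).
- by lia.
- rewrite (leq_trans (size_polyD _ _)) // geq_max sf size_polyN.
  by rewrite (leq_trans (size_scale_leq _ _)) // sW.
- rewrite big_ord_recr /= fE -mul_polyC -mulrBl mulrC dvdp_mul //.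
  by rewrite dvdp_XsubCl /root !hornerE subrr.
exists (fun m => if m == s then c else c' m); split.
  move=> m ms; rewrite (ltn_eqF ms) c'0 //; exact: ltnW.
rewrite -[f](subrK (c *: \prod_(l < s) ('X - (node l)%:P))) fE'.
rewrite [in LHS](bigD1 (Ordinal sn)) //= [in RHS](bigD1 (Ordinal sn)) //=.
rewrite c'0 // scale0r add0r eqxx addrC; congr (_ + _).
by apply: eq_bigr => m; rewrite -val_eqE /= => /negPf ->.
Qed.

Lemma dvdp_XsubC_sqr (F : fieldType) (h : {poly F}) (u : F) :
  h.[u] = 0 -> h^`().[u] = 0 -> ('X - u%:P) ^+ 2 %| h.
Proof.
move=> /eqP /factor_theorem [h1 ->]; rewrite derivM derivXsubC mulr1.
rewrite hornerD hornerM hornerXsubC subrr mulr0 add0r.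
move=> /eqP /factor_theorem [h2 ->]; rewrite -mulrA expr2.
exact: dvdp_mulIr.
Qed.

(* R here is (X^n - 1) / (X - u); its value and first derivative at u come   *)
(* from differentiating X^n - 1 = (X - u) R.                                  *)
Lemma sqr_cofactor (F : fieldType) (n : nat) (u : F) (R : {poly F}) :
  (0 < n)%N -> 2%:R * n%:R = -1 :> F -> 'X^n - 1 = ('X - u%:P) * R ->
  ('X - u%:P) ^+ 2 %| 2%:R *: 'X * ('X + u%:P) * R ^+ 2 - 1.
Proof.
move=> n_gt0 two_nF RE; move: two_nF; set nF := n%:R => two_nF.
have I1 : 'X * R + 'X * ('X - u%:P) * R^`() = nF%:P * (1 + ('X - u%:P) * R).
  rewrite -RE subrKC -(prednK n_gt0) exprS.
  have := congr1 (fun g : {poly F} => 'X * g^`()) RE.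
  rewrite derivB derivXn derivC subr0 derivM derivXsubC mul1r.
  rewrite mulrDr mulrA => <-.
  rewrite mulrnAr -mulr_natl -polyC_natr.
  by congr (_%:P * _); rewrite prednK.
have uR : u * R.[u] = nF.
  have := congr1 (horner^~ u) I1; rewrite !hornerE subrr.
  by rewrite !(mulr0, mul0r, addr0) mulr1.
have I2 := congr1 (fun g : {poly F} => (g^`()).[u]) I1.
have uR' : 2%:R * u * R^`().[u] = (nF - 1) * R.[u].
  have h : R.[u] + u * R^`().[u] + (u - u + u) * R^`().[u] +
      u * (u - u) * R^`()^`().[u] = nF * (R.[u] + (u - u) * R^`().[u]).
    by move: I2; rewrite !derivE !hornerE.
  move: h; rewrite subrr mulr0 !mul0r !addr0 add0r mulrBl mul1r => <-.
  by ring.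
apply: dvdp_XsubC_sqr.
  have -> : (2 *: 'X * ('X + u%:P) * R ^+ 2 - 1).[u] =
      (2%:R * (u * R.[u]) - 1) * (2%:R * (u * R.[u]) + 1).
    by rewrite !hornerE /=; ring.
  by rewrite uR two_nF addNr mulr0.
have -> : (2 *: 'X * ('X + u%:P) * R ^+ 2 - 1)^`().[u] =
    2%:R * R.[u] * (3%:R * (u * R.[u]) + 2%:R * u * (2%:R * u * R^`().[u])).
  by rewrite !derivE !hornerE /=; ring.
have -> : 3%:R * (u * R.[u]) + 2%:R * u * (2%:R * u * R^`().[u]) =
    u * R.[u] * (2%:R * nF + 1) by rewrite uR'; ring.
by rewrite two_nF addNr !mulr0.
Qed.

(** * The polynomials psi and psi_j over a finite field of odd order *)

Section SquareNodes.
Variables (F : finFieldType) (n : nat).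
Hypotheses (cardF : #|F| = n.*2.+1) (n_gt0 : (0 < n)%N).
Hypothesis two_n : 2%:R * n%:R = -1 :> F.

Let Psi : {poly F} := \prod_(i : F) ('X - (i ^+ 2)%:P).
Let f0 : {poly F} := \prod_(i : F | i != 0) ('X - (i ^+ 2)%:P).

Lemma two_neq0 : 2%:R != 0 :> F.
Proof.
apply/eqP => h; have := two_n; rewrite h mul0r => /eqP.
by rewrite eq_sym oppr_eq0 oner_eq0.
Qed.

Lemma expF_2n (x : F) : x != 0 -> (x ^+ 2) ^+ n = 1.
Proof.
move=> x0; apply: (mulfI x0); rewrite -exprM mul2n -exprS mulr1.
by rewrite -cardF expf_card.
Qed.

(* Comparing both sides at X^2 turns the left factor into (X^q - X)^2.       *)
Lemma PsiE : Psi = 'X * ('X^n - 1) ^+ 2.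
Proof.
have cX (f g : {poly F}) : f \Po 'X^2 = g \Po 'X^2 -> f = g.
  move=> /eqP; rewrite -subr_eq0 -comp_polyB comp_poly_eq0 ?size_polyXn //.
  by rewrite subr_eq0 => /eqP.
have gen := finField_genPoly F.
apply: cX; transitivity (('X^(n.*2.+1) - 'X : {poly F}) ^+ 2); last first.
  rewrite comp_polyM comp_polyX rmorphXn /= comp_polyB -polyC1 comp_polyC.
  have -> : 'X^(n.*2.+1) - 'X = 'X * ('X^(n.*2) - 1) :> {poly F}.
    by rewrite mulrBr mulr1 exprS.
  by rewrite comp_Xn_poly -exprM mul2n polyC1 exprMn.
rewrite rmorph_prod /= -cardF gen expr2.
rewrite [X in _ = _ * X](reindex_inj (@oppr_inj F)) -big_split /=.
apply: eq_bigr => i _; rewrite comp_polyB comp_polyX comp_polyC polyCN opprK.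
by rewrite polyCM -subr_sqr -expr2.
Qed.

Lemma Psi_f0 : Psi = 'X * f0.
Proof. by rewrite /Psi (bigD1 0) //= expr0n /= subr0. Qed.

Lemma f0E : f0 = ('X^n - 1) ^+ 2.
Proof. by apply: (mulfI (negbT (polyX_eq0 F))); rewrite -PsiE Psi_f0. Qed.

Lemma size_Psi : size Psi = n.*2.+2.
Proof. by rewrite /Psi size_prod_XsubC -cardF cardT enumT. Qed.

Lemma size_f0 : size f0 = n.*2.+1.
Proof.
have := size_Psi; rewrite Psi_f0 mulrC size_mulX ?f0E; last first.
  rewrite expf_eq0 /= subr_eq0; apply/negP.
  move=> /eqP /(congr1 (fun g : {poly F} => size g)).
  by rewrite size_polyXn size_poly1; case: (n) n_gt0.
by move=> [].
Qed.

(** The polynomial [psi_eps false j], over any such field. *)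
Definition prim_poly (j : F) : {poly F} :=
  if j == 0 then f0
  else 2%:R *: 'X * ('X + (j ^+ 2)%:P) *
       \prod_(i : F | [&& i != 0, i != j & i != - j]) ('X - (i ^+ 2)%:P).

Lemma opp_neq (s : F) : s != 0 -> - s != s.
Proof.
move=> s0; rewrite eq_sym -subr_eq0 opprK -mulr2n -mulr_natl.
by rewrite mulf_neq0 ?two_neq0.
Qed.

Section Nonzero.
Variable s : F.
Hypothesis s0 : s != 0.
Let u := s ^+ 2.
Let P : {poly F} :=
  \prod_(i : F | [&& i != 0, i != s & i != - s]) ('X - (i ^+ 2)%:P).

Lemma f0_P : f0 = ('X - u%:P) ^+ 2 * P.
Proof.
rewrite /f0 (bigD1 s) //= (bigD1 (- s)) /=; last by rewrite oppr_eq0 s0 opp_neq.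
rewrite sqrrN mulrA expr2; congr (_ * _); apply: eq_bigl => i.
by rewrite andbA.
Qed.

Lemma prim_polyE : prim_poly s = 2%:R *: 'X * ('X + u%:P) * P.
Proof. by rewrite /prim_poly (negPf s0). Qed.

Lemma un1 : u ^+ n = 1. Proof. exact: expF_2n. Qed.

(** Divide (X - u)^2 P = (X^n - 1)^2 by (X - u)^2. *)
Lemma P_sqr : exists R : {poly F},
  'X^n - 1 = ('X - u%:P) * R /\ P = R ^+ 2.
Proof.
have : root ('X^n - 1) u by rewrite /root !hornerE un1 subrr.
move=> /factor_theorem [R RE]; exists R; split; first by rewrite RE mulrC.
have x0 : ('X - u%:P) ^+ 2 != 0 by rewrite expf_neq0 // polyXsubC_eq0.
by apply: (mulfI x0); rewrite -f0_P f0E RE exprMn mulrC.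
Qed.

Lemma prim_poly_sub1 : ('X - u%:P) ^+ 2 %| prim_poly s - 1.
Proof.
have [R [RE PE]] := P_sqr; rewrite prim_polyE PE.
exact: (sqr_cofactor n_gt0 two_n RE).
Qed.

Lemma Psi_P : Psi = 'X * ('X - u%:P) ^+ 2 * P.
Proof. by rewrite Psi_f0 f0_P mulrA. Qed.

(** In Psi = X (X - u)^2 P the factor X P divides psi_s, and (X - u)^2 divides psi_s - 1. *)
Lemma prim_poly_idem_n0 : Psi %| prim_poly s * prim_poly s - prim_poly s.
Proof.
rewrite -{3}[prim_poly s]mulr1 -mulrBr Psi_P prim_polyE.
rewrite mulrAC mulrC -prim_polyE mulrC dvdp_mul ?prim_poly_sub1 //.
rewrite prim_polyE -scalerAl -scalerAl dvdpZr ?two_neq0 //.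
by rewrite mulrAC dvdp_mulIl.
Qed.

Lemma size_prim_poly_n0 : (size (prim_poly s) <= n.*2.+1)%N.
Proof.
have sP : (size P).+2 = n.*2.+1.
  rewrite -size_f0 f0_P size_mul ?expf_neq0 ?polyXsubC_eq0 //.
    by rewrite size_exp_XsubC.
  apply/eqP => P0; have := size_f0; rewrite f0_P P0 mulr0 size_poly0.
  by move: n_gt0; case: (n).
rewrite prim_polyE -scalerAl -scalerAl (leq_trans (size_scale_leq _ _)) //.
rewrite -sP (leq_trans (size_polyMleq _ _)) // mulrC size_mulX ?size_XaddC //.
by rewrite -size_poly_eq0 size_XaddC.
Qed.

End Nonzero.

Lemma prim_poly_idem j : Psi %| prim_poly j * prim_poly j - prim_poly j.
Proof.
have [->|j0] := eqVneq j 0; last exact: prim_poly_idem_n0.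
rewrite /prim_poly eqxx -{3}[f0]mulr1 -mulrBr Psi_f0 mulrC dvdp_mul //.
rewrite -['X]subr0 -polyC0 dvdp_XsubCl /root f0E !hornerE.
by rewrite expr0n /= -(prednK n_gt0) /= sub0r sqrrN expr1n subrr.
Qed.

Lemma size_prim_poly j : (size (prim_poly j) <= n.*2.+1)%N.
Proof.
have [->|j0] := eqVneq j 0; last exact: size_prim_poly_n0.
by rewrite /prim_poly eqxx size_f0.
Qed.

Lemma root_prim_poly j i : i ^+ 2 != j ^+ 2 -> root (prim_poly j) (i ^+ 2).
Proof.
move=> ij; have [j0|j0] := eqVneq j 0.
  rewrite /prim_poly j0 eqxx; move: ij; rewrite j0 expr0n /= expf_eq0 /= => i0.
  by rewrite /f0 (bigD1 i) //= rootM root_XsubC eqxx.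
rewrite prim_polyE //; have [->|i0] := eqVneq i 0.
  by rewrite expr0n /= !rootM rootZ ?two_neq0 // /root hornerX eqxx.
rewrite rootM; apply/orP; right; rewrite (bigD1 i) /= ?rootM ?root_XsubC ?eqxx //.
rewrite i0 /=; apply/andP; split; apply: contraNneq ij => ->; rewrite ?sqrrN //.
Qed.

Section Nodes.
Variable al : F.
Let W (m : nat) : {poly F} := \prod_(l < m) ('X - ((al + l%:R) ^+ 2)%:P).

Lemma W_dvd_prim_poly j s :
  (forall l, (l < s)%N -> (al + l%:R) ^+ 2 != j ^+ 2) ->
  (forall l l', (l < l' < s)%N -> (al + l%:R) ^+ 2 != (al + l'%:R) ^+ 2) ->
  W s %| prim_poly j.
Proof.
move=> lj ll'; pose rs := [seq (al + (val l)%:R) ^+ 2 | l <- enum 'I_s].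
have -> : W s = \prod_(z <- rs) ('X - z%:P) by rewrite big_map big_enum.
apply: uniq_roots_dvdp; last first.
  rewrite uniq_rootsE map_inj_in_uniq ?enum_uniq // => l l' _ _ e.
  case: (ltngtP (val l) (val l')) => h; last exact/val_inj.
    by have := ll' l l'; rewrite h ltn_ord e eqxx => /(_ isT).
  by have := ll' l' l; rewrite h ltn_ord e eqxx => /(_ isT).
apply/allP => z zrs; case/mapP: zrs => l _ ->.
by apply: root_prim_poly; apply: lj; apply: ltn_ord.
Qed.

Lemma Psi_dvd_W0 w l : (l < w)%N -> al + l%:R = 0 -> Psi %| W w * prim_poly 0.
Proof.
move=> lw al0; rewrite /prim_poly eqxx Psi_f0 dvdp_mul //.
by rewrite /W (bigD1 (Ordinal lw)) //= al0 expr0n /= subr0 dvdp_mulIl.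
Qed.

(** Two nodes j and -j put (X - j^2)^2 into W, exactly the factor of Psi missing from psi_j. *)
Lemma Psi_dvd_W w j l l' : j != 0 -> (l < w)%N -> (l' < w)%N ->
  al + l%:R = j -> al + l'%:R = - j -> Psi %| W w * prim_poly j.
Proof.
move=> j0 lw l'w alj al'j; rewrite (Psi_P j0) (prim_polyE j0) -!scalerAl -scalerAr.
rewrite dvdpZr ?two_neq0 //.
have ll' : Ordinal l'w != Ordinal lw.
  apply/eqP => /(congr1 val) /= e; move: al'j; rewrite e alj => /eqP.
  by rewrite eq_sym (negPf (opp_neq j0)).
have WE : ('X - (j ^+ 2)%:P) ^+ 2 %| W w.
  rewrite /W (bigD1 (Ordinal lw)) //= (bigD1 (Ordinal l'w)) //= alj al'j.
  by rewrite sqrrN mulrA -expr2 dvdp_mulIl.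
move: (\prod_(i : F | _) _) => Q; move: WE; set A := (_ ^+ 2) => WE.
have -> : 'X * A * Q = A * ('X * Q) by ring.
have -> : 'X * ('X + (j ^+ 2)%:P) * Q = 'X * Q * ('X + (j ^+ 2)%:P) by ring.
by rewrite dvdp_mul // dvdp_mulIl.
Qed.

End Nodes.

End SquareNodes.

(** * The prime subfield of k *)

Section PrimeSubfield.
Variables (k : fieldType) (p : nat).
Hypothesis hp : p \in [pchar k].
Let p_pr : prime p := pcharf_prime hp.

Lemma Fp_in_nat n : Fp_in k (n%:R : 'F_p) = n%:R.
Proof.
rewrite /Fp_in val_Fp_nat // [in RHS](divn_eq n p) natrD.
by rewrite (natp0 hp) add0r.
Qed.

Lemma Fp_natE (x : 'F_p) : x = (nat_of_ord x)%:R.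
Proof. by rewrite natr_Zp. Qed.

(** The extra argument carries the characteristic, on which the ring morphism structure depends. *)
Definition Fp_mor (_ : p \in [pchar k]) : 'F_p -> k := @Fp_in k p.

Lemma Fp_mor_zmod : zmod_morphism (Fp_mor hp).
Proof.
have D (x y : 'F_p) : Fp_in k (x + y) = Fp_in k x + Fp_in k y.
  by rewrite {1}[x]Fp_natE {1}[y]Fp_natE -natrD Fp_in_nat natrD.
move=> x y; apply: (addIr (Fp_mor hp y)); rewrite subrK.
by rewrite -[LHS]D subrK.
Qed.

Lemma Fp_mor_monoid : monoid_morphism (Fp_mor hp).
Proof.
split; first exact: (Fp_in_nat 1).
move=> x y; rewrite {1}[x]Fp_natE {1}[y]Fp_natE -natrM.
by rewrite [LHS]Fp_in_nat natrM.
Qed.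
End PrimeSubfield.

HB.instance Definition _ (k : fieldType) (p : nat) (hp : p \in [pchar k]) :=
  GRing.isZmodMorphism.Build 'F_p k (Fp_mor hp) (Fp_mor_zmod hp).
HB.instance Definition _ (k : fieldType) (p : nat) (hp : p \in [pchar k]) :=
  GRing.isMonoidMorphism.Build 'F_p k (Fp_mor hp) (Fp_mor_monoid hp).

(** * The idempotents B(a, j) of A_1 *)

Section LevelOne.
Variables (k : fieldType) (p : nat).
Hypothesis hp : p \in [pchar k].
Let p_pr : prime p := pcharf_prime hp.
Variables (A : algType k) (d : hyp_data A).

Local Notation X := (hX d).
Local Notation Y := (hY d).
Local Notation hb := (hb d).
Local Notation per := (per p).
Local Notation th := (th p d).
Local Notation A1 := (A1 p d).

Lemma Fp_inE : Fp_in k (p := p) = Fp_mor hp. Proof. by []. Qed.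

Lemma hcoef_th (b : int) (i j : nat) : exists lam : A -> k,
  [/\ {morph lam : x y / x + y}, forall c x, lam (c *: x) = c * lam x
    & forall N phi m n, per N phi -> lam (Y m * th N phi * X n) =
        phi (b + (2 * n)%:Z) * ((i, j) == (m, n))%:R].
Proof.
have [lam [lamD lamZ lamE]] := hcoef d b i j; exists lam; split=> //.
move=> N phi m n pphi; rewrite thE mulr_sumr mulr_suml.
have lam0 : lam 0 = 0 by rewrite -(scale0r 0) lamZ mul0r.
rewrite (big_morph lam lamD lam0) (newton_per hp pphi) mulr_suml.
apply: eq_bigr => l _; rewrite -scalerAr -scalerAl lamZ lamE addr0.
by rewrite mulrA.
Qed.

Definition mua (a : nat) : A := hb (- a%:Z - 1) p.-1.

(** By Lucas the value at x is C(d, p-1) with d the residue of x - a - 1, which is 1 for d = p - 1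
    and 0 otherwise. *)
Lemma mu_th a : mua a = th 1 (dlt k p 1 a%:Z).
Proof.
have p0 := prime_gt0 p_pr; have p1 : (p.-1 < p)%N by rewrite prednK.
rewrite /mua (@hb_th _ p _ d 1) ?expn1 //; apply: eq_th => x _.
have [dd ddp xd] := modz_exp hp 1 (x%:Z + (- a%:Z - 1)).
rewrite {1}(divz_eq (x%:Z + (- a%:Z - 1)) p%:Z) -{2}[p]expn1 xd.
rewrite expn1 in ddp; rewrite -[p.-1]add0n -(mul0n p).
rewrite (ibin_lucas hp _ _ ddp p1) ibin0 mul1r /dlt.
have -> : (x == a %[mod (p ^ 1)%N])%Z = (dd == p.-1).
  rewrite -eqz_nat -xd expn1 -[(p.-1)%:Z](@modz_small _ p%:Z); last first.
    by rewrite lez_nat ltz_nat.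
  rewrite !eqz_mod_dvd.
  have -> : x%:Z + (- a%:Z - 1) - (p.-1)%:Z = x%:Z - a%:Z - p%:Z.
    by rewrite -[p in RHS](prednK p0) intS; ring.
  by rewrite [RHS]rpredBr // dvdzz.
case: eqP => [->|/eqP ne]; first by rewrite binn.
by rewrite bin_small // ltn_neqAle ne -ltnS prednK.
Qed.

Lemma mua_A1 a : A1 (mua a).
Proof. by rewrite mu_th; apply/A1_th/dlt_per. Qed.

Lemma mua_th a psi : per 1 psi -> mua a * th 1 psi = psi a%:Z *: mua a.
Proof.
move=> ppsi; rewrite mu_th (thM hp) -thZ; apply: eq_th => x _.
by rewrite mulrC dltM.
Qed.

Lemma muaM a : mua a * mua a = mua a.
Proof.
rewrite {2}mu_th mua_th; last exact: dlt_per.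
by rewrite /dlt eqxx scale1r.
Qed.

Lemma mua_H a : mua a * hb 0 1 = a%:R *: mua a.
Proof. by rewrite (hb1E hp) mua_th //; exact: per1_int. Qed.

Local Notation t := (Y 1 * X 1).
Local Notation YX m := (Y 1 ^+ m * X 1 ^+ m).

Lemma X1_ge_p m : (p <= m)%N -> X 1 ^+ m = 0.
Proof.
move=> pm; rewrite -(subnK pm) exprD [X 1 ^+ p]X1_exp.
have -> : p`!%:R = 0 :> k.
  by apply/eqP; rewrite -(dvdn_pcharf hp) dvdn_fact // prime_gt0 /=.
by rewrite scale0r mulr0.
Qed.

Lemma mua_YXS a m : mua a * YX m.+1 =
  mua a * YX m * (t - (m%:R * (a%:R + 1 + m%:R))%:A).
Proof.
have -> : YX m.+1 = YX m * (t - m%:R * (hb 0 1 + 1 + m%:R)).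
  by rewrite !hYX_prod big_ord_recr.
rewrite mulrA; have := A1_comm hp (YnXn_A1 hp d m) (mua_A1 a).
move: (YX m) => z zC; rewrite -zC -!(mulrA z).
congr (_ * _); rewrite !mulrBr mulr_algr; congr (_ - _).
rewrite mulr_natl -[_ *+ m]scaler_nat -scalerAr -scalerA; congr (_ *: _).
by rewrite !mulrDr mulr1 mua_H mulr_natr -[_ *+ m]scaler_nat !scalerDl scale1r.
Qed.

(* The coefficients of an element mu_a (sum_m c_m Y^m X^m) are unique: they  *)
(* can be read off on the induced module of weight a.                        *)
Lemma YX_coef_uniq a (c c' : 'I_p -> k) :
  mua a * \sum_(m < p) c m *: YX m = mua a * \sum_(m < p) c' m *: YX m ->
  forall m, c m = c' m.
Proof.
move=> cc m; have [lam [lamD lamZ lamE]] := hcoef_th a%:Z m m.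
have lam0 : lam 0 = 0 by rewrite -(scale0r 0) lamZ mul0r.
have key (e : 'I_p -> k) : lam (mua a * \sum_(m < p) e m *: YX m) =
    e m * (m`!%:R * m`!%:R).
  rewrite mulr_sumr (big_morph lam lamD lam0) (bigD1 m) //= big1 ?addr0.
    rewrite -scalerAr lamZ X1_exp Y1_exp -scalerAl -scalerAr -!scalerAr !lamZ.
    rewrite mu_th [th _ _ * _]mulrA (th_Y hp); last exact: dlt_per.
    rewrite lamE; last exact/per_shift/dlt_per.
    by rewrite addrK /dlt !eqxx !mulr1.
  move=> i im; rewrite -scalerAr lamZ X1_exp Y1_exp -scalerAl -scalerAr.
  rewrite -!scalerAr !lamZ mu_th [th _ _ * _]mulrA (th_Y hp); last exact: dlt_per.
  rewrite lamE; last exact/per_shift/dlt_per.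
  have mi : (m == i :> nat) = false by rewrite eq_sym; apply/negbTE.
  by rewrite xpair_eqE mi !mulr0.
have := congr1 lam cc; rewrite !key; apply: mulIf.
by rewrite mulf_neq0 // (fact_neq0 hp).
Qed.

Section Eval.
Variable a : nat.
Hypotheses (p_odd : odd p) (ap : (a < p)%N).
Local Notation F := 'F_p.
Let al : F := (a%:R + 1) / 2%:R.
Let sg : F := al ^+ 2.
Let w : A := mua a * Y 1 * X 1 + (Fp_in k sg)%:A.
Let h (f : {poly F}) : A := horner_alg w (map_poly (Fp_in k (p := p)) f).
Let W (m : nat) : {poly F} := \prod_(l < m) ('X - ((al + l%:R) ^+ 2)%:P).

Lemma cardFp : #|F| = (p.-1)./2.*2.+1.
Proof. rewrite card_Fp //; have := prime_gt0 p_pr; move: p_odd; lia. Qed.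

Lemma half_gt0 : (0 < (p.-1)./2)%N.
Proof. have := prime_gt1 p_pr; move: p_odd; lia. Qed.

Lemma two_half : 2%:R * (p.-1)./2%:R = -1 :> F.
Proof.
apply/eqP; rewrite -subr_eq0 opprK -natrM natr1.
have -> : (2 * (p.-1)./2).+1 = p.
  by have := prime_gt0 p_pr; move: p_odd; lia.
by rewrite (pcharf0 (pchar_Fp p_pr)).
Qed.

Let hM f g : h (f * g) = h f * h g.
Proof. by rewrite /h Fp_inE !rmorphM. Qed.

Let hB f g : h (f - g) = h f - h g.
Proof. by rewrite /h Fp_inE !rmorphB. Qed.

Let hC c : h c%:P = (Fp_in k c)%:A.
Proof. by rewrite /h Fp_inE map_polyC horner_algC. Qed.

Let hXw : h 'X = w.
Proof. by rewrite /h Fp_inE map_polyX horner_algX. Qed.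

Let wA1 : A1 w.
Proof.
rewrite /w -mulrA; apply: A1_D; first by apply: A1_M; [exact: mua_A1|exact: A1_t].
exact/A1_Z/A1_one.
Qed.

Lemma h_A1 f : A1 (h f).
Proof.
elim/poly_ind: f => [|f c IHf]; first by rewrite /h Fp_inE !rmorph0; apply: A1_0.
have -> : h (f * 'X + c%:P) = h f * w + (Fp_in k c)%:A.
  by rewrite -hXw -hM -hC /h Fp_inE !rmorphD.
by apply: A1_D; [apply: A1_M | exact/A1_Z/A1_one].
Qed.

(** Evaluation in the algebra mu_a A_1 with unity mu_a; it is multiplicative and kills the multiples
    of psi. *)
Let ev f := h f * mua a.

Let muC u : A1 u -> u * mua a = mua a * u.
Proof. by move=> uA; apply: (A1_comm hp uA (mua_A1 a)). Qed.

Let evE f : ev f = mua a * h f.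
Proof. exact/muC/h_A1. Qed.

Lemma evM f g : ev (f * g) = ev f * ev g.
Proof.
rewrite /ev hM -!mulrA; congr (_ * _).
by rewrite [mua a * (_ * _)]mulrA -(muC (h_A1 g)) -mulrA muaM.
Qed.

Let evX c : ev ('X - c%:P) = mua a * (t + (Fp_in k (sg - c))%:A).
Proof.
rewrite evE hB hXw hC /w -addrA -scalerBl mulrDr -[mua a * Y 1 * X 1]mulrA.
by rewrite mulrA muaM mulrDr; congr (_ + mua a * (_ *: _)); rewrite !Fp_inE rmorphB.
Qed.

Lemma two_al : 2%:R * al = a%:R + 1.
Proof. by rewrite /al mulrC divfK // (two_neq0 two_half). Qed.

(** With 2 al = a + 1, the factor YX - m (a + 1 + m) of [mua_YXS] equals YX + al^2 - (al + m)^2. *)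
Lemma ev_W m : ev (W m) = mua a * YX m.
Proof.
elim: m => [|m IHm].
  rewrite /W big_ord0 evE; congr (_ * _); rewrite mul1r.
  by rewrite /h Fp_inE !rmorph1.
rewrite /W big_ord_recr /= evM -/(W m) IHm evX mua_YXS.
rewrite mulrA -[X in X * _](A1_comm hp (mua_A1 a)); last first.
  by apply: A1_M; [exact: mua_A1 | exact: YnXn_A1].
rewrite [X in X * _]mulrA muaM; congr (_ * (_ + _)).
rewrite -scaleNr; congr (_ *: _); rewrite Fp_inE.
have -> : sg - (al + m%:R) ^+ 2 = - (m%:R * (2%:R * al + m%:R)).
  by rewrite /sg; ring.
by rewrite two_al rmorphN rmorphM !rmorphD rmorph1 !rmorph_nat.
Qed.

Let Psi : {poly F} := \prod_(i : F) ('X - (i ^+ 2)%:P).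

Lemma W_p : W p = Psi.
Proof.
have inj : injective (fun l : 'I_p => al + (l%:R : F)).
  move=> l l' /addrI e; apply/val_inj.
  have := congr1 (@nat_of_ord _) e; rewrite !val_Fp_nat //.
  by rewrite !modn_small.
have bij := inj_card_bij inj; rewrite card_Fp // card_ord in bij.
rewrite /Psi (reindex _ (onW_bij _ (bij (leqnn _)))).
by [].
Qed.

(** The nodes al + l, l < p, exhaust F_p, so psi is W p and evaluates to mu_a Y^p X^p = 0. *)
Lemma ev_Psi_dvd f : Psi %| f -> ev f = 0.
Proof.
by move=> /dvdpP [q ->]; rewrite evM -W_p ev_W X1_ge_p // !mulr0.
Qed.

Lemma ev_sum (c : nat -> F) n :
  ev (\sum_(m < n) c m *: W m) =
  mua a * \sum_(m < n) Fp_in k (c m) *: YX m.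
Proof.
have evD f g : ev (f + g) = ev f + ev g.
  by rewrite /ev /h Fp_inE !rmorphD mulrDl.
have ev0 : ev 0 = 0 by rewrite /ev /h Fp_inE !rmorph0 mul0r.
rewrite (big_morph ev evD ev0) mulr_sumr; apply: eq_bigr => m _.
rewrite -mul_polyC evM ev_W evE hC mulrA mulr_algr -scalerAl -scalerAl -scalerAr.
by rewrite muaM.
Qed.

Definition idem1 (j : F) : A := ev (prim_poly j).

Lemma idem1_A1 j : A1 (idem1 j).
Proof. by rewrite /idem1 evE; apply: A1_M (mua_A1 a) (h_A1 _). Qed.

Lemma mua_idem1 j : mua a * idem1 j = idem1 j.
Proof. by rewrite /idem1 evE mulrA muaM. Qed.

Lemma idem1M j : idem1 j * idem1 j = idem1 j.
Proof.
rewrite -evM; apply/eqP; rewrite -subr_eq0 -mulrBl -hB.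
apply/eqP; apply: ev_Psi_dvd.
exact: (prim_poly_idem cardFp half_gt0 two_half).
Qed.

(** By [ev_W] the coefficients c_m are the Newton coefficients of psi_j at the nodes (al + l)^2, and
    the first s vanish because W s divides psi_j. *)
Lemma idem1_coef j s :
  (forall l, (l < s)%N -> (al + l%:R) ^+ 2 != j ^+ 2) ->
  (forall l l', (l < l' < s)%N -> (al + l%:R) ^+ 2 != (al + l'%:R) ^+ 2) ->
  exists c : nat -> F, (forall m, (m < s)%N -> c m = 0) /\
    idem1 j = mua a * \sum_(m < p) Fp_in k (c m) *: YX m.
Proof.
move=> lj ll'.
have sz : (size (prim_poly j) <= p)%N.
  have := size_prim_poly cardFp half_gt0 two_half j.
  by rewrite -cardFp card_Fp.
have dv := W_dvd_prim_poly two_half lj ll'.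
have [c [c0 cE]] := newton_basis (node := fun l => (al + l%:R) ^+ 2) sz dv.
by exists c; split=> //; rewrite /idem1 cE ev_sum.
Qed.

Lemma idem1_kill j w0 i : Psi %| W w0 * prim_poly j -> (w0 <= i < p)%N ->
  Y i * X i * idem1 j = 0.
Proof.
move=> dv /andP [wi ip].
have i0 := fact_neq0 hp ip.
apply: (scalerI (mulf_neq0 i0 i0)); rewrite scaler0.
have -> : (i`!%:R * i`!%:R) *: (Y i * X i * idem1 j) = YX i * idem1 j.
  by rewrite X1_exp Y1_exp -!scalerAl -!scalerAr -!scalerAl scalerA.
have -> : idem1 j = mua a * idem1 j by rewrite /idem1 evE mulrA muaM.
rewrite mulrA (muC (YnXn_A1 hp d i)) -ev_W -evM; apply: ev_Psi_dvd.
apply: dvdp_trans dv _; apply: dvdp_mul => //.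
rewrite /W -[X in _ %| X](big_mkord xpredT (fun l => 'X - ((al + l%:R) ^+ 2)%:P)).
rewrite (big_cat_nat _ wi) //= big_mkord; exact: dvdp_mulIl.
Qed.

Lemma mod_eq_close (m n : nat) :
  m = n %[mod p] -> (m < n + p)%N -> (n < m + p)%N -> m = n.
Proof.
wlog mn : m n / (m <= n)%N.
  move=> wl mn; case/orP: (leq_total m n) => e h1 h2; first exact: wl.
  by apply/esym; apply: wl.
move=> /eqP; rewrite eq_sym eqn_mod_dvd // => dv _ nm.
apply/eqP; rewrite eqn_leq mn /= -subn_eq0; apply: contraLR dv.
by rewrite -lt0n => e; rewrite gtnNdvd //; lia.
Qed.

Lemma natF_eq (m n : nat) : m%:R = n%:R :> F -> m = n %[mod p].
Proof. by move=> /(congr1 (@nat_of_ord _)); rewrite !val_Fp_nat. Qed.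

Lemma two_node l : 2%:R * (al + l%:R) = (a + 1 + 2 * l)%:R.
Proof. by rewrite natrD natrM natrD mulrDr two_al. Qed.

Lemma node_sqr l y b : 2%:R * y = b%:R -> (al + l%:R) ^+ 2 = y ^+ 2 ->
  a + 1 + 2 * l = b %[mod p] \/ a + 1 + 2 * l + b = 0 %[mod p].
Proof.
move=> yb /eqP; rewrite eqf_sqr => /orP [] /eqP e.
  by left; apply: natF_eq; rewrite -two_node e.
by right; apply: natF_eq; rewrite natrD -two_node e mulrN -yb addNr.
Qed.

Definition shift1 : nat := if odd a then (p - a)./2 else (p - a + 1)./2.
Definition twisted (j : nat) : bool :=
  if odd a then (2 * j < a)%N else (p < 2 * j + a)%N.

Lemma mod0_two (m : nat) : m = 0 %[mod p] -> (0 < m < 2 * p)%N -> m = p.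
Proof.
move=> m0 /andP [m_gt0 m2p]; apply: mod_eq_close.
- by rewrite m0 mod0n modnn.
- by lia.
- by lia.
Qed.

(** An equality of squares would give a + 1 + 2l = 2j or -2j modulo p, which the size and parity of
    the numbers exclude. *)
Lemma twisted_nodes j l : (2 * j < p)%N -> twisted j -> (l < shift1)%N ->
  (al + l%:R) ^+ 2 != (j%:R : F) ^+ 2.
Proof.
move=> jp tw ls; apply/eqP => /(@node_sqr _ _ (2 * j)) e.
have {e} [|e|e] := e; first by rewrite natrM.
  have := mod_eq_close e; move: tw ls; rewrite /twisted /shift1.
  by move: p_odd ap; case: ifP => oa; lia.
have := mod0_two e; move: tw ls; rewrite /twisted /shift1.
by move: p_odd ap; case: ifP => oa; lia.
Qed.

Lemma shift_nodes l l' : (l < l' < shift1)%N ->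
  (al + l%:R) ^+ 2 != (al + l'%:R) ^+ 2.
Proof.
move=> /andP [ll' ls]; apply/eqP => /(node_sqr (two_node l')) [] e.
  have := mod_eq_close e; move: ll' ls; rewrite /shift1.
  by move: p_odd ap; case: ifP => oa; lia.
have := mod0_two e; move: ll' ls; rewrite /shift1.
by move: p_odd ap; case: ifP => oa; lia.
Qed.

Lemma node_eq l b y : 2%:R * y = b%:R -> a + 1 + 2 * l = b %[mod p] ->
  al + l%:R = y.
Proof.
move=> yb e; apply: (mulfI (two_neq0 two_half)); rewrite two_node yb.
by apply/val_inj; rewrite /= !val_Fp_nat.
Qed.

(** For the types (B) and (D) both j and -j occur among al + l with l < p - a. *)
Lemma untwisted_kill j : (2 * j < p)%N -> ~~ twisted j ->
  Psi %| W (p - a) * prim_poly (j%:R : F).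
Proof.
move=> jp tw; have p0 := prime_gt0 p_pr.
have [l [l' [lw l'w al1 al2]]] : exists l l', [/\ (l < p - a)%N,
    (l' < p - a)%N, al + l%:R = j%:R & al + l'%:R = - j%:R :> F].
  move: tw; rewrite /twisted; case: ifP => oa tw.
    exists (j - (a + 1)./2)%N, (p - j - (a + 1)./2)%N; split.
    - by move: p_odd ap; lia.
    - by move: p_odd ap; lia.
    - apply: (@node_eq _ (2 * j)); first by rewrite natrM.
      by congr (_ %% _)%N; move: p_odd ap; lia.
    - apply: (@node_eq _ (2 * (p - j))).
        rewrite natrM natrB; last by lia.
        by rewrite (pcharf0 (pchar_Fp p_pr)) sub0r.
      by congr (_ %% _)%N; move: p_odd ap; lia.
  (* For even a the index (p - a - 1)/2 is the one with al + l = 0; the two witnesses lie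
     symmetrically around it. *)
  exists ((p - a - 1)./2 + j)%N, ((p - a - 1)./2 - j)%N; split.
  - by move: p_odd ap; lia.
  - by move: p_odd ap; lia.
  - apply: (@node_eq _ (2 * j)); first by rewrite natrM.
    rewrite -(modnDl (2 * j) p); congr (_ %% _)%N.
    by move: p_odd ap; lia.
  - apply: (@node_eq _ (p - 2 * j)).
      rewrite natrB; last by lia.
      by rewrite (pcharf0 (pchar_Fp p_pr)) sub0r natrM mulrN.
    by congr (_ %% _)%N; move: p_odd ap; lia.
have [j0|j0] := eqVneq (j%:R : F) 0.
  by rewrite j0; apply: (@Psi_dvd_W0 _ al _ l); rewrite ?al1.
exact: (Psi_dvd_W two_half j0 lw l'w al1 al2).
Qed.

End Eval.

(* What the induction step needs to know about B(a, j); [ac] says that the    *)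
(* type is (A) or (C), and a' is the weight a + 2s met behind Y^s.            *)
Definition level1 (a s : nat) (ac : bool) (B : A) : Prop :=
  [/\ (a < p)%N, A1 B, B * B = B /\ mua a * B = B,
    exists c : 'I_p -> 'F_p, (ac -> forall m : 'I_p, (m < s)%N -> c m = 0) /\
      B = mua a * \sum_(m < p) Fp_in k (c m) *: YX m
  & if ac then (s < p)%N /\ exists a', [/\ (a' < p)%N, (a' <= s)%N
       & a' = a + 2 * s %[mod p]]
    else forall i, (p - a <= i < p)%N -> Y i * X i * B = 0].

Lemma level1_odd a j : odd p -> (a < p)%N -> (2 * j < p)%N ->
  level1 a (shift1 a) (twisted a j) (idem1 a j%:R).
Proof.
move=> po ap jp; split=> //.
- exact: idem1_A1.
- by split; [exact: idem1M | exact: mua_idem1].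
- have [tw|tw] := boolP (twisted a j); last first.
    have [|l l' /andP[]|c [_ cE]] := @idem1_coef a po ap j%:R 0; rewrite ?ltn0 //.
    by exists (fun m => c m); split.
  have [||c [c0 cE]] := @idem1_coef a po ap j%:R (shift1 a) => //.
  - by move=> l; apply: twisted_nodes.
  - by move=> l l'; apply: shift_nodes.
  by exists (fun m => c m); split=> // _ m; apply: c0.
have [tw|tw] := ifPn; last first.
  by move=> i ip; apply: (idem1_kill po ap _ ip); apply: untwisted_kill.
split; first by rewrite /shift1; have := prime_gt1 p_pr; case: ifP; lia.
(* Here a + 2s is p for odd a and p + 1 for even a, so the weight behind Y^s is 0 or 1. *)
move: tw; rewrite /twisted /shift1; case: ifP => oa tw.
  exists 0%N; rewrite (prime_gt0 p_pr); split=> //.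
  have -> : (a + 2 * (p - a)./2 = p)%N by lia.
  by rewrite modnn mod0n.
exists 1%N; rewrite (prime_gt1 p_pr); split=> //; first by lia.
have -> : (a + 2 * (p - a + 1)./2 = p + 1)%N by lia.
by rewrite modnDl.
Qed.

Lemma level1_two : p = 2%N ->
  [/\ level1 0 1 false (mua 0),
      level1 1 1 true (mua 1 * t) & level1 1 1 false (mua 1 * t + mua 1)].
Proof.
move=> p2; have two0 : 2%:R = 0 :> k by rewrite -p2 (pcharf0 hp).
have tt : mua 1 * t * t = mua 1 * t.
  (* Here X^2 = 0, and the constant 1 (1 + 1 + 1) is 1 in characteristic 2. *)
  have := mua_YXS 1 1; rewrite !expr1 X1_ge_p ?p2 // !mulr0 mulrBr mulr_algr.
  move=> /esym /eqP; rewrite subr_eq0 => /eqP ->.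
  have -> : 1%:R * (1%:R + 1 + 1%:R) = 1 + 2%:R :> k by ring.
  by rewrite two0 addr0 scale1r.
have dbl (u : A) : u + u = 0.
  by rewrite -mulr2n -[_ *+ _]scaler_nat two0 scale0r.
have mt : t * mua 1 = mua 1 * t by apply: (A1_comm hp (A1_t p d) (mua_A1 1)).
have ee : mua 1 * t * (mua 1 * t) = mua 1 * t.
  move: (mua 1) t (muaM 1) mt tt => u v uu vu uvv.
  by rewrite mulrA -(mulrA u v) vu mulrA uu.
have coef1 a (i : nat) (ip : (i < p)%N) :
    mua a * \sum_(m < p) Fp_in k ((m == i :> nat)%:R : 'F_p) *: YX m =
    mua a * YX i.
  rewrite (bigD1 (Ordinal ip)) //= eqxx (Fp_in_nat hp 1) scale1r.
  rewrite big1 ?addr0 // => m; rewrite -val_eqE /= => /negPf ->.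
  by rewrite (Fp_in_nat hp 0) scale0r.
have kills (i : nat) : (p - 1 <= i < p)%N -> i = 1%N by rewrite p2; lia.
split; split.
- exact: prime_gt0.
- exact: mua_A1.
- by rewrite muaM.
- exists (fun m => (m == 0%N :> nat)%:R); split=> //.
  by rewrite coef1 ?prime_gt0 // !mulr1.
- by move=> i; rewrite subn0; lia.
- by rewrite p2.
- by apply: A1_M; [exact: mua_A1 | exact: A1_t].
- by rewrite ee (mulrA (mua 1) (mua 1)) muaM.
- exists (fun m => (m == 1%N :> nat)%:R); split=> [_ m m1|].
    by rewrite (_ : (m == 1%N :> nat) = false) //; lia.
  by rewrite coef1 ?p2 // !expr1.
- by rewrite p2; split=> //; exists 1%N.
- by rewrite p2.
- by apply: A1_D; [apply: A1_M; [exact: mua_A1 | exact: A1_t] | exact: mua_A1].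
- split; last by rewrite mulrDr (mulrA (mua 1) (mua 1)) muaM.
  rewrite mulrDl !mulrDr muaM ee (mulrA (mua 1) (mua 1)) muaM.
  by rewrite -(mulrA (mua 1) t) mt (mulrA (mua 1) (mua 1)) muaM addrA dbl add0r.
- exists (fun=> 1); split=> //.
  under eq_bigr => m _ do rewrite (Fp_in_nat hp 1) scale1r.
  rewrite -(big_mkord xpredT (fun m => YX m)) p2 2?big_nat_recr ?big_geq //=.
  by rewrite add0r !expr0 !expr1 mulrDr !mulr1 addrC.
- by move=> i /kills ->; rewrite mulrDr mulrA mt tt dbl.
Qed.

(** For the types (A) and (C), mu_a Y^s = Y^s mu_a' brings the element into the form Y^s b Fr(z) X^s
    with b = mu_a' times the sum of the c_m Y^(m-s) X^(m-s). The given coefficients vanish below s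
    because they are unique. *)
Lemma level1_step (Fr : {linear A -> A}) (hFr : forall m n m',
    Fr (Y m * hb 0 n * X m') = Y (m * p) * hb 0 (n * p) * X (m' * p))
    a s ac B (c : 'I_p -> 'F_p) N z :
  level1 a s ac B -> B = mua a * \sum_(m < p) Fp_in k (c m) *: YX m ->
  Dform p d N z -> z * z = z ->
  let E := if ac then mua a * \sum_(m < p | (s <= m)%N) Fp_in k (c m) *:
      (Y 1 ^+ m * X 1 ^+ (m - s) * Fr z * X 1 ^+ s) else Fr z * B in
  Dform p d N.+1 E /\ E * E = E.
Proof.
move=> [ap BA [BB muB] [c' [c'0 BE']]]; case: ac c'0 => [c'0|_]; last first.
  move=> kill _ zD zz E; apply: (Fr_step_idem hp hFr (a := a)) => //.
  by rewrite -mu_th.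
move=> [sp [a' [a'p a's a'E]]] BE zD zz E.
have cc' m : c m = c' m.
  have := YX_coef_uniq (etrans (esym BE) BE') m; rewrite !Fp_inE.
  exact: fmorph_inj.
have c0 (m : 'I_p) : (m < s)%N -> c m = 0 by move=> ms; rewrite cc' c'0.
pose b0 := \sum_(m < p | (s <= m)%N) Fp_in k (c m) *: YX (m - s).
pose b := th 1 (dlt k p 1 a'%:Z) * b0.
have muY : mua a * Y 1 ^+ s = Y 1 ^+ s * th 1 (dlt k p 1 a'%:Z).
  rewrite Y1_exp -scalerAr -scalerAl mu_th (th_Y hp); last exact: dlt_per.
  congr (_ *: (_ * _)); apply: eq_th => x _; rewrite dlt_shift opprK /dlt.
  by rewrite expn1 -PoszD !modz_nat a'E.
have b0A : A1 b0.
  rewrite /b0; elim/big_ind: _ => [||m _]; [exact: A1_0 | exact: A1_D |].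
  exact/A1_Z/YnXn_A1.
have bA : A1 b by apply: A1_M b0A; apply/A1_th/dlt_per.
have EE : E = Y 1 ^+ s * b * Fr z * X 1 ^+ s.
  rewrite /E /b !mulrA -muY -!mulrA; congr (_ * _).
  rewrite /b0 mulr_suml mulr_sumr; apply: eq_bigr => m sm.
  rewrite -scalerAl -scalerAr; congr (_ *: _).
  by rewrite -{1}(subnKC sm) exprD !mulrA.
rewrite EE; apply: (@sandwich_step_idem _ _ hp _ d Fr hFr N z b B s a') => //.
  rewrite /b mulrA (thM hp); congr (_ * _); apply: eq_th => x _.
  by rewrite /dlt; case: eqP; rewrite ?mulr1 ?mulr0.
rewrite BE /b !mulrA -muY -!mulrA; congr (_ * _).
rewrite /b0 mulr_suml mulr_sumr (bigID (fun m : 'I_p => (s <= m)%N)) /=.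
rewrite [X in _ + X]big1 ?addr0 => [|m]; last first.
  by rewrite -ltnNge => /c0 ->; rewrite (Fp_in_nat hp 0) scale0r.
apply: eq_bigr => m sm; rewrite -scalerAl -scalerAr; congr (_ *: _).
by rewrite -mulrA -exprD subnK // mulrA -exprD subnKC.
Qed.

End LevelOne.

(** * The symmetric form *)

Section Corner.
Variables (k : fieldType) (p : nat).
Hypothesis hp : p \in [pchar k].
Variables (A : algType k) (d : hyp_data A).
Local Notation Dform := (Dform p d).
Local Notation Uform := (Uform p d).

Lemma Dform_span r : exists (n : nat) (b : 'I_n -> A),
  (forall i, Dform r (b i)) /\
  forall u, Dform r u -> exists c : 'I_n -> k, u = \sum_i c i *: b i.
Proof.
pose T : finType := ('I_(p ^ r) * 'I_(p ^ r))%type.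
pose b (x : T) := hY d x.1 * th p d r (dlt k p r (x.2 : nat)%:Z) * hX d x.1.
exists #|T|, (fun i => b (enum_val i)); split=> [i|u [phi [pphi ->]]].
  exact: Dform_mon.
exists (fun i : 'I_#|T| => phi (enum_val i).1 ((enum_val i).2 : nat)%:Z).
rewrite -(big_enum_val (A := T) (fun x : T => phi x.1 (x.2 : nat)%:Z *: b x)) /=.
rewrite -(pair_big xpredT xpredT
  (fun m a : 'I_(p ^ r) => phi m (a : nat)%:Z *: b (m, a))) /=.
apply: eq_bigr => m _; rewrite /b /=.
under eq_bigr => a _ do rewrite scalerAl scalerAr -thZ.
rewrite -mulr_suml -mulr_sumr -th_sum; congr (_ * _ * _).
apply: eq_th => x _; under eq_bigr => a _ do rewrite -(dltM _ _ (pphi m)).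
rewrite -mulr_sumr; have := dlt_sum hp r 0 x.
by under eq_bigr => a _ do rewrite addr0; move=> ->; rewrite mulr1.
Qed.

(** The form is lam(x y), symmetric by commutativity. It stays nondegenerate because x v = x (v e)
    whenever x e = x. *)
Lemma Dform_corner_symmetric r e : Dform r e -> e * e = e ->
  is_symmetric_algebra [set x * e | x in Dform r] e.
Proof.
move=> eD ee; have C x y := @Dform_comm _ _ hp _ d r r x y.
have SE x : [set x * e | x in Dform r] x -> Dform r x /\ x * e = x.
  move=> [u uD <-]; split; first exact: (DformM hp).
  by rewrite -mulrA ee.
have ES x : Dform r x -> x * e = x -> [set x * e | x in Dform r] x.
  by move=> xD xe; exists x.
split.
- split.
  + exact: ES.
  + by move=> x /SE [xD xe]; rewrite (C _ _ eD xD).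
  + move=> c x y /SE [xD xe] /SE [yD ye]; apply: ES; first exact: Dform_lc.
    by rewrite mulrDl -scalerAl xe ye.
  + move=> x y /SE [xD xe] /SE [yD ye]; apply: ES; first exact: (DformM hp).
    by rewrite -mulrA ye.
- have [n [b [bD bs]]] := Dform_span r.
  exists n, (fun i => b i * e); split=> [i|x [u /bs [c ->] <-]].
    by exists (b i).
  exists c; rewrite mulr_suml.
  by apply: eq_bigr => i _; rewrite scalerAl.
have [lam [lamD lamZ lamN]] := Dform_frobenius hp d r.
exists (fun x y => lam (x * y)); split.
- by split=> c x y z _ _ _; rewrite ?mulrDl ?mulrDr lamD -?scalerAl -?scalerAr lamZ.
- by move=> x y z _ _ _; rewrite mulrA.
- by move=> x y /SE [xD _] /SE [yD _]; rewrite (C _ _ xD yD).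
move=> x /SE [xD xe] x0; apply: lamN => // v vD.
rewrite -(x0 (v * e)); last by exists v.
by rewrite (C _ _ vD eD) mulrA xe.
Qed.

Lemma Uform_mul_subalg r :
  is_subalg (fun u : A => forall v, Uform r v -> Uform r (u * v)).
Proof.
split=> [v|a u v uS vS w wU|u v uS vS w wU].
- by rewrite mul1r.
- rewrite mulrDl -scalerAl; apply: Uform_lc; [exact: uS|exact: vS].
- by rewrite -mulrA; apply: uS; apply: vS.
Qed.

Lemma th_centralizer_subalg : is_subalg (fun u : A =>
  forall N phi, per p N phi -> th p d N phi * u = u * th p d N phi).
Proof.
split=> [N phi _|a u v uS vS N phi pphi|u v uS vS N phi pphi].
- by rewrite mul1r mulr1.
- by rewrite mulrDl mulrDr -scalerAl -scalerAr uS ?vS.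
- by rewrite mulrA uS // -mulrA vS // mulrA.
Qed.

End Corner.

Section GeneratedSubalg.
Variables (k : fieldType) (G : set (hyperalgebra k)).

Lemma generated_subalgP : is_subalg (generated_subalg G).
Proof.
split=> [S [[S1 _ _] _]|a u v uS vS S SG|u v uS vS S SG].
- by move: S1; rewrite inE.
- have [[_ Slc _] _] := SG; have := Slc a u v; rewrite !inE; apply.
    exact: uS.
  exact: vS.
- have [[_ _ SM] _] := SG; have := SM u v; rewrite !inE; apply.
    exact: uS.
  exact: vS.
Qed.

Lemma generated_subalg_gen u : G u -> generated_subalg G u.
Proof. by move=> Gu S [_]; apply. Qed.

Lemma generated_subalg_min (S : set (hyperalgebra k)) u :
  is_subalg S -> (forall v, G v -> S v) -> generated_subalg G u -> S u.
Proof.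
move=> [S1 Slc SM] GS; apply; split=> //.
by split=> [|a v w|v w]; rewrite !inE //; [exact: Slc | exact: SM].
Qed.

End GeneratedSubalg.

(** * Identification of A_r, and idempotency of E(a, j) *)

Section Concrete.
Variables (k : fieldType) (p : nat).
Hypothesis hp : p \in [pchar k].
Let p_pr : prime p := pcharf_prime hp.
Local Notation d := (hyp_data_U k).

(** An element of U_r has the PBW form [Uform], and lying in A makes it commute with the Cartan
    part, which leaves the terms with equal orders. Conversely such terms are products of generators
    of either algebra, up to units and lower terms. *)
Lemma A_subE r : A_sub p r = Dform p d r.
Proof.
apply/funext => u; apply/propext; split=> [[uA uU]|uD].
  apply: (Uform_weight0 hp).
    have S := Uform_mul_subalg p d r.
    have : forall v, Uform p d r v -> Uform p d r (u * v).
      apply: (generated_subalg_min S _ uU) => _ [i ir [] ->] v.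
        by apply: (Uform_X hp); rewrite ltn_exp2l ?prime_gt1.
      by apply: (Uform_Y hp); rewrite ltn_exp2l ?prime_gt1.
    by move=> /(_ 1 (Uform1 hp d r)); rewrite mulr1.
  apply: (generated_subalg_min (th_centralizer_subalg p d) _ uA).
  move=> _ [i [] ->] N phi pphi; last first.
    exact: (th_YX_comm hp d (p ^ i) pphi).
  rewrite -[U_binom k 0 (p ^ i)]/(hb d 0 (p ^ i)) (@hb_th _ p _ d i.+1); last first.
    by rewrite ltn_exp2l ?prime_gt1.
  by apply: thC.
split.
  apply: (Dform_A hp (generated_subalgP _) _ _ uD) => i.
    by apply: generated_subalg_gen; exists i; left.
  by apply: generated_subalg_gen; exists i; right.
apply: (Dform_U hp (generated_subalgP _) _ _ uD) => i ir.
  by apply: generated_subalg_gen; exists i => //; left.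
by apply: generated_subalg_gen; exists i => //; right.
Qed.

Lemma B1_odd a i : p != 2%N -> B1 k p false (a, i%:R) = @idem1 k p _ d a i%:R.
Proof. by rewrite /B1 => /negPf ->; rewrite ratr_nat. Qed.

Lemma twistedE a i : odd p -> (a < p)%N -> (i <= (p.-1)./2)%N ->
  typeA p (a, i%:R) || typeC (a, i%:R) = twisted p a i.
Proof.
move=> po ap ip; rewrite /typeA /typeC /twisted /=.
have ip1 : (2 * i <= p.-1)%N by lia.
have p1E : (p.-1)%:R = p%:R - 1 :> rat.
  by rewrite -[p in RHS](prednK (prime_gt0 p_pr)) -natr1 addrK.
case: ifP => oa /=; rewrite ?orbF ?ler0n /=.
  rewrite -[(2 * i < a)%N](ler_nat rat) -[(2 * i).+1]addn1 natrD natrM.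
  by apply/idP/idP => h; lra.
rewrite -[(p < _)%N](ler_nat rat) -[p.+1]addn1 (natrD _ p) (natrD _ (2 * i)) natrM.
move: ip1; rewrite -(ler_nat rat) natrM p1E => ip1.
by apply/idP/idP => [/andP [h _]|h]; [lra | apply/andP; split; lra].
Qed.

Lemma B1_level1 aj : in_P p aj ->
  level1 p d aj.1 (s_shift p aj) (typeA p aj || typeC aj) (B1 k p false aj).
Proof.
have [p2|p2] := eqVneq p 2%N.
  have [l0 l1 l2] := level1_two hp d p2.
  move: l0 l1 l2; rewrite p2 => l0 l1 l2.
  rewrite /in_P eqxx !inE /s_shift /B1 /typeC => /or3P [] /eqP -> /=.
  - by [].
  - have -> : (0 <= (1%:R - 1) / 2%:R :> rat) = true by lra.
    by rewrite -(mulrA (mu k 2 1)).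
  - have -> : (1 <= (1%:R - 1) / 2%:R :> rat) = false by lra.
    by rewrite -(mulrA (mu k 2 1)).
case: aj => a j; rewrite /in_P (negPf p2) => /andP [ap /mapP [i iP jE]].
move: ap iP jE; rewrite mem_iota add0n ltnS => /= ap ip ->.
have po : odd p by case: (even_prime p_pr) p2 => [->|].
rewrite B1_odd // twistedE // /s_shift (negPf p2) /=.
by apply: (level1_odd hp d po ap); lia.
Qed.

Section Steps.
Variable Fr' : {linear hyperalgebra k -> hyperalgebra k}.
Hypothesis hFr' : is_Fr' p Fr'.

(** [level1] provides coefficients, so the choice in [B_coef] succeeds and its default value does
    not occur. *)
Lemma B_coefP aj : in_P p aj -> B1 k p false aj =
  mu k p aj.1%:Z * \sum_(m < p) Fp_in k (B_coef k p false aj m) *: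
     (U_Y k 1 ^+ m * U_X k 1 ^+ m).
Proof.
move=> /B1_level1 [_ _ _ [c [_ cE]] _]; rewrite /B_coef.
case: pickP => [c' /eqP //|/(_ [ffun m => c m]) /eqP []].
by rewrite cE; congr (_ * _); apply: eq_bigr => m _; rewrite ffunE.
Qed.

Lemma Z_map_step aj N z : in_P p aj -> Dform p d N z -> z * z = z ->
  let E := Z_map p Fr' false z aj in Dform p d N.+1 E /\ E * E = E.
Proof.
move=> ajP zD zz.
rewrite /Z_map; apply: (@level1_step k p hp _ d Fr' hFr') zD zz.
  exact: B1_level1.
exact: B_coefP.
Qed.

Lemma B_seq_idem s : s != [::] -> (forall aj, aj \in s -> in_P p aj) ->
  let E := B_seq p Fr' (zip (nseq (size s) false) s) in
  Dform p d (size s) E /\ E * E = E.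
Proof.
elim: s => [//|aj s IHs] _ sP.
have ajP : in_P p aj by apply: sP; rewrite mem_head.
case: s IHs sP => [|aj' s] IHs sP.
  have [_ /(A1_Dform hp) BD [BB _] _ _] := B1_level1 ajP.
  by split.
have [//|x xs|ED EE] := IHs.
  by apply: sP; rewrite inE xs orbT.
exact: (Z_map_step ajP ED EE).
Qed.

End Steps.
End Concrete.

Theorem theorem3p13 (k : closedFieldType) (p : nat) (hp : p \in [pchar k])
    (Fr' : {linear hyperalgebra k -> hyperalgebra k}) (hFr' : is_Fr' p Fr')
    (r : nat) (hr : (1 <= r)%N) (aj : r.-tuple (nat * rat))
    (haj : forall i, in_P p (tnth aj i)) :
  is_symmetric_algebra
    [set x * E_idem p Fr' aj | x in A_sub p r] (E_idem p Fr' aj).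
Proof.
rewrite A_subE //.
have [||ED EE] := @B_seq_idem k p hp Fr' hFr' aj.
- by rewrite -size_eq0 size_tuple -lt0n.
- by move=> x /tnthP [i ->].
rewrite size_tuple in ED EE.
exact: Dform_corner_symmetric.
Qed.
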